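(* Let $\Omega\subset\mathbb R^2$ be a bounded Lipschitz domain with connected complement, $\Gamma$ an open subset of $\partial\Omega$, $k\in\mathbb R_+$, and let $v,w\in H^1(\Omega)$ be a pair of transmission eigenfunctions associated with $k$, i.e. a nontrivial pair satisfying $$\Delta w+k^2 q w=0\ \text{ in }\Omega,\qquad \Delta v+k^2 v=0\ \text{ in }\Omega,\qquad w=v,\ \ \partial_\nu w=\partial_\nu v\ \text{ on }\Gamma .$$ Suppose $\mathbf 0\in\Gamma$ and $\Omega\cap B_h=\mathcal K\cap B_h=S_h$, where $\mathcal K=\{\mathbf x\in\mathbb R^2:\theta_m<\arg(x_1+\mathrm i x_2)<\theta_M\}$ is a convex sector ($-\pi<\theta_m<\theta_M<\pi$, $0<\theta_M-\theta_m<\pi$) and $h\in\mathbb R_+$ is sufficiently small such that $q\in H^2(\overline{S_h})$ and $q(\mathbf 0)\ne1$. Then the following hold. (a) Let $\beta,\gamma$ be given positive constants with $\gamma<\beta$. If there are Herglotz wave functions $v_j(\mathbf x)=\int_{\mathbb S^1}e^{\mathrm i k\xi\cdot\mathbf x}g_j(\xi)\,\mathrm d\xi$, $j=1,2,\dots$, with $g_j\in L^2(\mathbb S^1)$, such that $\|v-v_j\|_{H^1(S_h)}\le j^{-\beta}$ and $\|g_j\|_{L^2(\mathbb S^1)}\le j^\gamma$, then $$\lim_{\lambda\to+0}\frac{1}{m(B(\mathbf 0,\lambda)\cap\Omega)}\int_{B(\mathbf 0,\lambda)\cap\Omega}|v(\mathbf x)|\,\mathrm d\mathbf x=0,$$ where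 $m$ denotes area. (b) If $v\in C^\alpha(\overline{S_h})$ with $\alpha\in(0,1)$, then $v(\mathbf 0)=0$.
   Context: $q=1+V$ with $V\in L^\infty(\Omega)$ complex-valued; $\nu$ is the exterior unit normal to $\partial\Omega$. $B_h$ (resp. $B(\mathbf 0,\lambda)$) is the open disc of radius $h$ (resp. $\lambda$) centered at the origin, and $S_h=\mathcal K\cap B_h$. *)

(* Defs.v *)
From HB Require Import structures.
From mathcomp Require Import all_boot all_order all_algebra.
From mathcomp Require Import all_classical all_reals all_analysis.
From mathcomp Require Import complex.

Set Implicit Arguments.
Unset Strict Implicit.
Unset Printing Implicit Defensive.
Import Order.TTheory GRing.Theory Num.Theory.
Import numFieldNormedType.Exports.
Local Open Scope classical_set_scope.
Local Open Scope ring_scope.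
Local Open Scope complex_scope.

(* The library's norm on a product is the sup norm: [enorm] below is the
   Euclidean one. *)
Notation plane R := (R * R)%type.

Section Geometry.
Context {R : realType}.
Implicit Types (x p e : plane R) (Omega Gamma : set (plane R)) (f : R -> R).

Definition dot x y : R := x.1 * y.1 + x.2 * y.2.

Definition enorm x : R := Num.sqrt (x.1 ^+ 2 + x.2 ^+ 2).

Definition disc p (r : R) : set (plane R) := [set x | enorm (x - p) < r].

(* The set of x with tm < arg (x_1 + i x_2) < tM: as arg takes its values in
   (-pi, pi] and is undefined at the origin, this is the set below when
   -pi < tm and tM < pi. *)
Definition sector (tm tM : R) : set (plane R) :=
  [set x | exists r t : R,
     [/\ 0 < r, tm < t, t < tM & x = (r * cos t, r * sin t)]].

Definition bdry (A : set (plane R)) : set (plane R) := closure A `\` A°.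

Definition rot90 e : plane R := (- e.2, e.1).

(* In the disc of centre p and radius r, and in the orthonormal coordinates
   given by (e, rot90 e), Omega is the region above the graph of the
   Lipschitz function f. *)
Definition graph_chart Omega p (r : R) e f : Prop :=
  [/\ 0 < r, enorm e = 1, lipschitz f &
      forall x, disc p r x -> (Omega x <-> f (dot x e) < dot x (rot90 e))].

Definition graph_curve e f (t : R) : plane R := t *: e + f t *: rot90 e.

Definition lipschitz_domain Omega : Prop :=
  [/\ open Omega, connected Omega &
      forall p, bdry Omega p -> exists r e f, graph_chart Omega p r e f].

Definition rel_open (A Gamma : set (plane R)) : Prop :=
  exists2 U : set (plane R), open U & Gamma = A `&` U.

End Geometry.

Section SmoothFunctions.
Context {R : realType}.

Definition axis (i : bool) : plane R := if i then (0, 1) else (1, 0).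

Fixpoint Ck (n : nat) (f : plane R -> R) : Prop :=
  continuous f /\
  if n is m.+1 then
    forall i, (forall x, derivable f x (axis i)) /\ Ck m ('D_(axis i) f)
  else True.

Definition smooth (f : plane R -> R) : Prop := forall n, Ck n f.

Definition csmooth (f : plane R -> R[i]) : Prop :=
  smooth (fun x => complex.Re (f x)) /\ smooth (fun x => complex.Im (f x)).

Definition supp (f : plane R -> R) : set (plane R) :=
  closure [set x | f x != 0].

(* Test functions may be taken real-valued, the pairings below being linear. *)
Definition test_fun (D : set (plane R)) (phi : plane R -> R) : Prop :=
  [/\ smooth phi, compact (supp phi) & supp phi `<=` D].

Definition laplacian (phi : plane R -> R) (x : plane R) : R :=
  'D_(axis false) ('D_(axis false) phi) x +
  'D_(axis true) ('D_(axis true) phi) x.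

End SmoothFunctions.

Section LebesgueSpaces.
Context {R : realType}.
Implicit Types (D : set (plane R)) (u v : plane R -> R[i]).

Definition area : {measure set (measurableTypeR R * measurableTypeR R) -> \bar R} :=
  (@lebesgue_measure R \x @lebesgue_measure R)%E.

Definition Cintegral d (T : measurableType d) (mu : {measure set T -> \bar R})
    (D : set T) (u : T -> R[i]) : R[i] :=
  (\int[mu]_(x in D) complex.Re (u x)) +i* (\int[mu]_(x in D) complex.Im (u x)).

Definition Cmeasurable d (T : measurableType d) (D : set T)
    (u : T -> R[i]) : Prop :=
  measurable_fun D (fun x => complex.Re (u x)) /\
  measurable_fun D (fun x => complex.Im (u x)).

Definition sqint d (T : measurableType d) (mu : {measure set T -> \bar R})
    (D : set T) (u : T -> R[i]) : \bar R :=
  (\int[mu]_(x in D) ((Normc.normc (u x)) ^+ 2)%:E)%E.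

Definition L2 d (T : measurableType d) (mu : {measure set T -> \bar R})
    (D : set T) (u : T -> R[i]) : Prop :=
  Cmeasurable D u /\ (sqint mu D u < +oo)%E.

Definition ae_eq_on D u v : Prop := {ae area, forall x, D x -> u x = v x}.

Definition Linfty D u : Prop :=
  Cmeasurable (D : set (measurableTypeR R * measurableTypeR R)) u /\
  exists M : R, {ae area, forall x, D x -> Normc.normc (u x) <= M}.

End LebesgueSpaces.

Section SobolevSpaces.
Context {R : realType}.
Implicit Types (D Omega Gamma : set (plane R)) (u g : plane R -> R[i]).

Definition is_wpartial D (i : bool) u g : Prop :=
  L2 area D g /\
  forall phi, test_fun D phi ->
    Cintegral area D (fun x => u x * ('D_(axis i) phi x)%:C) =
    - Cintegral area D (fun x => g x * (phi x)%:C).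

Fixpoint Hk (m : nat) D u : Prop :=
  L2 area D u /\
  if m is m'.+1 then forall i, exists2 g, is_wpartial D i u g & Hk m' D g
  else True.

Definition wpartial D (i : bool) u : plane R -> R[i] :=
  xget (fun=> 0) [set g | is_wpartial D i u g].

Definition H1norm D u : \bar R :=
  ((sqint area D u + sqint area D (wpartial D false u)
    + sqint area D (wpartial D true u)) `^ 2^-1)%E.

Definition is_wlaplacian D u g : Prop :=
  L2 area D g /\
  forall phi, test_fun D phi ->
    Cintegral area D (fun x => u x * (laplacian phi x)%:C) =
    Cintegral area D (fun x => g x * (phi x)%:C).

Definition wlaplacian D u : plane R -> R[i] :=
  xget (fun=> 0) [set g | is_wlaplacian D u g].

(* The trace of u on the relatively open part Gamma of the boundary is g:
   smooth functions converging to u in H^1(Omega) have restrictions to Gamma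
   converging to g in L^2 of the arc length, computed in the local graphs
   (by compactness finitely many of them cover the boundary). *)
Definition has_trace Omega Gamma u g : Prop :=
  exists phi : nat -> plane R -> R[i],
  [/\ forall n, csmooth (phi n),
      H1norm Omega (fun x => phi n x - u x) @[n --> \oo] --> 0%E &
      forall p r e f, graph_chart Omega p r e f ->
        let J : set (measurableTypeR R) :=
          [set t | (Gamma `&` disc p r) (graph_curve e f t)] in
        Cmeasurable J (g \o graph_curve e f) /\
        (\int[@lebesgue_measure R]_(t in J)
           (Normc.normc (phi n (graph_curve e f t) - g (graph_curve e f t)) ^+ 2
            * Num.sqrt (1 + derive1 f t ^+ 2))%:E)%E @[n --> \oo] --> 0%E].

Definition eq_trace Omega Gamma u v : Prop :=
  exists2 g, has_trace Omega Gamma u g & has_trace Omega Gamma v g.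

(* The exterior normal derivative of u in H^1(Omega) with Laplacian in L^2 is
   the functional on traces given by Green's formula:
   <d_nu u, phi> = \int_Omega (grad u . grad phi + phi Delta u). *)
Definition normal_derivative Omega u (phi : plane R -> R) : R[i] :=
  Cintegral area Omega (fun x =>
    wpartial Omega false u x * ('D_(axis false) phi x)%:C +
    wpartial Omega true u x * ('D_(axis true) phi x)%:C +
    wlaplacian Omega u x * (phi x)%:C).

Definition eq_normal_derivative Omega Gamma u v : Prop :=
  forall phi, test_fun setT phi -> supp phi `&` bdry Omega `<=` Gamma ->
    normal_derivative Omega u phi = normal_derivative Omega v phi.

(* The two equations hold in the sense of distributions; the
   pair is nontrivial if v and w do not both vanish almost everywhere. *)
Definition transmission_eigenfunctions Omega Gamma (k : R) (q v w : plane R -> R[i])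
    : Prop :=
  [/\ Hk 1 Omega v /\ Hk 1 Omega w,
      ~ (ae_eq_on Omega v (fun=> 0) /\ ae_eq_on Omega w (fun=> 0)),
      is_wlaplacian Omega w (fun x => - ((k ^+ 2)%:C * q x * w x)),
      is_wlaplacian Omega v (fun x => - ((k ^+ 2)%:C * v x)) &
      eq_trace Omega Gamma w v /\ eq_normal_derivative Omega Gamma w v].

(* Pointwise values on the closure of D of a class of functions on D are those
   of its representative continuous up to the boundary. *)
Definition continuous_rep D u U : Prop :=
  [/\ {within closure D, continuous (fun x => complex.Re (U x))},
      {within closure D, continuous (fun x => complex.Im (U x))} &
      ae_eq_on D u U].

Definition hoelder_on (alpha : R) (A : set (plane R)) u : Prop :=
  exists M : R, forall x y, A x -> A y ->
    Normc.normc (u x - u y) <= M * enorm (x - y) `^ alpha.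

End SobolevSpaces.

Section Herglotz.
Context {R : realType}.

Definition circle_pt (t : R) : plane R := (cos t, sin t).

Definition period : set (measurableTypeR R) := [set` `[0, 2 * pi]].

Definition expi (t : R) : R[i] := cos t +i* sin t.

(* The unit circle carries the arc length, through its parametrization by
   angles. *)
Definition L2_circle (g : plane R -> R[i]) : Prop :=
  L2 (@lebesgue_measure R) period (g \o circle_pt).

Definition L2_circle_norm (g : plane R -> R[i]) : \bar R :=
  (sqint (@lebesgue_measure R) period (g \o circle_pt) `^ 2^-1)%E.

Definition herglotz (k : R) (g : plane R -> R[i]) (x : plane R) : R[i] :=
  Cintegral (@lebesgue_measure R) period
    (fun t => expi (k * dot (circle_pt t) x) * g (circle_pt t)).

End Herglotz.

(* Main.v *)
(** In an orthonormal frame at the corner the domain is the cone [y2 > c |y1|].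
    Test the difference of the two equations with the harmonic function
    exp(-tau y2) cos(tau y1), truncated away from the corner. By Green's formula, and
    because w - v has zero Cauchy data on the two edges, the only terms that survive
    are those on the support of the truncation, which are exponentially small, and
    k^2 times the integral of (1 - q) v - q (w - v) against the test function. A
    weighted Poincare inequality on the cone shows that w - v, whose trace on the edges
    vanishes, contributes o(tau^-2), whereas the integral of the test function itself
    is asymptotic to 2c / ((1 + c^2) tau^2), which is not 0. Hence (q(0) - 1) v(0) = 0
    when v is Hoelder continuous. For Herglotz approximants, the same computation with
    tau = j^sigma and gamma < sigma < beta gives v_j(0) -> 0, since the error v - v_j
    costs tau j^(-beta) and the oscillation of v_j costs j^gamma / tau; the averages of
    |v| are then compared with |v_j(0)| for j^sigma of the order of the inverse radius. *)

From HB Require Import structures.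
Require Import Defs.
From mathcomp Require Import all_boot all_order all_algebra.
From mathcomp Require Import all_classical all_reals all_analysis.
From mathcomp Require Import complex ring lra measurable_realfun.
Set Implicit Arguments.
Unset Strict Implicit.
Unset Printing Implicit Defensive.
Import Order.TTheory GRing.Theory Num.Theory.
Import numFieldNormedType.Exports.
Local Open Scope classical_set_scope.
Local Open Scope ring_scope.
Local Open Scope complex_scope.


(** * Functions closed under differentiation *)

Section Tower.
Context {R : realType}.

(** The scale tau^(-2) is critical: with a plain Poincare inequality, w - v would contribute at the
    same order as the main term. The gain comes from keeping the weight exp(- tau c |t|), t the
    abscissa across the axis, on the gradient side: for a fixed L^2 gradient this weighted energy
    tends to 0, without any rate. Traces are given only as limits of smooth functions, so Green's
    formula on the cone has to be derived. The same Poincare inequality, with the indicator of a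
    thin strip as weight, makes w - v so small near the edges that a cutoff there disappears in the
    limit. Test functions are real: the real part of the complex exponential already has an integral
    of exact order tau^(-2), and complex data are split into real and imaginary parts. For Herglotz
    waves no bound on v_j(0) uniform in j is at hand, while it multiplies q - q(0) in the error.
    Estimates are made relative to 1 + |v_j(0)|, and the unknown is absorbed at the end. Closeness
    to a corner value always enters as a bound a + b y2: multiplied by tau^2, the first term costs
    O(a), the second O(b / tau). *)

Definition tower (d : nat -> R -> R) :=
  forall n (x : R), is_derive x (1 : R) (d n) (d n.+1 x).

Lemma tower_expR : tower (fun=> expR).
Proof. by move=> n x; exact: is_derive_expR. Qed.

(** Differentiation shifts the phase of cos by pi / 2, so one formula covers all orders. *)
Lemma tower_cos : tower (fun n x => cos (x + n%:R * (pi / 2))).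
Proof.
move=> n x.
have -> : cos (x + n.+1%:R * (pi / 2)) = - sin (x + n%:R * (pi / 2)) * 1 :> R.
  by rewrite -natr1 mulrDl mul1r addrA cosDpihalf mulr1.
exact: (is_derive1_comp (is_derive_cos _) (is_derive_shift x 1 (n%:R * (pi / 2)))).
Qed.

Lemma pow_expRN_le (n : nat) (y : R) :
  0 <= y -> y ^+ n * expR (- y) <= n.+1`!%:R.
Proof.
move=> y0; rewrite expRN ler_pdivrMr ?expR_gt0//.
case: n => [|n].
  rewrite expr0 mul1r.
  have := expR_ge1Dxn 0 y0; rewrite expr1 divr1.
  by apply: le_trans; rewrite lerDl.
have fac_gt0 : 0 < (n.+1)`!%:R :> R by rewrite ltr0n fact_gt0.
have : y ^+ n.+1 <= (n.+1)`!%:R * expR y.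
  rewrite mulrC -ler_pdivrMr//; apply: le_trans (expR_ge1Dxn n y0).
  by rewrite lerDr.
move=> /le_trans; apply; rewrite ler_wpM2r ?expR_ge0// ler_nat.
by rewrite (factS n.+1) leq_pmull.
Qed.

(** Horner induction on the polynomial, for all k at once: the factor X of X p + c raises the power
    of y from k to k + 1. *)
Lemma poly_expRN_bounded (p : {poly R}) (k : nat) :
  exists C, forall y, 0 <= y -> `|p.[y]| * y ^+ k * expR (- y) <= C.
Proof.
elim/poly_ind: p k => [|p c IH] k.
  by exists 0 => y _; rewrite horner0 normr0 !mul0r.
have [C HC] := IH k.+1.
exists (C + `|c| * k.+1`!%:R) => y y0; rewrite hornerMXaddC.
apply: (@le_trans _ _ (`|p.[y]| * y ^+ k.+1 * expR (- y)
                       + `|c| * (y ^+ k * expR (- y)))).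
  rewrite mulrA -mulrDl ler_wpM2r ?expR_ge0// exprS mulrA -mulrDl.
  rewrite ler_wpM2r ?exprn_ge0//.
  by apply: le_trans (ler_normD _ _) _; rewrite normrM (ger0_norm y0).
by apply: lerD; [exact: HC | rewrite ler_wpM2l ?normr_ge0// pow_expRN_le].
Qed.

Lemma is_derive0_square (f : R -> R) (C : R) :
  (forall h, `|f h| <= C * h ^+ 2) -> is_derive (0 : R) (1 : R) f 0.
Proof.
move=> fC.
have f0 : f 0 = 0.
  by apply/normr0_eq0/eqP; rewrite eq_le normr_ge0 andbT (le_trans (fC 0))// expr0n mulr0.
have cvg0 : h^-1 *: (f (h *: 1 + 0) - f 0) @[h --> 0^'] --> (0 : R).
  apply/cvgr0Pnorm_lt => e e0.
  have C1 : 0 < `|C| + 1 by rewrite ltr_wpDl.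
  near=> h.
  have h0 : h != 0 by near: h; exact: nbhs_dnbhs_neq.
  rewrite f0 subr0 addr0 /GRing.scale/= mulr1 normrM normfV.
  rewrite ltr_pdivrMl ?normr_gt0//.
  apply: (@le_lt_trans _ _ (C * h ^+ 2)) => //.
  have -> : h ^+ 2 = `|h| * `|h| by rewrite -normrM -expr2 ger0_norm ?sqr_ge0.
  rewrite mulrCA ltr_pM2l ?normr_gt0//.
  apply: (@le_lt_trans _ _ ((`|C| + 1) * `|h|)).
    by rewrite ler_wpM2r// (le_trans (ler_norm _))// lerDl.
  rewrite mulrC -ltr_pdivlMr//.
  by near: h; apply: dnbhs0_lt; rewrite divr_gt0.
apply: DeriveDef; first by apply/cvg_ex; exists 0.
by rewrite /derive; apply/cvg_lim => //.
Unshelve. all: by end_near. Qed.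

(** Differentiating p(1/x) exp(-1/x) gives x^(-2) (p - p')(1/x) exp(-1/x), whence the recursion. *)
Fixpoint flat_poly n : {poly R} :=
  if n is m.+1 then 'X ^+ 2 * (flat_poly m - (flat_poly m)^`()) else 1.

(* The n-th derivative of exp(-1/x), extended by 0 to x <= 0. *)
Definition flat n (x : R) : R :=
  if 0 < x then (flat_poly n).[x^-1] * expR (- x^-1) else 0.

Lemma tower_flat : tower flat.
Proof.
move=> n x; have [x0|x0|<-] := ltgtP 0 x.
- rewrite {2}/flat x0.
  have xinv : is_derive x 1 (fun y : R => y^-1) (- x ^- 2).
    have := @is_deriveV _ id x 1 1; rewrite /GRing.scale/= mulr1; apply.
    by rewrite gt_eqF.
  have xninv : is_derive x 1 (fun y : R => - y^-1) (x ^- 2).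
    by rewrite -[x ^- 2]opprK; exact: is_deriveN.
  have dp := is_derive1_comp (is_derive_poly (flat_poly n) x^-1) xinv.
  have de := @is_derive1_comp _ expR (fun y : R => - y^-1) x _ _
    (is_derive_expR (- x^-1)) xninv.
  apply: (@near_eq_is_derive _ _ _
    (fun y : R => (flat_poly n).[y^-1] * expR (- y^-1))).
  + near=> y; rewrite /flat ifT//; near: y; exact: lt_nbhsr.
  + apply: is_derive_eq (is_deriveM dp de) _.
    rewrite /= /GRing.scale/= hornerM hornerXn hornerD hornerN -exprVn; ring.
- rewrite {2}/flat ltNge (ltW x0)/=.
  apply: (@near_eq_is_derive _ _ _ (cst 0)).
  near=> y; rewrite /flat ifF//; apply/negbTE; rewrite -leNgt ltW//.
  by near: y; exact: lt_nbhsl.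
- rewrite {2}/flat ltxx.
  (* With y = 1/h, the boundedness of |p(y)| y^2 exp(-y) reads |flat n h| <= C h^2, so the
     derivative at 0 is 0. *)
  have [C HC] := poly_expRN_bounded (flat_poly n) 2.
  apply: (@is_derive0_square _ C) => h.
  have C0 : 0 <= C by apply: le_trans (HC 0 (lexx _)); rewrite expr0n mulr0 mul0r.
  rewrite /flat; case: ifP => h0; last by rewrite normr0 mulr_ge0// sqr_ge0.
  have hi : 0 <= h^-1 by rewrite invr_ge0 ltW.
  have := HC _ hi.
  rewrite normrM (ger0_norm (expR_ge0 _)) mulrAC exprVn ler_pdivrMr ?exprn_gt0//.
Unshelve. all: by end_near. Qed.

End Tower.

Section SmoothClass.
Context {R : realType}.

Lemma is_derive_line (V : normedModType R) (f : V -> R) (x v : V) (df : R) :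
  is_derive x v f df <-> is_derive (0 : R) (1 : R) (fun h => f (h *: v + x)) df.
Proof.
have E : (fun h : R => h^-1 *: ((fun h => f (h *: v + x)) (h *: 1 + 0)
            - (fun h => f (h *: v + x)) 0)) =
         (fun h : R => h^-1 *: ((f \o shift x) (h *: v) - f x)).
  by apply/funext => h /=; rewrite addr0 scale0r add0r /GRing.scale/= mulr1.
by split=> -[H1 H2]; apply: DeriveDef;
  rewrite /derivable /derive ?E // in H1 H2 *; rewrite -E.
Qed.

Lemma is_derive_compl (V : normedModType R) (g : R -> R) (f : V -> R)
    (x v : V) (dg df : R) :
  is_derive (f x) (1 : R) g dg -> is_derive x v f df ->
  is_derive x v (g \o f) (dg * df).
Proof.
move=> Hg /is_derive_line Hf; apply/is_derive_line.
apply: (@is_derive1_comp _ g (fun h => f (h *: v + x))) => //.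
by rewrite scale0r add0r.
Qed.

Lemma is_derive1_continuous (f f' : R -> R) :
  (forall x : R, is_derive x (1 : R) f (f' x)) -> continuous f.
Proof.
by move=> H x; apply: differentiable_continuous; apply/derivable1_diffP; case: (H x).
Qed.

(* Closed under differentiation: the smoothness of the cutoffs and test functions
   below needs no explicit higher derivative. *)
Inductive elem1 : (R -> R) -> Prop :=
| Elem1_cst c : elem1 (cst c)
| Elem1_id : elem1 id
| Elem1_add f g : elem1 f -> elem1 g -> elem1 (f \+ g)
| Elem1_mul f g : elem1 f -> elem1 g -> elem1 (f \* g)
| Elem1_tower d n : tower d -> elem1 (d n)
| Elem1_comp f g : elem1 g -> elem1 f -> elem1 (g \o f).

Lemma elem1_derive f : elem1 f ->
  exists2 f', elem1 f' & forall x : R, is_derive x (1 : R) f (f' x).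
Proof.
elim=> {f} [c||f g Hf [f' Ef' Df] Hg [g' Eg' Dg]|f g Hf [f' Ef' Df] Hg [g' Eg' Dg]
  |d n Td|f g Hg [g' Eg' Dg] Hf [f' Ef' Df]].
- by exists (cst 0) => [|x]; [exact: Elem1_cst | exact: is_derive_cst].
- by exists (cst 1) => [|x]; [exact: Elem1_cst | exact: is_derive_id].
- by exists (f' \+ g') => [|x]; [exact: Elem1_add | exact: is_deriveD].
- exists ((f \* g') \+ (g \* f')) => [|x].
    by apply: Elem1_add; exact: Elem1_mul.
  exact: (is_deriveM (Df x) (Dg x)).
- by exists (d n.+1) => [|x]; [exact: Elem1_tower | exact: Td].
- exists ((g' \o f) \* f') => [|x].
    by apply: Elem1_mul => //; exact: Elem1_comp.
  exact: (is_derive1_comp (Dg (f x)) (Df x)).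
Qed.

Lemma elem1_continuous f : elem1 f -> continuous f.
Proof. by case/elem1_derive => f' _; exact: is_derive1_continuous. Qed.

(** Linear forms rather than the two coordinates generate the class, so that functions written in a
    rotated frame belong to it directly. *)
Inductive elem : (plane R -> R) -> Prop :=
| Elem_cst c : elem (cst c)
| Elem_lin a : elem (dot a)
| Elem_add f g : elem f -> elem g -> elem (f \+ g)
| Elem_mul f g : elem f -> elem g -> elem (f \* g)
| Elem_comp g f : elem1 g -> elem f -> elem (g \o f).

Lemma is_derive_dot (a x v : plane R) : is_derive x v (dot a) (dot a v).
Proof.
apply/is_derive_line.
have -> : (fun h : R => dot a (h *: v + x)) = (fun h => dot a v * h + dot a x).
  by apply/funext => h; rewrite /dot /= /GRing.scale/=; ring.
have D1 := is_deriveZ (dot a v) (is_derive_id (0 : R) (1 : R)).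
have D2 := is_deriveD D1 (is_derive_cst (dot a x) (0 : R) (1 : R)).
apply: is_derive_eq D2 _.
by rewrite addr0 /GRing.scale/= mulr1.
Qed.

Lemma elem_derive f v : elem f ->
  exists2 f', elem f' & forall x, is_derive x v f (f' x).
Proof.
elim=> {f} [c|a|f g Hf [f' Ef' Df] Hg [g' Eg' Dg]|f g Hf [f' Ef' Df] Hg [g' Eg' Dg]
  |g f Eg Hf [f' Ef' Df]].
- by exists (cst 0) => [|x]; [exact: Elem_cst | exact: is_derive_cst].
- by exists (cst (dot a v)) => [|x]; [exact: Elem_cst | exact: is_derive_dot].
- by exists (f' \+ g') => [|x]; [exact: Elem_add | exact: is_deriveD].
- exists ((f \* g') \+ (g \* f')) => [|x].
    by apply: Elem_add; exact: Elem_mul.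
  exact: (is_deriveM (Df x) (Dg x)).
- have [g' Eg' Dg] := elem1_derive Eg.
  exists ((g' \o f) \* f') => [|x].
    by apply: Elem_mul => //; exact: Elem_comp.
  exact: is_derive_compl.
Qed.

Lemma continuous_fst : continuous (fst : plane R -> R).
Proof. by move=> x; exact: cvg_fst. Qed.

Lemma continuous_snd : continuous (snd : plane R -> R).
Proof. by move=> x; exact: cvg_snd. Qed.

Lemma continuous_dot a : continuous (dot a : plane R -> R).
Proof.
move=> x; apply: cvgD; apply: cvgM; [exact: cvg_cst|exact: continuous_fst
  |exact: cvg_cst|exact: continuous_snd].
Qed.

Lemma elem_continuous f : elem f -> continuous f.
Proof.
elim=> {f} [c|a|f g _ Hf _ Hg|f g _ Hf _ Hg|g f Eg _ Hf] x.
- exact: cvg_cst.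
- exact: continuous_dot.
- by apply: cvgD; [exact: Hf|exact: Hg].
- by apply: cvgM; [exact: Hf|exact: Hg].
- by apply: continuous_comp; [exact: Hf | exact: elem1_continuous].
Qed.

Lemma elem_smooth f : elem f -> smooth f.
Proof.
move=> Ef n; elim: n f Ef => [|n IH] f Ef.
  by split=> //; exact: elem_continuous.
split=> [|i]; first exact: elem_continuous.
have [f' Ef' Df] := elem_derive (axis i) Ef.
split=> [x|]; first by case: (Df x).
suff -> : 'D_(axis i) f = f' by exact: IH.
by apply/funext => x; case: (Df x).
Qed.

End SmoothClass.

(** * Smooth steps and bumps *)

Section Bump.
Context {R : realType}.
Implicit Types r x : R.

Lemma flat0E x : flat 0 x = if 0 < x then expR (- x^-1) else 0.
Proof. by rewrite /flat /= hornerE mul1r. Qed.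

Lemma flat0_le0 x : x <= 0 -> flat 0 x = 0.
Proof. by move=> x0; rewrite flat0E ltNge x0. Qed.

Lemma flat0_ge0 x : 0 <= flat 0 x.
Proof. by rewrite flat0E; case: ifP => // _; exact: expR_ge0. Qed.

Lemma flat0_mono : {homo (@flat R 0) : x y / x <= y}.
Proof.
move=> x y xy; have [x0|x0] := leP x 0; first by rewrite flat0_le0// flat0_ge0.
have y0 := lt_le_trans x0 xy.
by rewrite !flat0E x0 y0 ler_expR lerN2 lef_pV2.
Qed.

(** The function e * [flat 0] equals 1 at 1 and is monotone. For r <= 0 its inner copy is at least
    1, so the outer argument is nonpositive; for r >= 1 the inner copy is 0. The nesting replaces
    the usual quotient, since [elem1] has no division. *)
Definition smooth_step r := expR 1 * flat 0 (1 - expR 1 * flat 0 (1 - r)).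

Lemma flat0_1 : expR 1 * flat 0 1 = 1 :> R.
Proof. by rewrite flat0E ltr01 invr1 expRN mulfV// gt_eqF// expR_gt0. Qed.

Lemma smooth_step_le0 r : r <= 0 -> smooth_step r = 0.
Proof.
move=> r0; rewrite /smooth_step [flat 0 (1 - expR 1 * _)]flat0_le0 ?mulr0// subr_le0.
by rewrite -[leLHS]flat0_1 ler_wpM2l ?expR_ge0// flat0_mono// lerBrDr gerDl.
Qed.

Lemma smooth_step_ge1 r : 1 <= r -> smooth_step r = 1.
Proof.
by move=> r1; rewrite /smooth_step (@flat0_le0 (1 - r)) ?subr_le0// mulr0 subr0 flat0_1.
Qed.

Lemma smooth_step_ge0 r : 0 <= smooth_step r.
Proof. by rewrite mulr_ge0 ?expR_ge0 ?flat0_ge0. Qed.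

Lemma smooth_step_le1 r : smooth_step r <= 1.
Proof.
rewrite -[leRHS]flat0_1 ler_wpM2l ?expR_ge0// flat0_mono// gerBl.
by rewrite mulr_ge0 ?expR_ge0 ?flat0_ge0.
Qed.

Lemma elem1_affine (a b : R) : elem1 (fun r => a * r + b).
Proof.
have H : elem1 ((cst a \* id) \+ cst b : R -> R).
  by do ![exact: Elem1_cst|exact: Elem1_id|apply: Elem1_add|apply: Elem1_mul].
by have -> : (fun r => a * r + b) = (cst a \* id) \+ cst b.
Qed.

Lemma elem1_smooth_step : elem1 smooth_step.
Proof.
have Ef : elem1 (@flat R 0) by apply: Elem1_tower; exact: tower_flat.
have -> : smooth_step = (fun r => expR 1 * r + 0) \o flat 0 \o
    (fun r => (- expR 1) * r + 1) \o flat 0 \o (fun r => (- 1) * r + 1).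
  by apply/funext => r; rewrite /smooth_step /= addr0 mulN1r mulNr ![- _ + 1]addrC.
by do ![apply: Elem1_comp; last exact: elem1_affine | apply: Elem1_comp => //];
  exact: elem1_affine.
Qed.

Definition bump r := smooth_step (2 - r) * smooth_step (2 + r).

Lemma elem1_bump : elem1 bump.
Proof.
have -> : bump = (smooth_step \o (fun r => (-1) * r + 2)) \*
                 (smooth_step \o (fun r => 1 * r + 2)).
  by apply/funext => r /=; rewrite mulN1r mul1r ![_ + 2]addrC.
by apply: Elem1_mul; apply: Elem1_comp;
  [exact: elem1_smooth_step|exact: elem1_affine|exact: elem1_smooth_step|exact: elem1_affine].
Qed.

Lemma bump1 r : `|r| <= 1 -> bump r = 1.
Proof.
rewrite ler_norml => /andP[r1 r2]; rewrite /bump !smooth_step_ge1 ?mulr1//; lra.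
Qed.

Lemma bump0 r : 2 <= `|r| -> bump r = 0.
Proof.
rewrite /bump ler_normr => /orP[] r2.
- by rewrite smooth_step_le0 ?mul0r//; lra.
- by rewrite (@smooth_step_le0 (2 + r)) ?mulr0//; lra.
Qed.

Lemma bump_ge0 r : 0 <= bump r.
Proof. by rewrite mulr_ge0 ?smooth_step_ge0. Qed.

Lemma bump_le1 r : bump r <= 1.
Proof. by rewrite mulr_ile1 ?smooth_step_ge0 ?smooth_step_le1. Qed.

Lemma elem1_bounded f (M : R) : elem1 f ->
  exists2 C, 0 <= C & forall r, `|r| <= M -> `|f r| <= C.
Proof.
move=> /elem1_continuous cf.
have : compact (f @` `[- M, M]%classic).
  apply: continuous_compact; last exact: segment_compact.
  exact: continuous_subspaceT.
move=> /compact_bounded[N [_ HN]].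
exists (`|N| + 1) => [|r]; first by rewrite addr_ge0.
rewrite ler_norml => rM; apply: (HN (`|N| + 1)).
  by rewrite (le_lt_trans (ler_norm _))// ltrDl.
by exists r => //=; rewrite in_itv.
Qed.

Lemma is_derive_locally_cst (f : R -> R) x df c :
  is_derive x (1 : R) f df -> (\near x, f x = c) -> df = 0.
Proof.
move=> Df nf.
have H := @near_eq_is_derive _ _ _ f (cst c) x 1 df nf Df.
by rewrite -(@derive_val _ _ _ _ _ _ _ H) derive_cst.
Qed.

End Bump.

(** * Measure and area-preserving maps in the plane *)

Notation mplane R := (measurableTypeR R * measurableTypeR R)%type.

Section PlaneMeasurability.
Context {R : realType}.

Definition obox (a b : plane R) : set (plane R) :=
  [set x | a.1 < x.1 < b.1 /\ a.2 < x.2 < b.2].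

Lemma obox_setX a b : obox a b = `]a.1, b.1[%classic `*` `]a.2, b.2[%classic.
Proof. by apply/seteqP; split=> x /=; rewrite !in_itv. Qed.

Lemma measurable_obox a b : measurable (obox a b : set (mplane R)).
Proof. by rewrite obox_setX; apply: measurableX. Qed.

Definition cboxab (a b : plane R) : set (plane R) := `[a.1, b.1] `*` `[a.2, b.2].

Lemma obox_sub_cbox a b : obox a b `<=` cboxab a b.
Proof. by move=> x [/andP[? ?] /andP[? ?]]; split; rewrite /= in_itv/= !ltW. Qed.

Definition ratpt (q : rat * rat) : plane R := (ratr q.1, ratr q.2).

(** The boxes have rational corners, enumerated through [unpickle]. Asking that the closed box lie
    in U makes smooth bumps on the box test functions on U, as [dubois_reymond] requires. *)
Lemma open_bigcup_obox (U : set (plane R)) : open U ->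
  U = \bigcup_(n : nat) \bigcup_(ab in [set ab | unpickle n = Some ab /\
    cboxab (ratpt ab.1) (ratpt ab.2) `<=` U]) obox (ratpt ab.1) (ratpt ab.2).
Proof.
move=> oU; apply/seteqP; split=> [x Ux|x [n _ [ab [_ abU]] abx]]; last first.
  by apply: abU; exact: obox_sub_cbox.
have := oU; rewrite openE => /(_ x Ux).
rewrite /interior => /nbhs_ballP[e /= e0 eU].
have e2 : 0 < e / 2 by rewrite divr_gt0.
have itv (y : R) : exists q1 q2 : rat, [/\ y - e / 2 < ratr q1, ratr q1 < y,
    y < ratr q2 & ratr q2 < y + e / 2].
  have [|q1] := @rat_in_itvoo R (y - e/2) y; first by rewrite ltrBlDr ltrDl.
  rewrite in_itv/= => /andP[? ?].
  have [|q2] := @rat_in_itvoo R y (y + e/2); first by rewrite ltrDl.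
  by rewrite in_itv/= => /andP[? ?]; exists q1, q2.
have [p1 [q1 [? ? ? ?]]] := itv x.1; have [p2 [q2 [? ? ? ?]]] := itv x.2.
exists (pickle ((p1, p2), (q1, q2))) => //=.
exists ((p1, p2), (q1, q2)); last by rewrite /obox/=; split; apply/andP.
rewrite pickleK; split=> //.
move=> z [].
rewrite /= !in_itv/= => /andP[? ?] /andP[? ?].
apply: eU; split => /=; rewrite /ball/= ltr_norml; lra.
Qed.

Lemma measurable_open (U : set (plane R)) : open U ->
  measurable (U : set (mplane R)).
Proof.
move=> /open_bigcup_obox ->; apply: bigcupT_measurable => n.
case E : (@unpickle ((rat * rat) * (rat * rat))%type n) => [ab|]; last first.
  rewrite (_ : (\bigcup_(_ in _) _) = set0)//.
  by apply/seteqP; split=> // x [? [] ].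
have [abU|abU] := pselect (cboxab (ratpt ab.1) (ratpt ab.2) `<=` U).
  rewrite (_ : (\bigcup_(_ in _) _) = obox (ratpt ab.1) (ratpt ab.2)).
    exact: measurable_obox.
  apply/seteqP; split=> [x [cd [[<-] _]]//|x xab].
  by exists ab.
rewrite (_ : (\bigcup_(_ in _) _) = set0)//.
by apply/seteqP; split=> // x [cd [[<-]]].
Qed.

Lemma measurable_closed (U : set (plane R)) : closed U ->
  measurable (U : set (mplane R)).
Proof.
by move=> cU; rewrite -[U]setCK; apply: measurableC; apply: measurable_open; exact: closed_openC.
Qed.

Lemma continuous_measurable_plane (f : plane R -> R) (D : set (plane R)) :
  continuous f -> measurable (D : set (mplane R)) ->
  measurable_fun (D : set (mplane R)) f.
Proof.
move=> cf mD; apply: measurable_funTS.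
apply: (measurability _ (measurable_realfun.RGenOInfty.measurableE R)) => _ [_ [x ->] <-].
rewrite setTI; apply: measurable_open.
by apply: open_comp => // y _; exact: cf.
Qed.

Lemma ae_area_mono (P Q : plane R -> Prop) : (forall x, P x -> Q x) ->
  {ae area, forall x, P x} -> {ae area, forall x, Q x}.
Proof. exact: (@filterS _ _ (@ae_filter_ringOfSetsType _ (mplane R) R area)). Qed.

Lemma ae_area_and (P Q : plane R -> Prop) :
  {ae area, forall x, P x} -> {ae area, forall x, Q x} ->
  {ae area, forall x, P x /\ Q x}.
Proof. exact: (@filterI _ _ (@ae_filter_ringOfSetsType _ (mplane R) R area)). Qed.

Lemma test_fun_elem (D C : set (plane R)) f :
  elem f -> compact C -> (forall x, ~ C x -> f x = 0) -> C `<=` D -> test_fun D f.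
Proof.
move=> Ef cC f0 CD.
have clC : closed C by apply: compact_closed => //; exact: norm_hausdorff.
have sC : supp f `<=` C.
  apply: (subset_trans _ clC); apply: closure_subset => y /= fy.
  by apply: contrapT => /f0 fy0; rewrite fy0 eqxx in fy.
split; first exact: elem_smooth.
- by apply: subclosed_compact cC sC; exact: closed_closure.
- exact: subset_trans CD.
Qed.

End PlaneMeasurability.

Definition mfun_of d d' (X : measurableType d) (Y : measurableType d')
  (f : X -> Y) (mf : measurable_fun setT f) : {mfun X >-> Y} :=
  HB.pack f (isMeasurableFun.Build _ _ _ _ _ mf).

Section AreaPreserving.
Context {R : realType}.

Definition preserving (T : mplane R -> mplane R) :=
  measurable_fun setT T /\ forall A, measurable A -> area (T @^-1` A) = area A.

Lemma preserving_comp S T : preserving S -> preserving T -> preserving (S \o T).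
Proof.
move=> [mS pS] [mT pT]; split; first exact: measurableT_comp.
move=> A mA; rewrite comp_preimage pT ?pS//.
by rewrite -[X in measurable X]setTI; exact: mS.
Qed.

(** The pushforward of Lebesgue measure by a translation agrees with it on half-open intervals,
    which determine it. *)
Lemma lebesgue_measure_translate (c : R) (A : set (measurableTypeR R)) :
  measurable A -> lebesgue_measure ((fun x => x + c) @^-1` A) = lebesgue_measure A.
Proof.
move=> mA.
have mf : @measurable_fun _ _ (measurableTypeR R) (measurableTypeR R) setT (fun x => x + c).
  exact: (@measurable_funD _ (measurableTypeR R) R setT id (cst c)).
pose f : {mfun measurableTypeR R >-> measurableTypeR R} := mfun_of mf.
apply: esym.
suff -> : lebesgue_measure A = pushforward lebesgue_measure f A by [].
apply: (@lebesgue_measure_unique R (pushforward lebesgue_measure f)) => //.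
move=> _ [[a b]] _ <-; rewrite /pushforward /=.
transitivity (lebesgue_measure (`]a - c, b - c]%classic : set (measurableTypeR R))); last first.
  by congr lebesgue_measure; apply/seteqP; split=> x /=; rewrite !in_itv/= ltrBlDr lerBrDr.
rewrite !lebesgue_measure_itv/= !lte_fin ltrD2r.
by case: ifP => // _; rewrite -!EFinB; congr EFin; ring.
Qed.

(** The product measure integrates the measures of vertical sections, and on each of them a shear is
    a translation. *)
Lemma preserving_shear (g : R -> R) : @measurable_fun _ _ (measurableTypeR R) R setT g ->
  preserving (fun x : mplane R => (x.1, x.2 + g x.1)).
Proof.
move=> mg; split.
  apply: (@measurable_fun_pair _ _ _ (mplane R) (measurableTypeR R) (measurableTypeR R) fst (fun x => x.2 + g x.1)); first exact: measurable_fst.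
  apply: (@measurable_funD _ (mplane R) R setT snd (g \o fst)).
    exact: measurable_snd.
  exact: (measurableT_comp mg measurable_fst).
move=> A mA; rewrite /area /= /product_measure1; apply: eq_integral => t _ /=.
rewrite -[RHS](@lebesgue_measure_translate (g t)); last exact: measurable_xsection.
by congr lebesgue_measure; apply/seteqP; split=> s; rewrite /xsection/= !inE.
Qed.

Lemma preserving_swap : preserving (fun x : mplane R => (x.2, x.1)).
Proof.
have mswap : @measurable_fun _ _ (mplane R) (mplane R) setT (fun x => (x.2, x.1)).
  exact: measurable_fun_pair.
split=> // A mA.
pose f : {mfun mplane R >-> mplane R} := mfun_of mswap.
apply: esym.
suff -> : area A = pushforward area f A by [].
apply: (@product_measure_unique _ _ _ _ _ (@lebesgue_measure R) (@lebesgue_measure R)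
  (pushforward area f)) => // A1 A2 mA1 mA2.
transitivity (area (A2 `*` A1 : set (mplane R))); last first.
  by rewrite [LHS](@product_measure1E _ _ (measurableTypeR R) (measurableTypeR R))// muleC.
have E : f @^-1` (A1 `*` A2) = A2 `*` A1 by apply/seteqP; split=> x [].
exact: (congr1 (fun B : set (mplane R) => area B) E).
Qed.

Definition rot (e x : plane R) : plane R := x.1 *: e + x.2 *: rot90 e.

(* A rotation is a composition of three shears. *)
Lemma preserving_rot (e : plane R) : e.1 ^+ 2 + e.2 ^+ 2 = 1 -> preserving (rot e).
Proof.
have shear1 (a : R) : preserving (fun x : mplane R => (x.1, x.2 + a * x.1)).
  apply: (@preserving_shear (fun t => a * t)).
  exact: mulrl_measurable.
have shear2 (a : R) : preserving (fun x : mplane R => (x.1 + a * x.2, x.2)).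
  by have := preserving_comp preserving_swap (preserving_comp (shear1 a) preserving_swap).
have gen (e' : plane R) : e'.2 != 0 -> e'.1 ^+ 2 + e'.2 ^+ 2 = 1 -> preserving (rot e').
  move=> e20 e1.
  (* For e' = (cos t, sin t) this is - tan (t / 2), the parameter of the two outer shears. *)
  pose a := (e'.1 - 1) / e'.2.
  have := preserving_comp (shear2 a) (preserving_comp (shear1 e'.2) (shear2 a)).
  congr preserving; apply/funext => x /=; rewrite /rot /=; congr pair => /=.
    rewrite /GRing.scale/= /a.
    have -> : x.1 + (e'.1 - 1) / e'.2 * x.2 +
      (e'.1 - 1) / e'.2 * (x.2 + e'.2 * (x.1 + (e'.1 - 1) / e'.2 * x.2)) =
      x.1 * e'.1 + x.2 * ((e'.1 ^+ 2 - 1) / e'.2) by field.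
    by congr (_ + _ * _); apply: (mulIf e20); rewrite -e1; field.
  by rewrite /GRing.scale/= /a; field.
(* If e.2 = 0 the rotation is the identity or the half turn, and the half turn is the square of the
   quarter turn. *)
move=> e1; have [e20|] := eqVneq e.2 0; last by move=> ?; exact: gen.
have H := gen (0, 1) (oner_neq0 _).
have H1 : preserving (rot (0, 1)) by apply: H; rewrite /= expr0n expr1n add0r.
have : e.1 ^+ 2 == 1 by rewrite -e1 e20 expr0n addr0.
rewrite sqrf_eq1 => /orP[] /eqP E.
  have -> : rot e = (fun x : mplane R => (x.1, x.2 + 0 * x.1)) => //.
  by apply/funext => x; rewrite [LHS]surjective_pairing /rot /rot90 /= /GRing.scale/= !E !e20; congr pair; rewrite /= /GRing.scale/=; ring.
have -> : rot e = rot (0,1) \o rot (0, 1).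
  by apply/funext => x; rewrite [LHS]surjective_pairing /rot /rot90 /= /GRing.scale/= !E !e20; congr pair; rewrite /= /GRing.scale/=; ring.
exact: preserving_comp.
Qed.

(* Straightens the cone: a rotation after the shear (t, s) |-> (t, s + c|t|), hence
   area preserving. *)
Definition cone_chart (e : plane R) (c : R) (x : plane R) : plane R :=
  rot e (x.1, x.2 + c * `|x.1|).

Lemma preserving_cone_chart e c : e.1 ^+ 2 + e.2 ^+ 2 = 1 ->
  preserving (cone_chart e c).
Proof.
move=> e1; apply: (preserving_comp (preserving_rot e1)).
apply: (@preserving_shear (fun t => c * `|t|)).
by apply: measurable_funM => //; exact: normr_measurable.
Qed.

End AreaPreserving.

(** * Integration by parts and the fundamental lemma *)

Section IntegrationByParts.
Context {R : realType}.
Notation mu := (@lebesgue_measure R).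

Lemma is_derive_path (V : normedModType R) (f : V -> R) (p v : V) (t df : R) :
  is_derive (p + t *: v) v f df ->
  is_derive t (1 : R) (fun s => f (p + s *: v)) df.
Proof.
move=> /is_derive_line H; apply/is_derive_line.
have -> : (fun h : R => f (p + (h *: (1 : R) + t) *: v)) =
          (fun h => f (h *: v + (p + t *: v))) => //.
apply/funext => h.
have -> : h *: (1 : R) = h by rewrite /GRing.scale/= mulr1.
by rewrite scalerDl addrCA.
Qed.

Lemma FTC2_segment (f f' : R -> R) (a b : R) :
  (forall x : R, is_derive x (1 : R) f (f' x)) -> continuous f' -> a <= b ->
  (\int[mu]_(x in `[a, b]) (f' x)%:E = (f b - f a)%:E)%E.
Proof.
move=> Df cf'; rewrite le_eqVlt => /predU1P[->|ab].
  by rewrite set_itv1 integral_set1 subrr.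
rewrite EFinB; apply: continuous_FTC2 => //.
- exact: continuous_subspaceT.
- split=> [x _||]; first by case: (Df x).
  + by apply: cvg_at_right_filter; exact: (is_derive1_continuous Df).
  + by apply: cvg_at_left_filter; exact: (is_derive1_continuous Df).
- by move=> x _; rewrite derive1E; case: (Df x).
Qed.

Definition cbox (M : R) : set (plane R) := `[- M, M] `*` `[- M, M].

Lemma cboxP M x : cbox M x <-> `|x.1| <= M /\ `|x.2| <= M.
Proof. by rewrite /cbox /= !in_itv/= !ler_norml; split=> -[]. Qed.

Lemma compact_cbox M : compact (cbox M).
Proof. by apply: compact_setX; exact: segment_compact. Qed.

Lemma measurable_cbox M : measurable (cbox M : set (mplane R)).
Proof. exact: measurableX. Qed.

Lemma area_cbox M : 0 <= M -> area (cbox M : set (mplane R)) = ((2 * M) ^+ 2)%:E.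
Proof.
move=> M0; rewrite [LHS](@product_measure1E _ _ (measurableTypeR R) (measurableTypeR R))//.
have E : mu (`[- M, M]%classic) = (2 * M)%:E.
  rewrite lebesgue_measure_itv/= lte_fin; case: ifPn => MM.
    by rewrite -EFinB; congr EFin; ring.
  have -> : M = 0 by apply: le_anti; rewrite M0 andbT; move: MM; rewrite -leNgt; lra.
  by rewrite mulr0.
by rewrite [LHS](congr2 (fun x y => x * y)%E E E) -EFinM expr2.
Qed.

Lemma bounded_sub_cbox (A : set (plane R)) : bounded_set A ->
  exists2 M, 0 < M & A `<=` cbox M.
Proof.
move=> [N [_ HN]]; exists (`|N| + 1) => [|x Ax]; first by rewrite ltr_wpDl.
apply/cboxP; have : `|x| <= `|N| + 1.
  by apply: (HN (`|N| + 1)) => //; rewrite (le_lt_trans (ler_norm _))// ltrDl.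
by rewrite prod_normE ge_max => /andP[].
Qed.

Lemma bounded_area (A : set (plane R)) : bounded_set A ->
  measurable (A : set (mplane R)) -> (area (A : set (mplane R)) < +oo)%E.
Proof.
move=> /bounded_sub_cbox[M M0 AM] mA.
apply: (@le_lt_trans _ _ (area (cbox M : set (mplane R)))).
  by apply: le_measure => //; rewrite inE//; exact: measurable_cbox.
by rewrite area_cbox ?ltry// ltW.
Qed.

Lemma continuous_bounded_cbox (f : plane R -> R) M : continuous f ->
  exists2 C, 0 <= C & forall x, cbox M x -> `|f x| <= C.
Proof.
move=> cf; have : compact (f @` cbox M).
  by apply: continuous_compact (@compact_cbox M); exact: continuous_subspaceT.
move=> /compact_bounded[N [_ HN]].
exists (`|N| + 1) => [|x xM]; first by rewrite addr_ge0.
apply: (HN (`|N| + 1)); last by exists x.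
by rewrite (le_lt_trans (ler_norm _))// ltrDl.
Qed.

Lemma continuous_integrable_bounded (f : plane R -> R) (D : set (plane R)) :
  continuous f -> bounded_set D -> measurable (D : set (mplane R)) ->
  area.-integrable (D : set (mplane R)) (EFin \o f).
Proof.
move=> cf bD mD; apply: measurable_bounded_integrable => //.
- exact: bounded_area.
- exact: continuous_measurable_plane.
- have [M M0 DM] := bounded_sub_cbox bD.
  have [C C0 HC] := continuous_bounded_cbox M cf.
  exists C; split; first exact: num_real.
  by move=> c Cc x /= Dx; apply: le_trans (ltW Cc); apply: HC; exact: DM.
Qed.

Lemma bounded_cbox M : bounded_set (cbox M).
Proof. by apply: compact_bounded; exact: compact_cbox. Qed.

Lemma integrable_zero_off (f : plane R -> R) (D E : set (mplane R)) :
  measurable D -> measurable E ->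
  (forall x, ~ D x -> f x = 0) -> area.-integrable D (EFin \o f) ->
  area.-integrable E (EFin \o f).
Proof.
move=> mD mE f0 /(integrable_mkcond _ mD) iD.
apply: (@integrableS _ _ _ _ setT) => //; move: iD; congr integrable.
apply/funext => x; rewrite /patch; case: ifPn => // /negP; rewrite inE => nD /=.
by rewrite f0.
Qed.

Lemma integral_zero_off (f : plane R -> R) (D : set (mplane R)) :
  (forall x, ~ D x -> f x = 0) ->
  (\int[area]_(x in D) (f x)%:E = \int[area]_x (f x)%:E)%E.
Proof.
move=> f0; rewrite integral_mkcond; apply: eq_integral => x _.
by rewrite /patch; case: ifPn => // /negP; rewrite inE => nD /=; rewrite f0.
Qed.

(** Fubini's theorem, integrating first along [axis i]: on each line in that direction, g vanishes
    at both ends. *)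
Lemma integral_derive_csupp (g G : plane R -> R) i (M : R) :
  (forall x, is_derive x (axis i) g (G x)) -> continuous G -> 0 <= M ->
  (forall x, ~ cbox M x -> g x = 0) -> (forall x, ~ cbox M x -> G x = 0) ->
  (\int[area]_x (G x)%:E = 0)%E.
Proof.
move=> Dg cG M0 g0 G0.
have iG : area.-integrable setT (EFin \o G).
  apply: (@integrable_zero_off G (cbox M)) => //; first exact: measurable_cbox.
  apply: continuous_integrable_bounded => //; first exact: bounded_cbox.
  exact: measurable_cbox.
have line (p v : plane R) : v = axis i -> (forall t : R, M < `|t| -> ~ cbox M (p + t *: v)) ->
    (\int[mu]_t (G (p + t *: v))%:E = 0)%E.
  move=> vE off.
  (* The box is closed, so g may be nonzero at distance M; at M + 1 it is 0. *)
  have M1 : M < M + 1 by rewrite ltrDl.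
  have off1 : M < `|M + 1| by rewrite ger0_norm// addr_ge0.
  transitivity (\int[mu]_(t in `[(- (M + 1))%R, (M + 1)%R]) (G (p + t *: v))%:E)%E.
    rewrite [RHS]integral_mkcond; apply: eq_integral => t _; rewrite /patch.
    case: ifPn => // /negP; rewrite inE/= in_itv/= -ler_norml => nt; rewrite G0//.
    by apply: off; rewrite ltNge; apply/negP => tM; apply: nt; rewrite (le_trans tM)// ltW.
  have D1 (t : R) : is_derive t (1 : R) (fun t => g (p + t *: v)) (G (p + t *: v)).
    by apply: is_derive_path; rewrite vE.
  have C1 : continuous (fun t : R => G (p + t *: v)).
    move=> t; apply: continuous_comp; last exact: cG.
    by apply: cvgD; [exact: cvg_cst|apply: cvgZ; [exact: cvg_id|exact: cvg_cst]].
  rewrite (FTC2_segment D1 C1); last by lra.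
  by rewrite !g0 ?subrr//; apply: off; rewrite ?normrN.
case: i Dg line => Dg line.
- rewrite -[LHS](@integral12_prod_meas1 _ _ (measurableTypeR R) (measurableTypeR R))//.
  rewrite integral0_eq// => x _; rewrite /fubini_F -[RHS](line (x, 0) (0, 1))//.
    by apply: eq_integral => y _; rewrite /=; congr (G _)%:E; rewrite /GRing.scale/=; congr pair => /=; rewrite /GRing.scale/=; ring.
  by move=> t tM /cboxP[_] /=; rewrite /GRing.scale/= add0r mulr1 leNgt tM.
- rewrite -[LHS](@integral21_prod_meas1 _ _ (measurableTypeR R) (measurableTypeR R))//.
  rewrite integral0_eq// => x _; rewrite /fubini_G -[RHS](line (0, x) (1, 0))//.
    by apply: eq_integral => y _; rewrite /=; congr (G _)%:E; rewrite /GRing.scale/=; congr pair => /=; rewrite /GRing.scale/=; ring.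
  move=> t tM /cboxP[+ _]; rewrite (_ : _.1 = t) ?leNgt ?tM//.
  by rewrite /= /GRing.scale/=; ring.
Qed.

End IntegrationByParts.

Section TestFunctions.
Context {R : realType}.
Implicit Types (f psi : plane R -> R) (D : set (plane R)).

Lemma smooth_continuous f : smooth f -> continuous f.
Proof. by move=> /(_ 0%N)[]. Qed.

Lemma smooth_derive f i : smooth f -> smooth ('D_(axis i) f).
Proof. by move=> sf n; have [_ /(_ i)[]] := sf n.+1. Qed.

Lemma smooth_is_derive f i x : smooth f -> is_derive x (axis i) f ('D_(axis i) f x).
Proof. by move=> /(_ 1%N)[_ /(_ i)[df _]]; exact: derivableP. Qed.

Lemma not_supp0 f x : ~ supp f x -> f x = 0.
Proof.
by move=> nx; apply: contrapT => /eqP fx; apply: nx; exact: subset_closure.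
Qed.

Lemma not_supp_derive0 f i x : ~ supp f x -> 'D_(axis i) f x = 0.
Proof.
move=> nx; have : \near x, f x = cst 0 x.
  have oS : open (~` supp f) by apply: closed_openC; exact: closed_closure.
  by apply: filterS (open_nbhs_nbhs (conj oS nx)) => y; exact: not_supp0.
by move=> /near_eq_derive ->; rewrite derive_cst.
Qed.

(** Off the support of psi both integrands are 0, so D may be replaced by the plane, where the
    derivative of f psi has integral 0. *)
Lemma test_ibp D f psi i : open D -> smooth f -> test_fun D psi ->
  \int[area]_(x in D) (f x * 'D_(axis i) psi x) =
  - \int[area]_(x in D) ('D_(axis i) f x * psi x).
Proof.
move=> oD sf [sp cp pD].
have mD := measurable_open oD.
have [M M0 pM] := bounded_sub_cbox (compact_bounded cp).
have offM x : ~ cbox M x -> ~ supp psi x by move=> n /pM.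
have offD x : ~ D x -> ~ supp psi x by move=> n /pD.
set F := fun x => f x * 'D_(axis i) psi x; set G := fun x => 'D_(axis i) f x * psi x.
have cF : continuous F.
  by move=> x; apply: cvgM; [exact: smooth_continuous | exact: (smooth_continuous (smooth_derive i sp))].
have cG : continuous G.
  by move=> x; apply: cvgM; [exact: (smooth_continuous (smooth_derive i sf)) | exact: smooth_continuous].
have F0 x : ~ supp psi x -> F x = 0 by move=> nx; rewrite /F (not_supp_derive0 i nx) mulr0.
have G0 x : ~ supp psi x -> G x = 0 by move=> nx; rewrite /G (not_supp0 nx) mulr0.
have iT (H : plane R -> R) : continuous H -> (forall x, ~ supp psi x -> H x = 0) ->
    area.-integrable setT (EFin \o H).
  move=> cH H0; apply: (@integrable_zero_off _ H (cbox M)) => //.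
  - exact: measurable_cbox.
  - by move=> x /offM; exact: H0.
  apply: continuous_integrable_bounded => //; first exact: bounded_cbox.
  exact: measurable_cbox.
rewrite /Rintegral !(@integral_zero_off R _ D); last 2 first.
- by move=> x /offD; exact: G0.
- by move=> x /offD; exact: F0.
have dH x : is_derive x (axis i) (fun x => f x * psi x) ((F \+ G) x).
  apply: is_derive_eq (is_deriveM (smooth_is_derive i x sf) (smooth_is_derive i x sp)) _.
  by rewrite /F /G /= /GRing.scale/=; ring.
have cFG : continuous (F \+ G).
  by move=> x; apply: cvgD; [exact: cF|exact: cG].
have H : (\int[area]_x ((F \+ G) x)%:E = 0)%E.
  apply: (integral_derive_csupp dH cFG (ltW M0)) => x /offM nx.
    by rewrite (not_supp0 nx) mulr0.
  by rewrite /= F0 ?G0 ?addr0.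
rewrite -/(Rintegral area setT F) -/(Rintegral area setT G).
apply/eqP; rewrite -addr_eq0 -RintegralD//; [|exact: iT..].
by rewrite /Rintegral H.
Qed.

End TestFunctions.

Section DuBoisReymond.
Context {R : realType}.
Implicit Types (D : set (plane R)).

Definition oboxes : set (set (plane R)) := [set B | exists a b, B = obox a b].

Let GT := g_sigma_algebraType oboxes.

Let open_oboxes (U : set (plane R)) : open U -> @measurable _ GT U.
Proof.
move=> /open_bigcup_obox ->; apply: (@bigcupT_measurable _ GT) => n.
case E : (@unpickle ((rat * rat) * (rat * rat))%type n) => [ab|]; last first.
  rewrite (_ : (\bigcup_(_ in _) _) = set0); last by apply/seteqP; split=> // x [? [] ].
  exact: (@measurable0 _ GT).
have [abU|abU] := pselect (cboxab (ratpt ab.1) (ratpt ab.2) `<=` U).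
  rewrite (_ : (\bigcup_(_ in _) _) = obox (ratpt ab.1) (ratpt ab.2)).
    by apply: sub_sigma_algebra; exists (ratpt ab.1), (ratpt ab.2).
  apply/seteqP; split=> [x [cd [[<-] _]]//|x xab].
  by exists ab.
rewrite (_ : (\bigcup_(_ in _) _) = set0); last first.
  by apply/seteqP; split=> // x [cd [[<-]]].
exact: (@measurable0 _ GT).
Qed.

Let continuous_oboxes (f : plane R -> R) : continuous f ->
  @measurable_fun _ _ GT (measurableTypeR R) setT f.
Proof.
move=> cf; apply: (measurability _ (measurable_realfun.RGenOInfty.measurableE R)).
move=> _ [_ [x ->] <-].
by rewrite setTI; apply: open_oboxes; apply: open_comp => // y _; exact: cf.
Qed.

(** Boxes are stable under intersection, so this equality makes Dynkin's argument available on the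
    plane. *)
Lemma measurable_plane_oboxes : @measurable _ (mplane R) = <<s oboxes >>.
Proof.
apply/seteqP; split; last first.
  apply: smallest_sub; first exact: sigma_algebra_measurable.
  by move=> _ [a [b ->]]; exact: measurable_obox.
rewrite measurable_prod_measurableType.
apply: smallest_sub; first exact: smallest_sigma_algebra.
move=> _ [A mA] [B mB] <-.
have -> : A `*` B = (fst @^-1` A) `&` (snd @^-1` B) :> set (plane R).
  by apply/seteqP; split=> x [].
apply: (@measurableI _ GT).
  by rewrite -[X in @measurable _ GT X]setTI; apply: (continuous_oboxes continuous_fst).
by rewrite -[X in @measurable _ GT X]setTI; apply: (continuous_oboxes continuous_snd).
Qed.

Lemma oboxI (a b c d : plane R) : obox a b `&` obox c d =
  obox (Num.max a.1 c.1, Num.max a.2 c.2) (Num.min b.1 d.1, Num.min b.2 d.2).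
Proof.
apply/seteqP; split=> x; rewrite /obox/= !gt_max !lt_min.
  by move=> [[/andP[-> ->] /andP[-> ->]] [/andP[-> ->] /andP[-> ->]]].
by move=> [/andP[/andP[-> ->] /andP[-> ->]] /andP[/andP[-> ->] /andP[-> ->]]].
Qed.

Lemma setI_closed_oboxes : setI_closed oboxes.
Proof. by move=> _ _ [a [b ->]] [c [d ->]]; rewrite oboxI; do 2 eexists. Qed.

Lemma cvg_step_large (x : R) : 0 < x ->
  smooth_step (n%:R * x) @[n --> \oo] --> (1 : R).
Proof.
move=> x0; apply: cvg_near_cst; near=> n.
apply/smooth_step_ge1; rewrite -ler_pdivrMr// div1r.
by near: n; exact: nbhs_infty_ger.
Unshelve. all: by end_near. Qed.

(** Smooth functions that vanish off the open box and tend to its indicator: they turn tests against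
    smooth functions into integrals over boxes. *)
Definition box_bump (a b : plane R) (n : nat) (x : plane R) : R :=
  smooth_step (n%:R * (x.1 - a.1)) * smooth_step (n%:R * (b.1 - x.1)) *
  (smooth_step (n%:R * (x.2 - a.2)) * smooth_step (n%:R * (b.2 - x.2))).

Lemma elem_step_affine (v : plane R) (c : R) : elem (fun x => smooth_step (dot v x + c)).
Proof.
apply: (@Elem_comp _ smooth_step (fun x => dot v x + c)); first exact: elem1_smooth_step.
by apply: (@Elem_add _ (dot v) (cst c)); [exact: Elem_lin|exact: Elem_cst].
Qed.

Lemma box_bump_obox a b n x : ~ obox a b x -> box_bump a b n x = 0.
Proof.
move=> nx; rewrite /box_bump.
have neg (y : R) : y <= 0 -> smooth_step (n%:R * y) = 0.
  by move=> y0; rewrite smooth_step_le0// mulr_ge0_le0.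
have [h1|h1] := leP x.1 a.1; first by rewrite neg ?mul0r// subr_le0.
have [h2|h2] := leP b.1 x.1; first by rewrite (@neg (b.1 - x.1)) ?subr_le0// mulr0 mul0r.
have [h3|h3] := leP x.2 a.2; first by rewrite (@neg (x.2 - _)) ?mul0r ?mulr0// subr_le0.
have [h4|h4] := leP b.2 x.2; first by rewrite (@neg (b.2 - x.2)) ?subr_le0// !mulr0.
by exfalso; apply: nx; split; apply/andP.
Qed.

Lemma elem_box_bump a b n : elem (box_bump a b n).
Proof.
have -> : box_bump a b n =
  ((fun x => smooth_step (dot (n%:R, 0) x + - n%:R * a.1)) \*
   (fun x => smooth_step (dot (- n%:R, 0) x + n%:R * b.1))) \*
  ((fun x => smooth_step (dot (0, n%:R) x + - n%:R * a.2)) \*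
   (fun x => smooth_step (dot (0, - n%:R) x + n%:R * b.2))).
  apply/funext => x; rewrite /box_bump.
  have -> : n%:R * (x.1 - a.1) = dot (n%:R, 0) x + - n%:R * a.1 by rewrite /dot/=; ring.
  have -> : n%:R * (b.1 - x.1) = dot (- n%:R, 0) x + n%:R * b.1 by rewrite /dot/=; ring.
  have -> : n%:R * (x.2 - a.2) = dot (0, n%:R) x + - n%:R * a.2 by rewrite /dot/=; ring.
  by have -> : n%:R * (b.2 - x.2) = dot (0, - n%:R) x + n%:R * b.2 by rewrite /dot/=; ring.
by apply: Elem_mul; apply: Elem_mul; exact: elem_step_affine.
Qed.

Lemma box_bump_itv01 a b n x : 0 <= box_bump a b n x <= 1.
Proof.
have M (p q : R) : 0 <= p <= 1 -> 0 <= q <= 1 -> 0 <= p * q <= 1.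
  by move=> /andP[? ?] /andP[? ?]; rewrite mulr_ge0// mulr_ile1.
have S (r : R) : 0 <= smooth_step r <= 1 by rewrite smooth_step_ge0 smooth_step_le1.
by rewrite /box_bump; apply: (M _ _ (M _ _ _ _) (M _ _ _ _)); exact: S.
Qed.

Lemma test_fun_box_bump D a b n : cboxab a b `<=` D -> test_fun D (box_bump a b n).
Proof.
move=> abD; apply: (@test_fun_elem _ D (cboxab a b)) => //.
- exact: elem_box_bump.
- by apply: compact_setX; exact: segment_compact.
- by move=> x nx; apply: box_bump_obox => /obox_sub_cbox.
Qed.

Lemma integral_obox_test0 D (g : plane R -> R) a b : open D ->
  area.-integrable (D : set (mplane R)) (EFin \o g) ->
  (forall psi, test_fun D psi -> \int[area]_(x in D) (g x * psi x) = 0) ->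
  cboxab a b `<=` D -> (\int[area]_(x in obox a b) (g x)%:E = 0)%E.
Proof.
move=> oD ig g0 abD.
have mD : measurable (D : set (mplane R)) := measurable_open oD.
have mg : measurable_fun (D : set (mplane R)) g.
  by case/integrableP: (ig) => /measurable_EFinP.
have bD : obox a b `<=` D.
  exact: subset_trans (@obox_sub_cbox _ _ _) abD.
have mbump n : measurable_fun (D : set (mplane R)) (box_bump a b n).
  by apply: continuous_measurable_plane => //; apply/elem_continuous/elem_box_bump.
have bx x : obox a b x -> box_bump a b n x @[n --> \oo] --> (1 : R).
  move=> [/andP[? ?] /andP[? ?]]; rewrite -[1 : R]mulr1 -[X in X * _]mulr1 -[X in _ * X]mulr1.
  by apply: cvgM; apply: cvgM; apply: cvg_step_large; rewrite subr_gt0.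
have lim x : (g x * box_bump a b n x)%:E @[n --> \oo] -->
    (((EFin \o g) \_ (obox a b)) x).
  rewrite /patch; case: ifPn => [|/negP]; rewrite inE => xab.
    apply: cvg_EFin; first exact: nearW.
    by rewrite -[X in _ --> X]mulr1; apply: cvgM; [exact: cvg_cst|exact: bx].
  apply: cvg_near_cst; apply: nearW => n.
  by rewrite box_bump_obox// mulr0.
have H : (\int[area]_(x in D) (g x * box_bump a b n x)%:E)%E @[n --> \oo] -->
    (\int[area]_(x in D) ((EFin \o g) \_ (obox a b)) x)%E.
  have [] := @dominated_convergence _ _ _ area D mD
    (fun n x => (g x * box_bump a b n x)%:E) ((EFin \o g) \_ (obox a b)) (abse \o (EFin \o g)) => //.
  - by move=> n; apply/measurable_EFinP; apply: measurable_funM.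
  - apply: (measurable_funS (E := setT)) => //.
    apply/(measurable_restrictT _ _).1; first exact: measurable_obox.
    by apply: measurable_funS bD _ => //; apply/measurable_EFinP.
  - by apply: aeW => x _; exact: lim.
  - exact: integrable_abse.
  - apply: aeW => x n _ /=; rewrite lee_fin normrM ler_piMr//.
    by have /andP[? ?] := box_bump_itv01 a b n x; rewrite ger0_norm.
rewrite -(setIidr bD) integral_mkcondr.
apply: (@cvg_unique _ (@ereal_hausdorff R) _ _ _ _ H).
have ib n : area.-integrable (D : set (mplane R)) (fun x => (g x * box_bump a b n x)%:E).
  apply: (le_integrable mD _ _ ig).
    by apply/measurable_EFinP; apply: measurable_funM.
  move=> x _ /=; rewrite lee_fin normrM ler_piMr//.
  by have /andP[? ?] := box_bump_itv01 a b n x; rewrite ger0_norm.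
have -> : (fun n => \int[area]_(x in D) (g x * box_bump a b n x)%:E)%E = cst 0%E.
  apply/funext => n; rewrite -[LHS]fineK; last exact: integrable_fin_num.
  by have := g0 _ (test_fun_box_bump n abD); rewrite /Rintegral => ->.
exact: cvg_cst.
Qed.

Lemma integral_obox_ae0 D (g : plane R -> R) a b : open D ->
  area.-integrable (D : set (mplane R)) (EFin \o g) ->
  (forall psi, test_fun D psi -> \int[area]_(x in D) (g x * psi x) = 0) ->
  cboxab a b `<=` D -> {ae area, forall x, obox a b x -> g x = 0}.
Proof.
move=> oD ig g0 abD.
have mD : measurable (D : set (mplane R)) := measurable_open oD.
have bD : obox a b `<=` D.
  exact: subset_trans (@obox_sub_cbox _ _ _) abD.
have mb : measurable (obox a b : set (mplane R)) := measurable_obox a b.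
have igS (E : set (mplane R)) : measurable E -> area.-integrable (E `&` obox a b) (EFin \o g).
  move=> mE; apply: integrableS ig => //; first exact: measurableI.
  by move=> x [_ /bD].
have all0 (E : set (mplane R)) : measurable E -> (\int[area]_(x in E `&` obox a b) (g x)%:E = 0)%E.
  rewrite measurable_plane_oboxes.
  apply: (@dynkin_induction _ _ oboxes
    (fun E : set (mplane R) => (\int[area]_(x in E `&` obox a b) (g x)%:E = 0)%E)).
  - exact: measurable_plane_oboxes.
  - exact: setI_closed_oboxes.
  - by rewrite setTI; exact: (integral_obox_test0 oD ig g0 abD).
  - move=> _ [c [d ->]].
    rewrite oboxI; apply: (integral_obox_test0 oD ig g0).
    apply: subset_trans abD => x []; rewrite /= !in_itv/= !ge_max !le_min.
    by move=> /andP[/andP[_ h1] /andP[_ h2]] /andP[/andP[_ h3] /andP[_ h4]]; split; apply/andP.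
  - move=> S mS PS.
    have mS' := measurableC mS.
    have : (\int[area]_(x in obox a b) (g x)%:E = 0)%E.
      exact: (integral_obox_test0 oD ig g0 abD).
    rewrite -[X in integral _ X _](setUIDK _ S) integral_setU.
    + by rewrite setIC PS add0e setDE setIC.
    + exact: measurableI.
    + exact: measurableD.
    + rewrite setUIDK; apply: measurable_int; rewrite -[obox a b]setTI; exact: igS.
    + by apply/disj_setPS => x [[_ ?] []].
  - move=> F mF tF F0.
    rewrite setI_bigcupl integral_bigcup.
    + by apply: eseries0 => n _ _; exact: F0.
    + apply/trivIsetP => i j _ _ ij; rewrite setIACA.
      by move/trivIsetP : tF => /(_ i j Logic.I Logic.I ij) ->; rewrite set0I.
    + by move=> n; apply: measurableI => //; exact: mF.
    + by rewrite -setI_bigcupl; apply: igS; exact: bigcupT_measurable.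
have : ae_eq area (obox a b) (EFin \o g) (cst 0%E).
  apply: integral_ae_eq => //.
  - by rewrite -[obox a b]setTI; exact: igS.
  - move=> E Eb mE; rewrite integral0 -[RHS](all0 E)// (_ : E `&` _ = E)//.
    exact: setIidl.
by apply: ae_area_mono => x H xab; have [] := H xab.
Qed.

(** Countably many boxes with closure in D cover D, and each contributes a null set. *)
Lemma dubois_reymond D (g : plane R -> R) : open D ->
  area.-integrable (D : set (mplane R)) (EFin \o g) ->
  (forall psi, test_fun D psi -> \int[area]_(x in D) (g x * psi x) = 0) ->
  {ae area, forall x, D x -> g x = 0}.
Proof.
move=> oD ig g0.
pose P n (x : mplane R) := forall ab, @unpickle ((rat * rat) * (rat * rat))%type n = Some ab ->
  cboxab (ratpt ab.1) (ratpt ab.2) `<=` D ->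
  obox (ratpt ab.1 : plane R) (ratpt ab.2) x -> g x = 0.
have : {ae area, forall x n, P n x}.
  apply: ae_foralln => n; rewrite /P.
  case En : (@unpickle ((rat * rat) * (rat * rat))%type n) => [ab|]; last by apply: aeW.
  have [abU|abU] := pselect (cboxab (ratpt ab.1) (ratpt ab.2) `<=` D); last first.
    by apply: aeW => x cd [<-].
  have := integral_obox_ae0 oD ig g0 abU.
  by apply: ae_area_mono => x gx cd [<-] _; exact: gx.
apply: ae_area_mono => x Px Dx.
by have := Dx; rewrite {1}(open_bigcup_obox oD) => -[n _ [ab [En cD] xab]]; exact: (Px n ab).
Qed.

End DuBoisReymond.

(** * A weighted Poincare inequality on the cone *)

Section Integrals.
Context d (T : measurableType d) (R : realType) (mu : {measure set T -> \bar R}).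

(** The integral of a nonnegative function is a supremum over the simple functions below it, so
    comparison requires no measurability. *)
Lemma ge0_le_integralW (D : set T) (f g : T -> \bar R) :
  (forall x, D x -> (0 <= f x)%E) -> (forall x, D x -> (f x <= g x)%E) ->
  (\int[mu]_(x in D) f x <= \int[mu]_(x in D) g x)%E.
Proof.
move=> f0 fg; rewrite (integral_mkcond D f) (integral_mkcond D g).
rewrite !ge0_integralTE.
- apply: le_ereal_sup => _ [h hf <-]; exists h => // x; apply: le_trans (hf x) _.
  by rewrite /patch; case: ifPn => //; rewrite inE; exact: fg.
- by move=> x; rewrite /patch; case: ifPn => //; rewrite inE => Dx; apply: le_trans (fg x Dx); exact: f0.
- by move=> x; rewrite /patch; case: ifPn => //; rewrite inE; exact: f0.
Qed.

End Integrals.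

Section Poincare.
Context {R : realType}.
Notation mu := (@lebesgue_measure R).

Lemma preserving_integral (T : mplane R -> mplane R) (D : set (mplane R)) (f : mplane R -> \bar R) :
  preserving T -> measurable D -> measurable_fun D f -> (forall y, D y -> (0 <= f y)%E) ->
  (\int[area]_(y in D) f y = \int[area]_(x in T @^-1` D) f (T x))%E.
Proof.
move=> [mT pT] mD mf f0.
rewrite -[RHS](ge0_integral_pushforward mT area mD mf); last first.
  by move=> y; rewrite inE; exact: f0.
apply: (@eq_measure_integral _ _ _ _ (pushforward area (mfun_of mT))) => A mA _.
exact/esym/pT.
Qed.

Lemma tonelli_setX (I J : set (measurableTypeR R)) (f : mplane R -> \bar R) :
  measurable I -> measurable J -> measurable_fun setT f -> (forall x, (0 <= f x)%E) ->
  (\int[area]_(x in I `*` J) f x = \int[mu]_(t in I) \int[mu]_(s in J) f (t, s))%E.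
Proof.
move=> mI mJ mf f0; rewrite integral_mkcond.
have mIJ : measurable (I `*` J) by exact: measurableX.
rewrite [LHS](@fubini_tonelli1 _ _ (measurableTypeR R) (measurableTypeR R)); last first.
- by move=> x; rewrite /patch; case: ifPn.
- by apply/(measurable_restrictT _ _).1 => //; exact: measurable_funTS.
rewrite [RHS]integral_mkcond; apply: eq_integral => t _; rewrite /fubini_F.
rewrite [RHS]/patch; case: ifPn => [|/negP]; rewrite inE => It.
  rewrite [RHS]integral_mkcond; apply: eq_integral => s _.
  rewrite /patch; case: ifPn => [|/negP]; rewrite inE => ts; case: ifPn => [|/negP] //; rewrite inE => Js.
  - by case: ts.
  - by exfalso; apply: ts.
apply: integral0_eq => s _; rewrite /patch; case: ifPn => //; rewrite inE => -[/= ? ?]; contradiction.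
Qed.

(** From g(s) = g(0) + int_0^s h and Cauchy-Schwarz. The integral of h^2 is enlarged to ]0, M[ so
    that s survives only as a factor, to be integrated against a weight later. *)
Lemma poincare_segment (g h : R -> R) (M s : R) :
  (forall x : R, is_derive x (1 : R) g (h x)) -> continuous h -> 0 <= s < M ->
  ((g s ^+ 2)%:E <= (2 * g 0 ^+ 2)%:E +
    (2 * s)%:E * \int[mu]_(x in `]0%R, M[) (h x ^+ 2)%:E)%E.
Proof.
move=> Dg ch /andP[s0 sM].
have iC (f : R -> R) : continuous f -> mu.-integrable `[0, s] (EFin \o f).
  move=> cf; apply: continuous_compact_integrable; first exact: segment_compact.
  exact: continuous_subspaceT.
have ch2 : continuous (fun x : R => h x ^+ 2).
  by move=> x; rewrite (_ : (fun x => h x ^+ 2) = h \* h)//; apply: cvgM; exact: ch.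
pose I2 := \int[mu]_(x in `[0, s]) (h x ^+ 2).
have E : \int[mu]_(x in `[0, s]) h x = g s - g 0.
  by rewrite /Rintegral (FTC2_segment Dg ch s0).
have m1 : \int[mu]_(x in `[0, s]) (1 : R) = s.
  by rewrite Rintegral_cst//= lebesgue_measure_itv/= lte_fin; case: ifPn => ?; rewrite ?mul1r ?subr0//=; lra.
have CS : (g s - g 0) ^+ 2 <= s * I2.
  have [->|s_neq0] := eqVneq s 0; first by rewrite subrr expr0n mul0r.
  have s_gt0 : 0 < s by rewrite lt_def s_neq0.
  (* m is the mean of h over [0, s]; Cauchy-Schwarz is obtained as the nonnegativity of the integral
     of (h - m)^2. *)
  pose m := (g s - g 0) / s.
  have : 0 <= \int[mu]_(x in `[0, s]) ((h x ^+ 2 + (- 2 * m) * h x) + (m ^+ 2) * 1).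
    apply: Rintegral_ge0 => x _.
    have -> : h x ^+ 2 + - 2 * m * h x + m ^+ 2 * 1 = (h x - m) ^+ 2 by ring.
    exact: sqr_ge0.
  have i1 := iC _ ch2; have i2 := iC _ ch; have i3 := iC (fun=> 1) (@cst_continuous _ _ _).
  rewrite RintegralD//; last 2 first.
  - have := integrableD _ i1 (integrableZl _ (- 2 * m) i2).
    by apply.
  - exact: (integrableZl _ (m ^+ 2) i3).
  rewrite RintegralD//; last exact: (integrableZl _ (- 2 * m) i2).
  rewrite !RintegralZl// m1 E -/I2 => H.
  rewrite -subr_ge0; apply: le_trans (mulr_ge0 s0 H) _.
  by rewrite le_eqVlt; apply/orP; left; apply/eqP; rewrite /m; field.
have : (I2%:E <= \int[mu]_(x in `]0%R, M[) (h x ^+ 2)%:E)%E.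
  rewrite /I2 /Rintegral fineK; last exact: integrable_fin_num (iC _ ch2).
  rewrite -integral_itv_obnd_cbnd; last first.
    by apply/measurable_EFinP; apply: measurable_funTS; exact: continuous_measurable_fun.
  apply: ge0_subset_integral => //.
  - by apply/measurable_EFinP; apply: measurable_funTS; exact: continuous_measurable_fun.
  - by move=> x _; rewrite lee_fin sqr_ge0.
  - by move=> x /=; rewrite !in_itv/= => /andP[-> /le_lt_trans]; exact.
move=> H; apply: (@le_trans _ _ (2 * g 0 ^+ 2 + 2 * s * I2)%:E).
  rewrite lee_fin; have := sqr_ge0 (g s - 2 * g 0).
  by have := CS; nra.
by rewrite EFinD leeD2l// EFinM lee_wpmul2l// lee_fin mulr_ge0.
Qed.

End Poincare.

Section DirectionalDerivative.
Context {R : realType}.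

Lemma mvt_line_le (f f' : plane R -> R) (v p : plane R) (a L eps : R) :
  (forall x, is_derive x v f (f' x)) ->
  (forall t : R, `|t| <= `|a| -> `|f' (p + t *: v) - L| <= eps) ->
  `|f (p + a *: v) - f p - a * L| <= eps * `|a|.
Proof.
move=> Df bnd.
pose g (t : R) := f (p + t *: v); pose dg (t : R) := f' (p + t *: v).
have Dg (t : R) : is_derive t (1 : R) g (dg t) by apply: is_derive_path.
have cg : continuous g := is_derive1_continuous Dg.
have key (u w : R) : u <= w -> (forall t, u <= t <= w -> `|t| <= `|a|) ->
    `|g w - g u - (w - u) * L| <= eps * (w - u).
  move=> uw sub.
  have [t] := MVT_segment uw (fun t _ => Dg t) (continuous_subspaceT cg).
  rewrite in_itv/= => tuw ->; rewrite [_ * L]mulrC -mulrBl normrM.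
  by rewrite [X in _ * X]ger0_norm ?subr_ge0// ler_wpM2r ?subr_ge0//; apply: bnd; exact: sub.
have g0 : g 0 = f p by rewrite /g scale0r addr0.
have [a0|a0] := leP 0 a.
  have sub t : 0 <= t <= a -> `|t| <= `|a|.
    by move=> /andP[t0 ta]; rewrite !ger0_norm// (le_trans t0 ta).
  by have := key 0 a a0 sub; rewrite g0 subr0 (ger0_norm a0).
have sub t : a <= t <= 0 -> `|t| <= `|a|.
  by move=> /andP[ta t0]; rewrite (ler0_norm t0) (ltr0_norm a0) lerN2.
have := key a 0 (ltW a0) sub; rewrite g0 sub0r (ltr0_norm a0) -/(g a).
by rewrite -normrN; congr (`|_| <= _); ring.
Qed.

(** [smooth] speaks of the two axes only. As the partial derivatives are continuous, moving along
    one axis and then the other, with the mean value theorem on each leg, gives every direction. *)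
Lemma smooth_is_derive_dir (f : plane R -> R) (v x : plane R) : smooth f ->
  is_derive x v f (v.1 * 'D_(axis false) f x + v.2 * 'D_(axis true) f x).
Proof.
move=> sf.
set L0 := 'D_(axis false) f x; set L1 := 'D_(axis true) f x.
pose K := `|v.1| + `|v.2| + 1.
have K0 : 0 < K by rewrite ltr_wpDl// addr_ge0.
have lim : h^-1 *: ((f \o shift x) (h *: v) - f x) @[h --> 0^'] --> v.1 * L0 + v.2 * L1.
  apply/cvgrPdist_le => eps eps0.
  have e0 : 0 < eps / K by rewrite divr_gt0.
  have c0 := smooth_continuous (smooth_derive false sf) (x := x).
  have c1 := smooth_continuous (smooth_derive true sf) (x := x).
  move/cvgrPdist_le : c0 => /(_ _ e0) /nbhs_ballP[d0 /= d00 H0].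
  move/cvgrPdist_le : c1 => /(_ _ e0) /nbhs_ballP[d1 /= d10 H1].
  near=> h.
  have h0 : h != 0 by near: h; exact: nbhs_dnbhs_neq.
  have hd0 : `|h| * K < d0.
    by rewrite -ltr_pdivlMr//; near: h; apply: dnbhs0_lt; rewrite divr_gt0.
  have hd1 : `|h| * K < d1.
    by rewrite -ltr_pdivlMr//; near: h; apply: dnbhs0_lt; rewrite divr_gt0.
  have small (t : R) i : `|t| <= `|h * (if i then v.2 else v.1)| -> `|t| <= `|h| * K.
    move=> /le_trans; apply; rewrite normrM ler_wpM2l// /K.
    by case: i; rewrite -addrA ?lerDl ?addr_ge0// addrCA lerDl addr_ge0.
  have hv1 : `|h * v.1| <= `|h| * K by apply: (@small _ false).
  pose p := x + (h * v.1) *: axis false.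
  have B1 : `|f (p + (h * v.2) *: axis true) - f p - h * v.2 * L1| <= eps / K * `|h * v.2|.
    apply: (mvt_line_le (fun y => smooth_is_derive true y sf)) => t /(@small t true) tK.
    rewrite distrC; apply: H1; split; rewrite /ball/= /GRing.scale/= !(mulr0, mulr1, addr0, add0r).
      by rewrite opprD addrA subrr add0r normrN (le_lt_trans hv1).
    by rewrite opprD addrA subrr add0r normrN (le_lt_trans tK).
  have B0 : `|f p - f x - h * v.1 * L0| <= eps / K * `|h * v.1|.
    apply: (mvt_line_le (fun y => smooth_is_derive false y sf)) => t /(@small t false) tK.
    rewrite distrC; apply: H0; split; rewrite /ball/= /GRing.scale/= !(mulr0, mulr1, addr0, add0r).
      by rewrite opprD addrA subrr add0r normrN (le_lt_trans tK).
    by rewrite subrr normr0.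
  have E : f (h *: v + x) = f (p + (h * v.2) *: axis true).
    rewrite /p; congr f; rewrite [RHS]surjective_pairing [LHS]surjective_pairing /=.
    by rewrite /GRing.scale/=; congr pair; ring.
  rewrite /= E distrC.
  have -> : h^-1 *: (f (p + (h * v.2) *: axis true) - f x) - (v.1 * L0 + v.2 * L1) =
    h^-1 * ((f (p + (h * v.2) *: axis true) - f p - h * v.2 * L1) + (f p - f x - h * v.1 * L0)).
    by rewrite /GRing.scale/=; field.
  rewrite normrM normfV ler_pdivrMl ?normr_gt0//.
  apply: le_trans (ler_normD _ _) _; apply: le_trans (lerD B1 B0) _.
  rewrite -mulrDr !normrM -mulrDr mulrCA ler_wpM2l//.
  rewrite mulrAC ler_pdivrMr// ler_wpM2l ?(ltW eps0)//.
  by rewrite /K [`|v.1| + _]addrC lerDl.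
by apply: DeriveDef; [apply/cvg_ex; eexists; exact: lim | rewrite /derive; apply/cvg_lim].
Unshelve. all: by end_near. Qed.

End DirectionalDerivative.

Lemma measurable_tonelli_inner (R : realType) (J : set (measurableTypeR R))
    (f : mplane R -> \bar R) :
  measurable J -> measurable_fun setT f -> (forall x, (0 <= f x)%E) ->
  measurable_fun setT (fun t : measurableTypeR R => \int[@lebesgue_measure R]_(s in J) f (t, s))%E.
Proof.
move=> mJ mf f0; have mIJ : measurable (setT `*` J : set (mplane R)) by exact: measurableX.
have := @measurable_fun_fubini_tonelli_F _ _ (measurableTypeR R) (measurableTypeR R) R
  (@lebesgue_measure R) (f \_ (setT `*` J)).
move=> /(_ _ _)H; apply: eq_measurable_fun (H _ _).
- move=> t _; rewrite /fubini_F [RHS]integral_mkcond; apply: eq_integral => s _.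
  rewrite /patch; congr (if _ then _ else _).
  by apply/idP/idP; rewrite !inE => // -[].
- by apply/(measurable_restrictT _ _).1 => //; exact: measurable_funTS.
- by move=> x; rewrite /patch; case: ifPn.
Qed.

Lemma mul_sqr_ge0 (R : realType) (p r : R) : 0 <= p -> 0 <= p * r ^+ 2.
Proof. by move=> p0; rewrite mulr_ge0// sqr_ge0. Qed.

Section Cone.
Context {R : realType}.
Notation mu := (@lebesgue_measure R).
Variables (e : plane R) (c : R).
Hypothesis e1 : e.1 ^+ 2 + e.2 ^+ 2 = 1.

Notation b := (rot90 e).
Notation Psi := (cone_chart e c).

Definition tc (x : plane R) : R := dot x e.
(* The height of x over the graph of [c * |t|], so that the cone is [0 < sc]. *)
Definition sc (x : plane R) : R := dot x b - c * `|tc x|.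

Lemma tc_chart y : tc (Psi y) = y.1.
Proof.
rewrite /tc /cone_chart /rot /dot /= /GRing.scale/=.
transitivity (y.1 * (e.1 ^+ 2 + e.2 ^+ 2)); first by ring.
by rewrite e1 mulr1.
Qed.

Lemma dot_chart y : dot (Psi y) b = y.2 + c * `|y.1|.
Proof.
rewrite /tc /cone_chart /rot /dot /= /GRing.scale/=.
transitivity ((y.2 + c * `|y.1|) * (e.1 ^+ 2 + e.2 ^+ 2)); first by ring.
by rewrite e1 mulr1.
Qed.

Lemma sc_chart y : sc (Psi y) = y.2.
Proof. by rewrite /sc tc_chart dot_chart addrK. Qed.

Lemma continuous_tc : continuous tc.
Proof.
have -> : tc = dot e by apply/funext => x; rewrite /tc /dot mulrC [x.2 * _]mulrC.
exact: continuous_dot.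
Qed.

Lemma continuous_dotr (a : plane R) : continuous (fun x => dot x a).
Proof.
have -> : (fun x => dot x a) = dot a.
  by apply/funext => x; rewrite /dot mulrC [x.2 * _]mulrC.
exact: continuous_dot.
Qed.

Lemma continuous_sc : continuous sc.
Proof.
move=> x; apply: cvgB; first exact: continuous_dotr.
apply: cvgM; first exact: cvg_cst.
by apply: (continuous_comp (continuous_tc (x := x))); exact: norm_continuous.
Qed.

Lemma continuous_chart_line (t : R) : continuous (fun s : R => Psi (t, s)).
Proof.
move=> s; rewrite /cone_chart /rot /=.
apply: cvgD; first exact: cvg_cst.
apply: cvgZ; last exact: cvg_cst.
by apply: cvgD; [exact: cvg_id | exact: cvg_cst].
Qed.

(** The image under the chart of the rectangle ]-l, l[ x ]0, M[, where Fubini's theorem applies; the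
    lower side of the rectangle corresponds to the two edges of the cone. *)
Definition cone_rect (l M : R) : set (plane R) :=
  [set x | - l < tc x < l /\ 0 < sc x < M].

Lemma cone_rect_chart l M : Psi @^-1` (cone_rect l M) = `]- l, l[ `*` `]0, M[.
Proof.
by apply/seteqP; split=> y; rewrite /cone_rect /= tc_chart sc_chart !in_itv.
Qed.

Lemma open_cone_rect l M : open (cone_rect l M).
Proof.
have -> : cone_rect l M = (tc @^-1` `]- l, l[) `&` (sc @^-1` `]0, M[).
  by apply/seteqP; split=> y; rewrite /cone_rect /= !in_itv.
apply: openI.
- by apply: open_comp => // x _; exact: continuous_tc.
- by apply: open_comp => // x _; exact: continuous_sc.
Qed.

Lemma measurable_cone_rect l M : measurable (cone_rect l M : set (mplane R)).
Proof. by apply: measurable_open; exact: open_cone_rect. Qed.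

Lemma integral_cone_rect l M (f : mplane R -> \bar R) :
  measurable_fun (cone_rect l M : set (mplane R)) f ->
  (forall y, cone_rect l M y -> (0 <= f y)%E) ->
  (\int[area]_(y in cone_rect l M) f y =
   \int[area]_(y in `](- l)%R, l[ `*` `]0%R, M[) f (Psi y))%E.
Proof.
move=> mf f0; rewrite -cone_rect_chart.
apply: (@preserving_integral R Psi (cone_rect l M)) => //.
  exact: preserving_cone_chart.
exact: measurable_cone_rect.
Qed.

Definition dirb (f : plane R -> R) (x : plane R) : R :=
  b.1 * 'D_(axis false) f x + b.2 * 'D_(axis true) f x.

Lemma continuous_dirb f : smooth f -> continuous (dirb f).
Proof.
by move=> sf x; apply: cvgD; apply: cvgM; (exact: cvg_cst || exact: (smooth_continuous (smooth_derive _ sf))).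
Qed.

Lemma is_derive_chart_line f t s : smooth f ->
  is_derive s (1 : R) (fun s : R => f (Psi (t, s))) (dirb f (Psi (t, s))).
Proof.
move=> sf.
have E s' : Psi (t, s') = (t *: e + (c * `|t|) *: b) + s' *: b.
  by rewrite /cone_chart /rot /= scalerDl [s' *: _ + _]addrC addrA.
have -> : (fun s : R => f (Psi (t, s))) = (fun s => f ((t *: e + (c * `|t|) *: b) + s *: b)).
  by apply/funext => s'; rewrite E.
by rewrite E; apply: is_derive_path; exact: smooth_is_derive_dir.
Qed.

Lemma continuous_chart_edge (s : R) : continuous (fun t : R => Psi (t, s)).
Proof.
move=> t; rewrite /cone_chart /rot /=.
apply: cvgD; apply: cvgZ; try exact: cvg_cst; first exact: cvg_id.
apply: cvgD; first exact: cvg_cst.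
by apply: cvgM; [exact: cvg_cst | exact: norm_continuous].
Qed.

(* Integrate along the axis of the cone, starting on its edge. *)
Lemma weighted_poincare_smooth (f : plane R -> R) (wa wb : R -> R) (l M : R) :
  smooth f -> 0 < M ->
  measurable_fun setT wa -> measurable_fun setT wb ->
  (forall t, 0 <= wa t) -> (forall s, 0 <= wb s) ->
  (\int[area]_(x in cone_rect l M) (wa (tc x) * wb (sc x) * f x ^+ 2)%:E <=
   (2%:E * \int[mu]_(s in `]0%R, M[) (wb s)%:E) *
     \int[mu]_(t in `](- l)%R, l[) (wa t * f (Psi (t, 0%R)) ^+ 2)%:E +
   (2%:E * \int[mu]_(s in `]0%R, M[) (s * wb s)%:E) *
     \int[area]_(x in cone_rect l M) (wa (tc x) * dirb f x ^+ 2)%:E)%E.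
Proof.
move=> sf M0 mwa mwb wa0 wb0.
have cf := smooth_continuous sf; have cd := continuous_dirb sf.
have mc (g : plane R -> R) (D : set (mplane R)) : continuous g -> measurable D -> measurable_fun D g.
  exact: continuous_measurable_plane.
have sq (g : plane R -> R) : continuous g -> continuous (fun x => g x ^+ 2).
  by move=> cg x; rewrite (_ : (fun x => g x ^+ 2) = g \* g)//; apply: cvgM; exact: cg.
have mS := measurable_cone_rect l M.
have mta : measurable_fun (setT : set (mplane R)) (wa \o tc).
  by apply: measurableT_comp => //; apply: mc => //; exact: continuous_tc.
have msb : measurable_fun (setT : set (mplane R)) (wb \o sc).
  by apply: measurableT_comp => //; apply: mc => //; exact: continuous_sc.
have m1 : measurable_fun (setT : set (mplane R)) (fun x => wa (tc x) * wb (sc x) * f x ^+ 2).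
  by do 2! [apply: measurable_funM => //]; apply: mc => //; exact: sq.
have m2 : measurable_fun (setT : set (mplane R)) (fun x => wa (tc x) * dirb f x ^+ 2).
  by apply: measurable_funM => //; apply: mc => //; exact: sq.
have mPsi : measurable_fun (setT : set (mplane R)) (Psi : _ -> mplane R).
  by case: (preserving_cone_chart c e1).
rewrite integral_cone_rect; last 2 first.
- by apply/measurable_EFinP; exact: measurable_funTS.
- by move=> y _; rewrite lee_fin mul_sqr_ge0 ?mulr_ge0.
rewrite (@integral_cone_rect l M (fun x => (wa (tc x) * dirb f x ^+ 2)%:E)); last 2 first.
- by apply/measurable_EFinP; exact: measurable_funTS.
- by move=> y _; rewrite lee_fin mul_sqr_ge0 ?mulr_ge0.
have m1' : measurable_fun setT (fun y : mplane R => (wa (tc (Psi y)) * wb (sc (Psi y)) * f (Psi y) ^+ 2)%:E).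
  by apply/measurable_EFinP; exact: (measurableT_comp m1 mPsi).
have m2' : measurable_fun setT (fun y : mplane R => (wa (tc (Psi y)) * dirb f (Psi y) ^+ 2)%:E).
  by apply/measurable_EFinP; exact: (measurableT_comp m2 mPsi).
rewrite !tonelli_setX//; last 2 first.
- by move=> y; rewrite lee_fin mul_sqr_ge0 ?mulr_ge0.
- by move=> y; rewrite lee_fin mul_sqr_ge0 ?mulr_ge0.
pose A t := wa t * f (Psi (t, 0)) ^+ 2.
pose C t := (\int[mu]_(s in `]0%R, M[) (wa t * dirb f (Psi (t, s)) ^+ 2)%:E)%E.
pose K0 := (\int[mu]_(s in `]0%R, M[) (wb s)%:E)%E.
pose K1 := (\int[mu]_(s in `]0%R, M[) (s * wb s)%:E)%E.
have Aa0 t : 0 <= A t by rewrite mul_sqr_ge0.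
have A20 t : 0 <= 2 * A t by rewrite pmulr_rge0.
have K00 : (0 <= K0)%E by apply: integral_ge0 => s' _; rewrite lee_fin.
have K10 : (0 <= K1)%E.
  by apply: integral_ge0 => s'; rewrite /= in_itv/= => /andP[? _]; rewrite lee_fin mulr_ge0// ltW.
have C0 t : (0 <= C t)%E by apply: integral_ge0 => s' _; rewrite lee_fin mul_sqr_ge0.
have mC : measurable_fun setT C.
  have := measurable_tonelli_inner (measurable_itv `]0%R, M[) m2' _.
  have P0 (y : mplane R) : (0 <= (wa (tc (Psi y)) * dirb f (Psi y) ^+ 2)%:E)%E.
    by rewrite lee_fin mul_sqr_ge0.
  move=> /(_ P0); apply: eq_measurable_fun => t _; apply: eq_integral => s' _.
  by rewrite tc_chart.
have mA : measurable_fun setT A.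
  apply: measurable_funM => //; apply: continuous_measurable_fun => t.
  exact: (@continuous_comp _ _ _ (fun t : R => Psi (t, 0)) (fun x : plane R => f x ^+ 2) t
    (@continuous_chart_edge 0 t) (sq f cf _)).
(* For fixed t, [poincare_segment] is integrated in s against wb: the edge value picks up K0, and
   the factor s turns into K1. *)
apply: (@le_trans _ _ (\int[mu]_(t in `](- l)%R, l[) ((2%:E * K0) * (A t)%:E + (2%:E * K1) * C t))%E).
  apply: ge0_le_integralW => t _.
    by apply: integral_ge0 => s' _; rewrite lee_fin mul_sqr_ge0 ?mulr_ge0.
  have mwb' (D : set R) : measurable_fun D (fun s => (wb s)%:E).
    by apply/measurable_EFinP; exact: measurable_funTS.
  have mswb' (D : set R) : measurable_fun D (fun s : R => (s * wb s)%:E).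
    by apply/measurable_EFinP; apply: measurable_funM; [exact: measurable_id|exact: measurable_funTS].
  have -> : ((2%:E * K0) * (A t)%:E + (2%:E * K1) * C t =
     \int[mu]_(s in `]0%R, M[) ((2 * A t)%:E * (wb s)%:E + (2%:E * C t) * (s * wb s)%:E))%E.
    rewrite ge0_integralD//; last 4 first.
    - by move=> s' _; rewrite mule_ge0// lee_fin.
    - apply: measurable_funeM; exact: mwb'.
    - move=> s'; rewrite /= in_itv/= => /andP[s0 _].
      by rewrite !mule_ge0// lee_fin mulr_ge0// ltW.
    - apply: measurable_funeM; exact: mswb'.
    rewrite ge0_integralZl//; last 2 first.
    - by move=> s' _; rewrite lee_fin.
    - by rewrite lee_fin.
    rewrite ge0_integralZl//; last 2 first.
    - by move=> s'; rewrite /= in_itv/= => /andP[s0 _]; rewrite lee_fin mulr_ge0// ltW.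
    - by rewrite mule_ge0.
    by congr (_ + _)%E; rewrite ?EFinM; exact: muleAC.
    exact: mswb'.
    exact: mwb'.
  apply: ge0_le_integralW => s'; first by move=> _; rewrite lee_fin mul_sqr_ge0 ?mulr_ge0.
  rewrite /= in_itv/= => /andP[s0 sM]; rewrite tc_chart sc_chart /=.
  have ds (s : R) := @is_derive_chart_line f t s sf.
  have cds : continuous (fun s : R => dirb f (Psi (t, s))).
    move=> s; exact: (@continuous_comp _ _ _ (fun s : R => Psi (t, s)) (dirb f) s
      (@continuous_chart_line t s) (cd _)).
  have sM' : 0 <= s' < M by rewrite (ltW s0).
  have := poincare_segment ds cds sM'.
  have CE : C t = ((wa t)%:E * \int[mu]_(x in `]0%R, M[) (dirb f (Psi (t, x)) ^+ 2)%:E)%E.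
    have mh : measurable_fun (`]0, M[%classic : set (measurableTypeR R))
        (fun s => (dirb f (Psi (t, s)) ^+ 2)%:E).
      apply/measurable_EFinP; apply: measurable_funTS; apply: continuous_measurable_fun => s.
      exact: (@continuous_comp _ _ _ (fun s : R => Psi (t, s)) (fun x => dirb f x ^+ 2) s
        (@continuous_chart_line t s) (sq _ cd _)).
    rewrite -(ge0_integralZl mu (measurable_itv _) mh) ?lee_fin//.
    by move=> x _; rewrite lee_fin sqr_ge0.
  rewrite CE => H.
  have w0 : (0 <= (wa t * wb s')%:E)%E by rewrite lee_fin mulr_ge0.
  apply: le_trans (lee_wpmul2l w0 H) _.
  set X := (\int[mu]_(x in _) _)%E.
  have X0 : (0 <= X)%E by apply: integral_ge0 => x _; rewrite lee_fin sqr_ge0.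
  rewrite le_eqVlt; apply/orP; left; apply/eqP.
  have p0 : (0 <= (2 * f (Psi (t, 0%R)) ^+ 2)%:E)%E by rewrite lee_fin mul_sqr_ge0.
  have q0 : (0 <= (2 * s')%:E * X)%E by rewrite mule_ge0// lee_fin mulr_ge0// ltW.
  rewrite (ge0_muleDr _ p0 q0).
  congr (_ + _)%E; first by rewrite -!EFinM; congr EFin; rewrite /A; ring.
  by rewrite [(2%:E * _)%E]muleA [RHS]muleAC muleA -!EFinM; congr (_%:E * _)%E; ring.
have mAE : measurable_fun (`]- l, l[%classic : set (measurableTypeR R)) (fun t => (A t)%:E).
  by apply/measurable_EFinP; exact: measurable_funTS.
have mC' : measurable_fun (`]- l, l[%classic : set (measurableTypeR R)) C.
  exact: measurable_funTS.
have A0E t : (0 <= (A t)%:E)%E by rewrite lee_fin.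
have k0 : (0 <= 2%:E * K0)%E by rewrite mule_ge0.
have k1 : (0 <= 2%:E * K1)%E by rewrite mule_ge0.
have f1 (t : R) : (`]- l, l[%classic : set R) t -> (0 <= (2%:E * K0) * (A t)%:E)%E.
  by move=> _; apply: mule_ge0.
have f2 (t : R) : (`]- l, l[%classic : set R) t -> (0 <= (2%:E * K1) * C t)%E.
  by move=> _; apply: mule_ge0.
have mk1 := measurable_funeM (2%:E * K0)%E mAE.
have mk2 := measurable_funeM (2%:E * K1)%E mC'.
rewrite ge0_integralD//.
have I1 : (\int[mu]_(t in `](- l)%R, l[) ((2%:E * K0) * (A t)%:E) =
    (2%:E * K0) * \int[mu]_(t in `](- l)%R, l[) (A t)%:E)%E.
  by apply: ge0_integralZl.
have I2 : (\int[mu]_(t in `](- l)%R, l[) ((2%:E * K1) * C t) =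
    (2%:E * K1) * \int[mu]_(t in `](- l)%R, l[) C t)%E.
  by apply: ge0_integralZl.
rewrite I1 I2 /A /K0 /K1; apply: leeD; first exact: lexx.
rewrite le_eqVlt; apply/orP; left; apply/eqP; congr (_ * _)%E.
by apply: eq_integral => t _; apply: eq_integral => s' _; rewrite tc_chart.
Qed.

End Cone.

Section WeightedPoincare.
Context {R : realType}.
Notation mu := (@lebesgue_measure R).
Variables (e : plane R) (c : R).
Hypothesis e1 : e.1 ^+ 2 + e.2 ^+ 2 = 1.

Lemma integral_sq_le2 (D : set (mplane R)) (f g h : plane R -> R) :
  measurable D -> measurable_fun D g -> measurable_fun D h ->
  (forall x, D x -> 0 <= f x <= 2 * g x ^+ 2 + 2 * h x) -> (forall x, D x -> 0 <= h x) ->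
  (\int[area]_(x in D) (f x)%:E <=
   2%:E * \int[area]_(x in D) (g x ^+ 2)%:E + 2%:E * \int[area]_(x in D) (h x)%:E)%E.
Proof.
move=> mD mg mh fgh h0.
have mg2 : measurable_fun D (fun x => (g x ^+ 2)%:E).
  by apply/measurable_EFinP; exact: measurable_funX.
have mhE : measurable_fun D (fun x => (h x)%:E) by exact/measurable_EFinP.
rewrite -(ge0_integralZl_EFin area mD _ mg2)//; last by move=> x _; rewrite lee_fin sqr_ge0.
rewrite -(ge0_integralZl_EFin area mD _ mhE)//.
have mk1 := measurable_funeM 2%:E mg2; have mk2 := measurable_funeM 2%:E mhE.
rewrite -ge0_integralD//.
- apply: ge0_le_integralW => x Dx; have /andP[f0 fl] := fgh x Dx; first by rewrite lee_fin.
  by rewrite -!EFinM -EFinD lee_fin.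
- by move=> x _; rewrite -EFinM lee_fin mul_sqr_ge0.
- by move=> x Dx; rewrite -EFinM lee_fin mulr_ge0// h0.
Qed.

(** The inequality passes from the smooth chi n to u, the edge term tending to 0: this is the only
    way in which a vanishing trace is used. The weights are at most 1 so that the unweighted L^2
    errors dominate. The constant 8 is 2 from the smooth inequality, times 2 for replacing u by chi
    n, times 2 for replacing the derivative of chi n by G. *)
Lemma weighted_poincare (u G : plane R -> R) (chi : nat -> plane R -> R)
    (wa wb : R -> R) (l M : R) (S := cone_rect e c l M : set (mplane R)) :
  (forall n, smooth (chi n)) -> 0 < M ->
  measurable_fun setT wa -> measurable_fun setT wb ->
  (forall t, 0 <= wa t <= 1) -> (forall s, 0 <= wb s <= 1) ->
  measurable_fun S u -> measurable_fun S G ->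
  (\int[area]_(x in S) ((chi n x - u x) ^+ 2)%:E)%E @[n --> \oo] --> 0%E ->
  (\int[area]_(x in S) ((dirb e (chi n) x - G x) ^+ 2)%:E)%E @[n --> \oo] --> 0%E ->
  (\int[mu]_(t in `](- l)%R, l[) (chi n (cone_chart e c (t, 0%R)) ^+ 2)%:E)%E @[n --> \oo] --> 0%E ->
  (\int[area]_(x in S) (wa (tc e x) * wb (sc e c x) * u x ^+ 2)%:E <=
   (8%:E * \int[mu]_(s in `]0%R, M[) (s * wb s)%:E) *
     \int[area]_(x in S) (wa (tc e x) * G x ^+ 2)%:E)%E.
Proof.
move=> schi M0 mwa mwb wa01 wb01 mu_ mG cu cG ct.
have wa0 t : 0 <= wa t by case/andP: (wa01 t).
have wb0 t : 0 <= wb t by case/andP: (wb01 t).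
have mS : measurable S by exact: measurable_cone_rect.
have mtc : measurable_fun S (fun x => wa (tc e x)).
  apply: (measurableT_comp mwa); apply: continuous_measurable_plane => //; exact: continuous_tc.
have msc : measurable_fun S (fun x => wb (sc e c x)).
  apply: (measurableT_comp mwb); apply: continuous_measurable_plane => //; exact: continuous_sc.
set K1 := (\int[mu]_(s in `]0%R, M[) (s * wb s)%:E)%E.
set K0 := (\int[mu]_(s in `]0%R, M[) (wb s)%:E)%E.
set L := (\int[area]_(x in S) (wa (tc e x) * G x ^+ 2)%:E)%E.
have itvM : mu (`]0, M[%classic) = M%:E.
  by rewrite lebesgue_measure_itv/= lte_fin M0 -EFinB subr0.
have bnd (f : R -> R) (B : R) : (forall s, `]0, M[%classic s -> 0 <= f s <= B) ->
    (\int[mu]_(s in `]0%R, M[) (f s)%:E)%E \is a fin_num.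
  move=> fB; rewrite ge0_fin_numE; last first.
    by apply: integral_ge0 => s /fB /andP[? _]; rewrite lee_fin.
  apply: (@le_lt_trans _ _ (\int[mu]_(s in `]0%R, M[) B%:E)%E).
    by apply: ge0_le_integralW => s /fB /andP[? ?]; rewrite lee_fin.
  by rewrite integral_cst//= itvM -EFinM ltry.
have K0fin : K0 \is a fin_num by apply: (bnd _ 1) => s _; exact: wb01.
have K1fin : K1 \is a fin_num.
  apply: (bnd _ M) => s; rewrite /= in_itv/= => /andP[s0 sM].
  have /andP[? ?] := wb01 s; rewrite mulr_ge0 ?(ltW s0)//=.
  by rewrite -[leRHS]mulr1 ler_pM// ltW.
have K10 : (0 <= K1)%E.
  by apply: integral_ge0 => s; rewrite /= in_itv/= => /andP[? _]; rewrite lee_fin mulr_ge0// ltW.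
have K00 : (0 <= K0)%E by apply: integral_ge0 => s _; rewrite lee_fin.
have L0 : (0 <= L)%E by apply: integral_ge0 => x _; rewrite lee_fin mul_sqr_ge0.
pose E n := (\int[area]_(x in S) ((chi n x - u x) ^+ 2)%:E)%E.
pose E' n := (\int[area]_(x in S) ((dirb e (chi n) x - G x) ^+ 2)%:E)%E.
pose T n := (\int[mu]_(t in `](- l)%R, l[) (chi n (cone_chart e c (t, 0%R)) ^+ 2)%:E)%E.
have mchi n : measurable_fun S (chi n).
  by apply: continuous_measurable_plane => //; exact: smooth_continuous.
have mdchi n : measurable_fun S (dirb e (chi n)).
  by apply: continuous_measurable_plane => //; exact: continuous_dirb.
have step n : (\int[area]_(x in S) (wa (tc e x) * wb (sc e c x) * u x ^+ 2)%:E <=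
   2%:E * E n + 2%:E * ((2%:E * K0) * T n + (2%:E * K1) * (2%:E * E' n + 2%:E * L)))%E.
  apply: (@le_trans _ _ (2%:E * E n + 2%:E *
     \int[area]_(x in S) (wa (tc e x) * wb (sc e c x) * chi n x ^+ 2)%:E)%E).
    apply: integral_sq_le2 => //.
    - exact: measurable_funB.
    - by apply: measurable_funM; [exact: measurable_funM | exact: measurable_funX].
    - move=> x _; have /andP[a0 a1] := wa01 (tc e x); have /andP[b0 b1] := wb01 (sc e c x).
      set p := wa _ * wb _.
      have p0 : 0 <= p by exact: mulr_ge0.
      have p1 : p <= 1 by exact: mulr_ile1.
      rewrite mul_sqr_ge0//=.
      have H1 : u x ^+ 2 <= 2 * (chi n x - u x) ^+ 2 + 2 * chi n x ^+ 2.
        by have := sqr_ge0 (2 * chi n x - u x); nra.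
      apply: le_trans (ler_wpM2l p0 H1) _.
      rewrite mulrDr lerD//; last by rewrite mulrCA.
      by rewrite mulrCA ler_wpM2l// ler_piMl// sqr_ge0.
    - by move=> x _; rewrite mul_sqr_ge0// mulr_ge0.
  rewrite leeD2l// lee_wpmul2l//.
  apply: le_trans (weighted_poincare_smooth c e1 l (schi n) M0 mwa mwb wa0 wb0) _.
  apply: leeD.
    apply: lee_wpmul2l; first by rewrite mule_ge0.
    apply: ge0_le_integralW => t _; rewrite lee_fin; first exact: mul_sqr_ge0.
    by rewrite ler_piMl ?sqr_ge0//; case/andP: (wa01 t).
  apply: lee_wpmul2l; first by rewrite mule_ge0.
  apply: integral_sq_le2 => //.
  - exact: measurable_funB.
  - by apply: measurable_funM => //; exact: measurable_funX.
  - move=> x _; have /andP[a0 a1] := wa01 (tc e x).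
    rewrite mul_sqr_ge0//=.
    have H1 : dirb e (chi n) x ^+ 2 <= 2 * (dirb e (chi n) x - G x) ^+ 2 + 2 * G x ^+ 2.
      by have := sqr_ge0 (dirb e (chi n) x - 2 * G x); nra.
    apply: le_trans (ler_wpM2l a0 H1) _.
    rewrite mulrDr lerD//; last by rewrite mulrCA.
    by rewrite mulrCA ler_wpM2l// ler_piMl// sqr_ge0.
  - by move=> x _; rewrite mul_sqr_ge0.
have lim : (2%:E * E n + 2%:E * ((2%:E * K0) * T n + (2%:E * K1) * (2%:E * E' n + 2%:E * L)))%E @[n --> \oo]
   --> (2%:E * 0 + 2%:E * ((2%:E * K0) * 0 + (2%:E * K1) * (2%:E * 0 + 2%:E * L)))%E.
  apply: cvgeD; first by rewrite mule0; apply: fin_num_adde_defr.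
    by apply: cvgeZl.
  apply: cvgeZl => //; apply: cvgeD.
  - by rewrite mule0.
  - by apply: cvgeZl => //; rewrite fin_numM.
  apply: cvgeZl; first by rewrite fin_numM.
  apply: cvgeD; first by rewrite mule0.
    by apply: cvgeZl.
  exact: cvg_cst.
have E8 : (2%:E * 0 + 2%:E * ((2%:E * K0) * 0 + (2%:E * K1) * (2%:E * 0 + 2%:E * L)) =
    (8%:E * K1) * L :> \bar R)%E.
  rewrite !mule0 !add0e !muleA; congr (_ * _)%E.
  by rewrite muleAC -!EFinM; congr (_%:E * _)%E; ring.
by rewrite -E8; apply: cvge_ge lim; apply: nearW => n; exact: step.
Qed.

End WeightedPoincare.

(** * Square-integrable functions and weak derivatives *)

Section RealConvergence.
Context {R : realType}.

Lemma ecvg0P (X : nat -> \bar R) : (forall n, (0 <= X n)%E) ->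
  (X n @[n --> \oo] --> 0%E <->
   forall eps : R, 0 < eps -> \forall n \near \oo, (X n <= eps%:E)%E).
Proof.
move=> X0; split=> [cX eps eps0|H].
  have := cX [set y | (y < eps%:E)%E].
  have o : nbhs (0%E : \bar R) [set y | (y < eps%:E)%E].
    apply: open_nbhs_nbhs; split => /=; last by rewrite lte_fin.
    exact: open_ereal_lt_ereal.
  by move=> /(_ o) H; near=> n; apply: ltW; near: n.
apply/fine_cvgP; split.
  have := H 1 ltr01; apply: filterS => n Xn.
  by rewrite ge0_fin_numE//; apply: le_lt_trans Xn _; rewrite ltry.
apply/cvgr0Pnorm_le => eps eps0; have := H eps eps0; apply: filterS => n Xn /=.
rewrite ger0_norm ?fine_ge0// -lee_fin fineK//.
by rewrite ge0_fin_numE//; apply: le_lt_trans Xn _; rewrite ltry.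
Unshelve. all: by end_near. Qed.

Lemma ecvg0_le (X Y : nat -> \bar R) : (forall n, (0 <= X n)%E) ->
  (forall n, (X n <= Y n)%E) -> Y n @[n --> \oo] --> 0%E -> X n @[n --> \oo] --> 0%E.
Proof.
move=> X0 XY cY; apply/ecvg0P => // eps eps0.
have Y0 n : (0 <= Y n)%E by exact: le_trans (X0 n) (XY n).
have /ecvg0P/(_ eps eps0) := cY; move=> /(_ Y0); apply: filterS => n.
exact: le_trans.
Qed.

Lemma poweR_half_le (X : \bar R) (t : R) : (0 <= X)%E -> 0 <= t ->
  (X `^ 2^-1 <= t%:E)%E -> (X <= (t ^+ 2)%:E)%E.
Proof.
move=> X0 t0; case: X X0 => [r||]//.
- rewrite lee_fin => r0; rewrite poweR_EFin lee_fin powR12_sqrt// => H.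
  rewrite lee_fin -(sqr_sqrtr r0) ler_pXn2r// nnegrE//; exact: sqrtr_ge0.
- by rewrite poweRyr ?invr_neq0// leye_eq.
Qed.

End RealConvergence.

Lemma sqr_le_bound (R : realType) (y C : R) : `|y| <= C -> y ^+ 2 <= C ^+ 2.
Proof.
move=> yC; rewrite -[leLHS]real_normK ?num_real// ler_pXn2r ?nnegrE//.
exact: le_trans yC.
Qed.

Section L2real.
Context d (T : measurableType d) (R : realType) (mu : {measure set T -> \bar R}).
Implicit Types (D : set T) (f g : T -> R).

Definition L2r D f :=
  measurable_fun D f /\ (\int[mu]_(x in D) ((f x) ^+ 2)%:E < +oo)%E.

Lemma L2r_sq_integrable D f : measurable D -> L2r D f ->
  mu.-integrable D (fun x => (f x ^+ 2)%:E).
Proof.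
move=> mD [mf If]; apply/integrableP; split.
  by apply/measurable_EFinP; exact: measurable_funX.
rewrite (eq_integral (fun x => (f x ^+ 2)%:E))// => x _.
by rewrite gee0_abs// lee_fin sqr_ge0.
Qed.

Lemma L2r_of_sq D f : measurable D -> measurable_fun D f ->
  mu.-integrable D (fun x => (f x ^+ 2)%:E) -> L2r D f.
Proof.
move=> mD mf /integrableP[_ If]; split=> //; move: If.
by rewrite (eq_integral (fun x => (f x ^+ 2)%:E))// => x _; rewrite gee0_abs// lee_fin sqr_ge0.
Qed.

Lemma L2r_mul D f g : measurable D -> L2r D f -> L2r D g ->
  mu.-integrable D (fun x => (f x * g x)%:E).
Proof.
move=> mD Lf Lg.
have := integrableD mD (L2r_sq_integrable mD Lf) (L2r_sq_integrable mD Lg).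
apply: (le_integrable mD).
  by apply/measurable_EFinP; apply: measurable_funM; [case: Lf|case: Lg].
move=> x _ /=; rewrite lee_fin [leRHS]ger0_norm ?addr_ge0 ?sqr_ge0// normrM.
rewrite -[f x ^+ 2]real_normK ?num_real// -[g x ^+ 2]real_normK ?num_real//.
have := sqr_ge0 (`|f x| - `|g x|).
have := mulr_ge0 (normr_ge0 (f x)) (normr_ge0 (g x)); nra.
Qed.

Lemma L2r_mul_bounded D f g (C : R) : measurable D -> L2r D f -> measurable_fun D g ->
  (forall x, D x -> `|g x| <= C) -> L2r D (fun x => f x * g x).
Proof.
move=> mD Lf mg gC; have [mf _] := Lf.
apply: L2r_of_sq => //; first exact: measurable_funM.
have := integrableZl mD (C ^+ 2) (L2r_sq_integrable mD Lf).
apply: (le_integrable mD).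
  by apply/measurable_EFinP; apply: measurable_funX; exact: measurable_funM.
move=> x Dx /=; rewrite lee_fin (ger0_norm (sqr_ge0 _)).
rewrite (ger0_norm (mul_sqr_ge0 _ (sqr_ge0 C))) exprMn mulrC.
by rewrite ler_wpM2r ?sqr_ge0// sqr_le_bound// gC.
Qed.

Lemma L2r_D D f g : measurable D -> L2r D f -> L2r D g -> L2r D (fun x => f x + g x).
Proof.
move=> mD Lf Lg; have [mf _] := Lf; have [mg _] := Lg.
apply: L2r_of_sq => //; first exact: measurable_funD.
have := integrableZl mD 2 (integrableD mD (L2r_sq_integrable mD Lf) (L2r_sq_integrable mD Lg)).
apply: (le_integrable mD).
  by apply/measurable_EFinP; apply: measurable_funX; exact: measurable_funD.
move=> x _ /=; have p0 : 0 <= 2 * (f x ^+ 2 + g x ^+ 2).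
  by rewrite pmulr_rge0// addr_ge0// sqr_ge0.
rewrite lee_fin (ger0_norm (sqr_ge0 _)) (ger0_norm p0).
by have := sqr_ge0 (f x - g x); nra.
Qed.

Lemma L2r_N D f : L2r D f -> L2r D (fun x => - f x).
Proof.
move=> [mf If]; split; first exact: measurableT_comp.
by rewrite (eq_integral (fun x => (f x ^+ 2)%:E))// => x _; rewrite sqrrN.
Qed.

Lemma L2r_B D f g : measurable D -> L2r D f -> L2r D g -> L2r D (fun x => f x - g x).
Proof. by move=> mD Lf Lg; apply: L2r_D => //; exact: L2r_N. Qed.

Lemma L2r_bounded D f (C : R) : measurable D -> (mu D < +oo)%E -> measurable_fun D f ->
  (forall x, D x -> `|f x| <= C) -> L2r D f.
Proof.
move=> mD Dfin mf fC; split=> //.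
apply: (@le_lt_trans _ _ (\int[mu]_(x in D) (C ^+ 2)%:E)%E).
  apply: ge0_le_integralW => x Dx; rewrite lee_fin ?sqr_ge0//.
  by rewrite sqr_le_bound// fC.
by rewrite integral_cst// lte_mul_pinfty ?lee_fin ?sqr_ge0.
Qed.

Lemma L2r_integrable D f : measurable D -> (mu D < +oo)%E -> L2r D f ->
  mu.-integrable D (EFin \o f).
Proof.
move=> mD Dfin Lf.
have L1 : L2r D (fun=> 1) by apply: (@L2r_bounded _ _ 1) => // x _; rewrite normr1.
have := L2r_mul mD Lf L1; congr integrable; apply/funext => x /=; by rewrite mulr1.
Qed.

Lemma L2r_subset D E f : measurable D -> measurable E -> E `<=` D -> L2r D f -> L2r E f.
Proof.
move=> mD mE ED [mf If]; split; first exact: measurable_funS mf.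
apply: le_lt_trans If; apply: ge0_subset_integral => //.
  by apply/measurable_EFinP; exact: measurable_funX.
by move=> x _; rewrite lee_fin sqr_ge0.
Qed.

Lemma Rdct D (f_ : nat -> T -> R) f (g : T -> R) : measurable D ->
  (forall n, measurable_fun D (f_ n)) -> measurable_fun D f ->
  (forall x, D x -> f_ n x @[n --> \oo] --> f x) ->
  mu.-integrable D (EFin \o g) -> (forall n x, D x -> `|f_ n x| <= g x) ->
  \int[mu]_(x in D) f_ n x @[n --> \oo] --> \int[mu]_(x in D) f x.
Proof.
move=> mD mf_ mf cf ig fg.
have mf_E n : measurable_fun D (fun x => (f_ n x)%:E) by exact/measurable_EFinP.
have mfE : measurable_fun D (EFin \o f) by exact/measurable_EFinP.
have cE : {ae mu, forall x, D x -> (f_ n x)%:E @[n --> \oo] --> (EFin \o f) x}.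
  by apply: aeW => x Dx; apply: cvg_EFin; [exact: nearW | exact: cf].
have bE : {ae mu, forall x n, D x -> (`|(f_ n x)%:E| <= (EFin \o g) x)%E}.
  by apply: aeW => x n Dx; rewrite lee_fin; exact: fg.
have [i1 _ H] := dominated_convergence mD mf_E mfE cE ig bE.
apply: (@fine_cvg _ _ _ _ (fun n => \int[mu]_(x in D) (f_ n x)%:E)%E).
by rewrite fineK//; exact: integrable_fin_num.
Qed.

End L2real.

Section ComplexParts.
Context {R : realType}.
Implicit Types (z : R[i]) (im : bool).

(** The boolean index lets one real argument serve both parts. *)
Definition cpart im z : R := if im then complex.Im z else complex.Re z.

Lemma cpartD im z1 z2 : cpart im (z1 + z2) = cpart im z1 + cpart im z2.
Proof. by case: im z1 z2 => -[? ?] [? ?]. Qed.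

Lemma cpartN im z : cpart im (- z) = - cpart im z.
Proof. by case: im z => -[? ?]. Qed.

Lemma cpartB im z1 z2 : cpart im (z1 - z2) = cpart im z1 - cpart im z2.
Proof. by rewrite cpartD cpartN. Qed.

Lemma cpart_mulr im z (r : R) : cpart im (z * r%:C) = cpart im z * r.
Proof. by case: im z => -[a b] /=; ring. Qed.

Lemma cpart_eq z1 z2 : (forall im, cpart im z1 = cpart im z2) -> z1 = z2.
Proof.
by move=> H; have := H false; have := H true; case: z1 z2 {H} => [? ?] [? ?] /= -> ->.
Qed.

Lemma normc_sq z : Normc.normc z ^+ 2 = cpart false z ^+ 2 + cpart true z ^+ 2.
Proof. by case: z => a b /=; rewrite sqr_sqrtr// addr_ge0// sqr_ge0. Qed.

Lemma normc_ge0 z : 0 <= Normc.normc z.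
Proof. by case: z => a b /=; exact: sqrtr_ge0. Qed.

Lemma cpart_le_normc im z : `|cpart im z| <= Normc.normc z.
Proof.
rewrite -ler_sqr ?nnegrE ?normc_ge0// normc_sq real_normK ?num_real//.
by case: im; rewrite ?lerDl ?lerDr sqr_ge0.
Qed.

Lemma normc_le_parts z : Normc.normc z <= `|cpart false z| + `|cpart true z|.
Proof.
rewrite -ler_sqr ?nnegrE ?normc_ge0 ?addr_ge0// normc_sq.
rewrite -[cpart false z ^+ 2]real_normK ?num_real// -[cpart true z ^+ 2]real_normK ?num_real//.
by have := mulr_ge0 (normr_ge0 (cpart false z)) (normr_ge0 (cpart true z)); nra.
Qed.

Lemma cpart_integral d (T : measurableType d) (mu : {measure set T -> \bar R}) D
    (u : T -> R[i]) im :
  cpart im (Cintegral mu D u) = \int[mu]_(x in D) cpart im (u x).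
Proof. by case: im. Qed.

Lemma Cmeasurable_cpart d (T : measurableType d) (D : set T) (u : T -> R[i]) :
  Cmeasurable D u <-> forall im, measurable_fun D (fun x => cpart im (u x)).
Proof. by split=> [[? ?] [] //|H]; split; [exact: (H false)|exact: (H true)]. Qed.

Lemma L2P d (T : measurableType d) (mu : {measure set T -> \bar R}) (D : set T)
    (u : T -> R[i]) : measurable D ->
  L2 mu D u <-> forall im, L2r mu D (fun x => cpart im (u x)).
Proof.
move=> mD; split=> [[/Cmeasurable_cpart mu_ Iu] im|H].
  split=> //; apply: le_lt_trans Iu; apply: ge0_le_integralW => x _; rewrite lee_fin ?sqr_ge0//.
  by rewrite normc_sq; case: im; rewrite ?lerDl ?lerDr sqr_ge0.
have mu_ : Cmeasurable D u by apply/Cmeasurable_cpart => im; case: (H im).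
split=> //; rewrite /sqint.
under eq_integral do rewrite normc_sq EFinD.
have m im : measurable_fun D (fun x => (cpart im (u x) ^+ 2)%:E).
  by apply/measurable_EFinP; apply: measurable_funX; case: (H im).
have p im x : D x -> (0 <= (cpart im (u x) ^+ 2)%:E)%E by rewrite lee_fin sqr_ge0.
rewrite ge0_integralD//; do ?[exact: p|exact: m].
by rewrite lte_add_pinfty//; [case: (H false)|case: (H true)].
Qed.

End ComplexParts.

Section WeakDerivatives.
Context {R : realType}.
Implicit Types (D : set (plane R)) (u g f : plane R -> R).

Definition wpart D i u g := L2r area (D : set (mplane R)) g /\
  forall psi, test_fun D psi ->
   \int[area]_(x in D) (u x * 'D_(axis i) psi x) = - \int[area]_(x in D) (g x * psi x).

Lemma is_wpartialP D i (u g : plane R -> R[i]) : measurable (D : set (mplane R)) ->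
  is_wpartial D i u g <->
  forall im, wpart D i (fun x => cpart im (u x)) (fun x => cpart im (g x)).
Proof.
move=> mD; split=> [[/(L2P _ _ mD) Lg H] im|H].
  split; first exact: Lg.
  move=> psi /H /(congr1 (cpart im)); rewrite cpartN !cpart_integral.
  by under eq_Rintegral do rewrite cpart_mulr; under [in RHS]eq_Rintegral do rewrite cpart_mulr.
split; first by apply/(L2P _ _ mD) => im; case: (H im).
move=> psi tpsi; apply: cpart_eq => im; rewrite cpartN !cpart_integral.
under eq_Rintegral do rewrite cpart_mulr; under [in RHS]eq_Rintegral do rewrite cpart_mulr.
by case: (H im) => _; exact.
Qed.

Lemma test_fun_integrable_mul D f psi : open D -> area.-integrable (D : set (mplane R)) (EFin \o f) ->
  test_fun D psi -> area.-integrable (D : set (mplane R)) (fun x => (f x * psi x)%:E).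
Proof.
move=> oD iF [sp cp pD]; have mD : measurable (D : set (mplane R)) := measurable_open oD.
have [M M0 pM] := bounded_sub_cbox (compact_bounded cp).
have cpsi := smooth_continuous sp.
have [C C0 HC] := continuous_bounded_cbox M cpsi.
have mf : measurable_fun (D : set (mplane R)) f by apply/measurable_EFinP; exact: measurable_int iF.
apply: (le_integrable mD _ _ (integrableZl mD C iF)).
  by apply/measurable_EFinP; apply: measurable_funM => //; exact: continuous_measurable_plane.
move=> x _ /=; rewrite lee_fin !normrM mulrC ler_wpM2r// (ger0_norm C0).
have [sx|nx] := pselect (supp psi x); first by apply: HC; exact: pM.
by rewrite not_supp0// normr0.
Qed.

Lemma dubois_reymond2 D f g : open D -> bounded_set D ->
  L2r area (D : set (mplane R)) f -> L2r area (D : set (mplane R)) g ->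
  (forall psi, test_fun D psi ->
    \int[area]_(x in D) (f x * psi x) = \int[area]_(x in D) (g x * psi x)) ->
  {ae area, forall x, D x -> f x = g x}.
Proof.
move=> oD bD Lf Lg H; have mD : measurable (D : set (mplane R)) := measurable_open oD.
have Dfin := bounded_area bD mD.
have i1 := L2r_integrable mD Dfin Lf; have i2 := L2r_integrable mD Dfin Lg.
have := @dubois_reymond R D (fun x => f x - g x) oD.
have ifg : area.-integrable (D : set (mplane R)) (EFin \o (fun x => f x - g x)).
  exact: (L2r_integrable mD Dfin (L2r_B mD Lf Lg)).
move=> /(_ ifg) K; suff : {ae area, forall x, D x -> f x - g x = 0}.
  by apply: ae_area_mono => x E /E /eqP; rewrite subr_eq0 => /eqP.
apply: K => psi tpsi; under eq_Rintegral do rewrite mulrBl.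
rewrite RintegralB//; [|exact: test_fun_integrable_mul..].
by rewrite H// subrr.
Qed.

Lemma wpart_unique D i u g1 g2 : open D -> bounded_set D ->
  wpart D i u g1 -> wpart D i u g2 -> {ae area, forall x, D x -> g1 x = g2 x}.
Proof.
move=> oD bD [L1 H1] [L2' H2]; apply: dubois_reymond2 => // psi tpsi.
by apply: oppr_inj; rewrite -H1// -H2.
Qed.

Lemma test_fun_derive D i psi : test_fun D psi -> test_fun D ('D_(axis i) psi).
Proof.
move=> [sp cp pD].
have sub : supp ('D_(axis i) psi) `<=` supp psi.
  apply: (subset_trans _ (@closed_closure _ [set x | psi x != 0])).
  apply: closure_subset => x /= dx; apply: contrapT => nx.
  by rewrite not_supp_derive0 ?eqxx in dx.
split; first exact: smooth_derive.
- by apply: subclosed_compact cp sub; exact: closed_closure.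
- exact: subset_trans pD.
Qed.

Lemma wpart_smooth D i f : open D -> bounded_set D -> smooth f ->
  wpart D i f ('D_(axis i) f).
Proof.
move=> oD bD sf; have mD : measurable (D : set (mplane R)) := measurable_open oD.
have cdf := smooth_continuous (smooth_derive i sf).
split; last by move=> psi; exact: test_ibp.
have [M M0 DM] := bounded_sub_cbox bD.
have [C C0 HC] := continuous_bounded_cbox M cdf.
apply: (@L2r_bounded _ _ _ _ _ _ C) => //; first exact: bounded_area.
  exact: continuous_measurable_plane.
by move=> x /DM; exact: HC.
Qed.

Lemma smooth_L2r D f : open D -> bounded_set D -> smooth f -> L2r area (D : set (mplane R)) f.
Proof.
move=> oD bD sf; have mD : measurable (D : set (mplane R)) := measurable_open oD.
have cdf := smooth_continuous sf.
have [M M0 DM] := bounded_sub_cbox bD.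
have [C C0 HC] := continuous_bounded_cbox M cdf.
apply: (@L2r_bounded _ _ _ _ _ _ C) => //; first exact: bounded_area.
  exact: continuous_measurable_plane.
by move=> x /DM; exact: HC.
Qed.

Lemma wpart_B D i u1 u2 g1 g2 : open D -> bounded_set D ->
  L2r area (D : set (mplane R)) u1 -> L2r area (D : set (mplane R)) u2 ->
  wpart D i u1 g1 -> wpart D i u2 g2 ->
  wpart D i (fun x => u1 x - u2 x) (fun x => g1 x - g2 x).
Proof.
move=> oD bD L1 L2' [Lg1 H1] [Lg2 H2].
have mD : measurable (D : set (mplane R)) := measurable_open oD.
have Dfin := bounded_area bD mD.
have I f psi : L2r area (D : set (mplane R)) f -> test_fun D psi ->
    area.-integrable (D : set (mplane R)) (fun x => (f x * psi x)%:E).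
  by move=> Lf; apply: test_fun_integrable_mul => //; exact: L2r_integrable.
split; first exact: L2r_B.
move=> psi tpsi.
under eq_Rintegral do rewrite mulrBl; under [in RHS]eq_Rintegral do rewrite mulrBl.
rewrite RintegralB//; [|exact: (I _ _ _ (test_fun_derive i tpsi))..].
rewrite RintegralB//; [|exact: I..].
by rewrite H1// H2// opprB addrC opprK.
Qed.

End WeakDerivatives.

(** * Green's formula on the cone *)

Section Green.
Context {R : realType}.
Notation mu := (@lebesgue_measure R).

Lemma elem_D (f : plane R -> R) i : elem f -> elem ('D_(axis i) f).
Proof.
move=> /(elem_derive (axis i))[f' Ef' Df].
by have -> : 'D_(axis i) f = f' by apply/funext => x; case: (Df x).
Qed.

(** The rise takes place on [1, 2] instead of [0, 1], so that the rescaled function vanishes in a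
    whole neighbourhood of the edges and the cutoff has its support inside the cone. *)
Definition late_step (r : R) := smooth_step (r - 1).

Lemma elem1_late_step : elem1 late_step.
Proof.
have -> : late_step = smooth_step \o (fun r => 1 * r + - 1).
  by apply/funext => r; rewrite /late_step /= mul1r.
by apply: Elem1_comp; [exact: elem1_smooth_step | exact: elem1_affine].
Qed.

Lemma late_step_derivative : exists (ds : R -> R) (C : R),
  [/\ forall r : R, is_derive r (1 : R) late_step (ds r), elem1 ds, 0 <= C,
      forall r, `|ds r| <= C & forall r, 2 < r -> ds r = 0].
Proof.
have [ds Eds Dds] := elem1_derive elem1_late_step.
have [C C0 HC] := elem1_bounded 2 Eds.
have big r : 2 < r -> ds r = 0.
  move=> r2; apply: (is_derive_locally_cst (c := 1) (Dds r)).
  near=> x; rewrite /late_step smooth_step_ge1// lerBrDr; apply: ltW.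
  by have -> : (1 + 1 : R) = 2 by []; near: x; exact: lt_nbhsr.
exists ds, C; split=> // r; have [r2|r2] := leP `|r| 2; first exact: HC.
have [r0|r0] := leP 0 r; first by rewrite big ?normr0// -(ger0_norm r0).
rewrite (_ : ds r = 0) ?normr0//; apply: (is_derive_locally_cst (c := 0) (Dds r)).
near=> x; rewrite /late_step smooth_step_le0// subr_le0; apply: ltW.
by rewrite (@lt_trans _ _ 0)//; near: x; exact: lt_nbhsl.
Unshelve. all: by end_near. Qed.

Variables (Omega : set (plane R)) (e : plane R) (c l M : R).
Hypothesis oO : open Omega.
Hypothesis bO : bounded_set Omega.
Hypothesis e1 : e.1 ^+ 2 + e.2 ^+ 2 = 1.
Hypothesis c0 : 0 <= c.
Notation S := (cone_rect e c l M).

Let mO : measurable (Omega : set (mplane R)) := measurable_open oO.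

Variable u : plane R -> R.
Variable G : bool -> plane R -> R.
Hypothesis Lu : L2r area (Omega : set (mplane R)) u.
Hypothesis wu : forall i, wpart Omega i u (G i).

Variables L L' : R.
Hypothesis strip_u : forall d, 0 < d ->
  (\int[area]_(x in (S : set (mplane R))) ((if (sc e c x <= d)%R then 1 else 0) * u x ^+ 2)%:E <= (L * d ^+ 2)%:E)%E.
Hypothesis strip_area : forall d, 0 < d ->
  (\int[area]_(x in (S : set (mplane R))) (if (sc e c x <= d)%R then 1 else 0)%:E <= (L' * d)%:E)%E.

Variable phi : plane R -> R.
Hypothesis Ephi : elem phi.
Hypothesis cphi : compact (supp phi).
Hypothesis phi_cone : forall x, supp phi x -> (Omega x <-> 0 < sc e c x).
Hypothesis phi_rect : forall x, supp phi x -> Omega x -> S x.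
Hypothesis SO : S `<=` Omega.

(** [ap] and [am] give the linear forms vanishing on the two edges. Their minimum is [sc], which is
    not differentiable on the axis; the cutoff is therefore a product of two functions of linear
    forms. *)
Let ap : plane R := rot90 e - c *: e.
Let am : plane R := rot90 e + c *: e.

Let dot_ap x : dot ap x = dot x (rot90 e) - c * tc e x.
Proof. by rewrite /dot /tc /dot /ap /= /GRing.scale/=; ring. Qed.

Let dot_am x : dot am x = dot x (rot90 e) + c * tc e x.
Proof. by rewrite /dot /tc /dot /am /= /GRing.scale/=; ring. Qed.

Let sc_le x : sc e c x <= dot ap x /\ sc e c x <= dot am x.
Proof.
rewrite dot_ap dot_am /sc; split; first by rewrite lerD2l lerN2 ler_wpM2l// ler_norm.
by rewrite lerD2l -mulrN ler_wpM2l// lerNl -normrN ler_norm.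
Qed.

Let sc_ge x d : d <= dot ap x -> d <= dot am x -> d <= sc e c x.
Proof.
rewrite dot_ap dot_am /sc; case: (leP 0 (tc e x)) => t0.
  by rewrite ger0_norm.
by rewrite ltr0_norm// mulrN opprK.
Qed.

(** The scale is the square N = (n + 1)^2, so that the rate N^(-1/2) is 1 / (n + 1) and no square
    root occurs. *)
Let eta n x := late_step ((n.+1 ^ 2)%:R * dot ap x) * late_step ((n.+1 ^ 2)%:R * dot am x).

Let elem_eta n : elem (eta n).
Proof.
have E (a : plane R) : elem (fun x => late_step ((n.+1 ^ 2)%:R * dot a x)).
  apply: (@Elem_comp _ late_step (cst (n.+1 ^ 2)%:R \* dot a)); first exact: elem1_late_step.
  by apply: Elem_mul; [exact: Elem_cst | exact: Elem_lin].
exact: (Elem_mul (E ap) (E am)).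
Qed.

Let late_step_itv r : 0 <= late_step r <= 1.
Proof. by rewrite smooth_step_ge0 smooth_step_le1. Qed.

Let eta_itv n x : 0 <= eta n x <= 1.
Proof.
have P (p q : R) : 0 <= p <= 1 -> 0 <= q <= 1 -> 0 <= p * q <= 1.
  by move=> /andP[? ?] /andP[? ?]; rewrite mulr_ge0// mulr_ile1.
exact: (P _ _ (late_step_itv _) (late_step_itv _)).
Qed.

Let N_gt0 n : 0 < (n.+1 ^ 2)%:R :> R.
Proof. by rewrite ltr0n expn_gt0. Qed.

Let eta_derivative : exists2 K : R, 0 <= K & forall n i x,
  `|'D_(axis i) (eta n) x| <= K * (n.+1 ^ 2)%:R * (if sc e c x <= 2 / (n.+1 ^ 2)%:R then 1 else 0).
Proof.
have [ds [C [Dds _ C0 dsC ds0]]] := late_step_derivative.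
pose A i := `|dot ap (axis i)| + `|dot am (axis i)|.
exists (C * (A false + A true)); first by rewrite mulr_ge0 ?addr_ge0.
move=> n i x; set N : R := (n.+1 ^ 2)%:R.
have N0 : 0 < N := N_gt0 n.
have D1 a : is_derive x (axis i) (fun x => late_step (N * dot a x))
    (ds (N * dot a x) * (N * dot a (axis i))).
  have DZ : is_derive x (axis i) (fun y : plane R => N * dot a y) (N * dot a (axis i)).
    exact: (is_deriveZ N (is_derive_dot a x (axis i))).
  have Dl := Dds (N * dot a x).
  exact: (@is_derive_compl R (plane R : normedModType R) late_step (fun y => N * dot a y) x (axis i) _ _ Dl DZ).
have De := is_deriveM (D1 ap) (D1 am).
have -> : 'D_(axis i) (eta n) x = late_step (N * dot ap x) * (ds (N * dot am x) * (N * dot am (axis i))) +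
   late_step (N * dot am x) * (ds (N * dot ap x) * (N * dot ap (axis i))).
  by case: De => _ <-.
case: ifPn => [_|]; last first.
  rewrite -ltNge => big; rewrite !ds0 ?mul0r ?mulr0 ?addr0 ?normr0//.
    by rewrite mulrC -ltr_pdivrMr//; apply: lt_le_trans big _; case: (sc_le x).
  by rewrite mulrC -ltr_pdivrMr//; apply: lt_le_trans big _; case: (sc_le x).
have piece r a : `|late_step r * (ds (N * dot a x) * (N * dot a (axis i)))| <=
    C * `|dot a (axis i)| * N.
  have /andP[s0 s1] := late_step_itv r.
  rewrite normrM [`|ds _ * _|]normrM [`|N * _|]normrM (ger0_norm s0) (gtr0_norm N0).
  apply: (@le_trans _ _ (1 * (C * (N * `|dot a (axis i)|)))); last by rewrite mul1r; lra.
  apply: ler_pM => //; first by rewrite mulr_ge0// mulr_ge0// ltW.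
  by rewrite ler_wpM2r// mulr_ge0// ltW.
rewrite mulr1; apply: le_trans (ler_normD _ _) _.
apply: le_trans (lerD (piece _ _) (piece _ _)) _.
rewrite -mulrDl -mulrDr ler_wpM2r ?(ltW N0)// ler_wpM2l// /A.
by case: (i); rewrite addrC ?lerDl ?lerDr addr_ge0.
Qed.

Let eta_cvg x : 0 < sc e c x -> eta n x @[n --> \oo] --> (1 : R).
Proof.
move=> s0; apply: cvg_near_cst; near=> n; apply/eqP; rewrite /eta.
have big : 2 <= (n.+1 ^ 2)%:R * sc e c x.
  rewrite -ler_pdivrMr//; apply: (@le_trans _ _ n%:R).
    by near: n; exact: nbhs_infty_ger.
  by rewrite ler_nat (leq_trans (leqnSn n))// -mulnn leq_pmulr.
have [h1 h2] := sc_le x.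
rewrite /late_step !smooth_step_ge1 ?mulr1// lerBrDr.
  by apply: le_trans big _; rewrite ler_wpM2l// ltW.
by apply: le_trans big _; rewrite ler_wpM2l// ltW.
Unshelve. all: by end_near. Qed.

Let elem_bounded_phi f : elem f -> exists2 C, 0 <= C & forall x, supp phi x -> `|f x| <= C.
Proof.
move=> Ef; have [m m0 pm] := bounded_sub_cbox (compact_bounded cphi).
have [C C0 HC] := continuous_bounded_cbox m (elem_continuous Ef).
by exists C => // x /pm; exact: HC.
Qed.

Let dphi_eta i n x := 'D_(axis i) phi x * eta n x.

(** The support of phi may touch the edges; where eta n is nonzero both linear forms are at least 1
    / N, which leaves a compact subset of the open cone. *)
Let test_dphi_eta i n : test_fun Omega (dphi_eta i n).
Proof.
pose d : R := (n.+1 ^ 2)%:R^-1.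
have d0 : 0 < d by rewrite invr_gt0.
pose C := supp phi `&` ((dot ap @^-1` [set r | d <= r]) `&` (dot am @^-1` [set r | d <= r])).
have cC : compact C.
  apply: subclosed_compact cphi _; last by move=> x [].
  apply: closedI; first exact: closed_closure.
  by apply: closedI; apply: closed_comp => [x _|]; do ?[exact: continuous_dot|exact: closed_ge].
apply: (@test_fun_elem _ _ C) => //.
- exact: (Elem_mul (elem_D i Ephi) (elem_eta n)).
- move=> x nC; rewrite /dphi_eta.
  have [sx|nx] := pselect (supp phi x); last by rewrite not_supp_derive0// mul0r.
  have small a : dot a x < d -> late_step ((n.+1 ^ 2)%:R * dot a x) = 0.
    move=> ad; rewrite /late_step smooth_step_le0// subr_le0 mulrC -ler_pdivlMr//.
    by rewrite div1r ltW.
  have [h1|h1] := ltP (dot ap x) d; first by rewrite /eta small// mul0r mulr0.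
  have [h2|h2] := ltP (dot am x) d; first by rewrite /eta (small am)// !mulr0.
  by exfalso; apply: nC.
- move=> x [sx [/= h1 h2]]; apply/(phi_cone sx).
  by apply: lt_le_trans d0 _; exact: sc_ge.
Qed.

Let mf (f : plane R -> R) : continuous f -> measurable_fun (Omega : set (mplane R)) f.
Proof. by move=> cf; exact: continuous_measurable_plane. Qed.

Let elem_mul_integrable f g : L2r area (Omega : set (mplane R)) f -> elem g ->
  area.-integrable (Omega : set (mplane R)) (fun x => (f x * g x)%:E).
Proof.
move=> Lf Eg; apply: L2r_mul => //; apply: smooth_L2r => //; exact: elem_smooth.
Qed.

Let mu_u : measurable_fun (Omega : set (mplane R)) u := Lu.1.

Let strip_vanishes i :
  \int[area]_(x in (Omega : set (mplane R))) (u x * ('D_(axis i) phi x * 'D_(axis i) (eta n) x)) @[n --> \oo] --> (0 : R).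
Proof.
have [K K0 HK] := eta_derivative.
have [C C0 HC] := elem_bounded_phi (elem_D i Ephi).
have mS : measurable (S : set (mplane R)) := measurable_cone_rect e c l M.
pose N n : R := (n.+1 ^ 2)%:R.
pose ind n x : R := if sc e c x <= 2 / N n then 1 else 0.
have ind0 n x : 0 <= ind n x by rewrite /ind; case: ifP.
have NE n : N n = n.+1%:R * n.+1%:R by rewrite /N -mulnn natrM.
have n1 n : 0 < n.+1%:R :> R by rewrite ltr0n.
have N2 n : 0 < 2 / N n by rewrite divr_gt0 ?N_gt0.
have mind n : measurable_fun (S : set (mplane R)) (ind n).
  have -> : ind n = \1_(sc e c @^-1` `]-oo, 2 / N n]).
    apply/funext => x; rewrite indicE /ind; case: ifPn => h.
      by rewrite mem_set//= in_itv.
    by rewrite memNset//= in_itv/=; exact/negP.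
  apply: measurable_funTS; apply: measurable_indic.
  apply: measurable_closed; apply: closed_comp => [x _|]; first exact: continuous_sc.
  exact: interval_closed.
have bnd n : `|\int[area]_(x in (Omega : set (mplane R))) (u x * ('D_(axis i) phi x * 'D_(axis i) (eta n) x))| <=
    C * K * (4 * L + 2 * L') / n.+1%:R.
  have iO : area.-integrable (Omega : set (mplane R))
      (EFin \o (fun x => u x * ('D_(axis i) phi x * 'D_(axis i) (eta n) x))).
    by apply: elem_mul_integrable => //; apply: Elem_mul; apply: elem_D.
  apply: le_trans (le_normr_Rintegral mO iO) _.
  rewrite -lee_fin /Rintegral fineK; last first.
    by apply: integrable_fin_num => //; exact: (integrable_norm iO).
  (* Young's inequality in the form N |u| <= (n + 1) ((n + 1)^2 u^2 + 1). With strips of width 2 /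
     N, the two terms contribute multiples of 4 L / (n + 1) and 2 L' / (n + 1). *)
  pose B x : R := C * K * n.+1%:R * (n.+1%:R ^+ 2 * (ind n x * u x ^+ 2)) + C * K * n.+1%:R * ind n x.
  apply: (@le_trans _ _ (\int[area]_(x in (S : set (mplane R))) (B x)%:E)%E).
    rewrite -(setIidr SO) integral_mkcondr; apply: ge0_le_integralW => x Ox; first by rewrite lee_fin.
    rewrite /patch; case: ifPn => [|/negP]; rewrite inE => Sx.
      rewrite lee_fin normrM [`|'D_(axis i) phi x * _|]normrM.
      have dC : `|'D_(axis i) phi x| <= C.
        have [sx|nx] := pselect (supp phi x); first exact: HC.
        by rewrite not_supp_derive0// normr0.
      apply: (@le_trans _ _ (`|u x| * (C * (K * N n * ind n x)))).
        by rewrite ler_wpM2l// ler_pM.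
      rewrite /B NE /ind; case: ifP => _; last by rewrite !(mulr0, mul0r, addr0).
      rewrite !mulr1 mul1r -[u x ^+ 2]real_normK ?num_real//.
      have CK : 0 <= C * K * n.+1%:R by rewrite !mulr_ge0.
      have := mulr_ge0 CK (sqr_ge0 (n.+1%:R * `|u x| - 1)).
      have := mulr_ge0 (mulr_ge0 CK (ltW (n1 n))) (normr_ge0 (u x)); nra.
    have nx : ~ supp phi x by move=> sx; apply: Sx; exact: phi_rect.
    by rewrite not_supp_derive0// mul0r mulr0 normr0.
  have CK : 0 <= C * K * n.+1%:R by rewrite !mulr_ge0.
  have mu2 : measurable_fun (S : set (mplane R)) (fun x => (ind n x * u x ^+ 2)%:E).
    apply/measurable_EFinP; apply: measurable_funM => //; apply: measurable_funX.
    exact: measurable_funS SO mu_u.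
  have mind2 : measurable_fun (S : set (mplane R)) (fun x => (ind n x)%:E).
    exact/measurable_EFinP.
  have CK2 : 0 <= C * K * n.+1%:R * n.+1%:R ^+ 2 by rewrite mul_sqr_ge0.
  have -> : (\int[area]_(x in (S : set (mplane R))) (B x)%:E =
      (C * K * n.+1%:R * n.+1%:R ^+ 2)%:E * \int[area]_(x in (S : set (mplane R))) (ind n x * u x ^+ 2)%:E +
      (C * K * n.+1%:R)%:E * \int[area]_(x in (S : set (mplane R))) (ind n x)%:E)%E.
    rewrite -(ge0_integralZl_EFin area mS _ mu2)//; last by move=> x _; rewrite lee_fin mul_sqr_ge0.
    rewrite -(ge0_integralZl_EFin area mS _ mind2)//; last by move=> x _; rewrite lee_fin.
    rewrite -ge0_integralD//.
    - by apply: eq_integral => x _; rewrite /B EFinD !EFinM !muleA.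
    - by move=> x _; rewrite -EFinM lee_fin mulr_ge0// mul_sqr_ge0.
    - exact: measurable_funeM.
    - by move=> x _; rewrite -EFinM lee_fin mulr_ge0.
    - exact: measurable_funeM.
  apply: (@le_trans _ _ ((C * K * n.+1%:R * n.+1%:R ^+ 2)%:E * (L * (2 / N n) ^+ 2)%:E +
      (C * K * n.+1%:R)%:E * (L' * (2 / N n))%:E)%E).
    by apply: leeD; apply: lee_wpmul2l; rewrite ?lee_fin//; [exact: strip_u|exact: strip_area].
  rewrite -!EFinM -EFinD lee_fin le_eqVlt NE; apply/orP; left; apply/eqP.
  by field; rewrite addrC natr1 pnatr_eq0.
have c1 : (C * K * (4 * L + 2 * L')) / n.+1%:R @[n --> \oo] --> (0 : R).
  rewrite -[X in _ --> X](mulr0 (C * K * (4 * L + 2 * L'))).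
  by apply: cvgM; [exact: cvg_cst | exact: cvg_harmonic].
apply/norm_cvg0P.
by apply: squeeze_cvgr (cvg_cst 0) c1; apply: nearW => n; rewrite normr_ge0 bnd.
Qed.

(* Test the weak derivatives against grad phi cut off at distance 1/N from the two
   edges. The cutoff has gradient O(N) on a strip of area O(1/N) where u is O(1/N) in
   L^2, so the error is O(N^(-1/2)). *)
Lemma cone_green :
  \int[area]_(x in (Omega : set (mplane R)))
    (G false x * 'D_(axis false) phi x + G true x * 'D_(axis true) phi x) =
  - \int[area]_(x in (Omega : set (mplane R))) (u x * laplacian phi x).
Proof.
have LG i : L2r area (Omega : set (mplane R)) (G i) by case: (wu i).
pose DD i x := 'D_(axis i) ('D_(axis i) phi) x.
have ED i := elem_D i Ephi; have EDD i : elem (DD i) by apply: elem_D; exact: ED.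
have off i x : ~ supp phi x -> DD i x = 0.
  move=> nx; apply: not_supp_derive0 => sx; apply: nx; move: x sx.
  apply: (subset_trans _ (@closed_closure _ [set x | phi x != 0])).
  apply: closure_subset => x /= dx; apply: contrapT => nx.
  by rewrite not_supp_derive0 ?eqxx in dx.
have lim (F f : plane R -> R) : L2r area (Omega : set (mplane R)) F -> elem f ->
    (forall x, ~ supp phi x -> f x = 0) ->
    \int[area]_(x in (Omega : set (mplane R))) (F x * (f x * eta n x)) @[n --> \oo] -->
    \int[area]_(x in (Omega : set (mplane R))) (F x * f x).
  move=> LF Ef f0; have mF := LF.1.
  apply: (@Rdct _ _ _ area Omega _ _ (fun x => `|F x * f x|) mO).
  - by move=> n; apply: measurable_funM => //; apply: mf; apply: elem_continuous; exact: (Elem_mul Ef).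
  - by apply: measurable_funM => //; apply: mf; exact: elem_continuous.
  - move=> x Ox; have [sx|nx] := pselect (supp phi x).
      apply: cvgM; first exact: cvg_cst.
      rewrite -[X in _ --> X]mulr1; apply: cvgM; first exact: cvg_cst.
      by apply: eta_cvg; apply/(phi_cone sx).
    rewrite f0// mulr0; under eq_fun do rewrite mul0r mulr0; exact: cvg_cst.
  - exact: (integrable_norm (elem_mul_integrable LF Ef)).
  - move=> n x _; rewrite mulrA normrM ler_piMr//.
    by have /andP[h1 h2] := eta_itv n x; rewrite ger0_norm.
(* The product rule puts the derivative of the cutoff into a term of its own, the one that
   [strip_vanishes] removes. *)
have step i n : \int[area]_(x in (Omega : set (mplane R))) (G i x * ('D_(axis i) phi x * eta n x)) =
   - (\int[area]_(x in (Omega : set (mplane R))) (u x * (DD i x * eta n x)) +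
      \int[area]_(x in (Omega : set (mplane R))) (u x * ('D_(axis i) phi x * 'D_(axis i) (eta n) x))).
  have [_ /(_ _ (test_dphi_eta i n)) H] := wu i.
  rewrite -RintegralD//; last 2 first.
  - by apply: elem_mul_integrable => //; exact: Elem_mul.
  - by apply: elem_mul_integrable => //; apply: Elem_mul => //; exact: elem_D.
  apply: oppr_inj; rewrite opprK -H; apply: eq_Rintegral => x _.
  rewrite -mulrDr; congr (_ * _).
  have D1 : is_derive x (axis i) ('D_(axis i) phi) (DD i x).
    by apply: smooth_is_derive; exact: elem_smooth.
  have D2 : is_derive x (axis i) (eta n) ('D_(axis i) (eta n) x).
    by apply: smooth_is_derive; exact: elem_smooth.
  have D12 := is_deriveM D1 D2.
  have -> : 'D_(axis i) (dphi_eta i n) x =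
    'D_(axis i) phi x * 'D_(axis i) (eta n) x + eta n x * DD i x by case: D12 => _ <-.
  by rewrite addrC; congr (_ + _); rewrite mulrC.
have conv i : \int[area]_(x in (Omega : set (mplane R))) (G i x * 'D_(axis i) phi x) =
   - \int[area]_(x in (Omega : set (mplane R))) (u x * DD i x).
  have c1 := lim _ _ (LG i) (ED i) (fun x nx => not_supp_derive0 i nx).
  have c2 : - (\int[area]_(x in (Omega : set (mplane R))) (u x * (DD i x * eta n x)) +
      \int[area]_(x in (Omega : set (mplane R))) (u x * ('D_(axis i) phi x * 'D_(axis i) (eta n) x)))
      @[n --> \oo] --> - (\int[area]_(x in (Omega : set (mplane R))) (u x * DD i x) + 0).
    by apply: cvgN; apply: cvgD; [exact: (lim _ _ Lu (EDD i) (off i)) | exact: strip_vanishes].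
  move: c1; under eq_fun do rewrite step.
  move=> c1; rewrite -[X in - X]addr0.
  by rewrite -(cvg_lim (@Rhausdorff R) c1) -(cvg_lim (@Rhausdorff R) c2).
rewrite RintegralD//; [|exact: elem_mul_integrable..].
rewrite !conv -opprD -RintegralD//; [|exact: elem_mul_integrable..].
by congr (- _); apply: eq_Rintegral => x _; rewrite -mulrDr.
Qed.

End Green.

(** * Exponential weights on the cone *)

Section OneDimensional.
Context {R : realType}.
Notation mu := (@lebesgue_measure R).

(** The intended integrands involve |t| and have one antiderivative on each half-line. *)
Lemma Rintegral_two_sided (f f1 f2 F1 F2 : R -> R) (l : R) : 0 < l -> continuous f ->
  continuous f1 -> continuous f2 ->
  (forall x : R, is_derive x (1 : R) F1 (f1 x)) -> (forall x : R, is_derive x (1 : R) F2 (f2 x)) ->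
  (forall t, t <= 0 -> f t = f1 t) -> (forall t, 0 <= t -> f t = f2 t) ->
  \int[mu]_(t in `]- l, l[) f t = F1 0 - F1 (- l) + (F2 l - F2 0).
Proof.
move=> l0 cf cf1 cf2 D1 D2 ff1 ff2.
have iC (a b : R) : mu.-integrable `[a, b] (EFin \o f).
  apply: continuous_compact_integrable; first exact: segment_compact.
  exact: continuous_subspaceT.
have iS (D : set R) (a b : R) : measurable D -> D `<=` `[a, b]%classic -> mu.-integrable D (EFin \o f).
  by move=> mD Dab; apply: integrableS (iC a b).
have ll : - l <= l by lra.
rewrite Rintegral_itv_bndo_bndc; last first.
  by apply: (iS _ (- l) l) => // x /=; rewrite !in_itv/= => /andP[/ltW -> /ltW ->].
rewrite Rintegral_itv_obnd_cbnd; last first.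
  by apply: (iS _ (- l) l) => // x /=; rewrite !in_itv/= => /andP[/ltW -> ->].
have := @Rintegral_itvB R f (BLeft (- l)) (BRight l) 0 (iC _ _).
rewrite !bnd_simp => /(_ _ _)H.
have {}H := H (ltac:(lra)) (ltac:(lra)).
have -> : \int[mu]_(t in `[- l, l]) f t = \int[mu]_(t in `[- l, 0]) f t + \int[mu]_(t in `]0, l]) f t.
  by rewrite -H addrC subrK.
congr (_ + _).
  have -> : \int[mu]_(t in `[- l, 0]) f t = \int[mu]_(t in `[- l, 0]) f1 t.
    by apply: eq_Rintegral => t; rewrite inE/= in_itv/= => /andP[_ t0]; exact: ff1.
  by rewrite /Rintegral (FTC2_segment D1 cf1)//; lra.
rewrite Rintegral_itv_obnd_cbnd; last first.
  by apply: (iS _ 0 l) => // x /=; rewrite !in_itv/= => /andP[/ltW -> ->].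
have -> : \int[mu]_(t in `[0, l]) f t = \int[mu]_(t in `[0, l]) f2 t.
  by apply: eq_Rintegral => t; rewrite inE/= in_itv/= => /andP[t0 _]; exact: ff2.
by rewrite /Rintegral (FTC2_segment D2 cf2)//; lra.
Qed.

Lemma is_derive_expRM (a t : R) : is_derive t (1 : R) (fun x => expR (a * x)) (expR (a * t) * a).
Proof.
apply: (is_derive1_comp (is_derive_expR (a * t))).
have := is_deriveZ a (is_derive_id t (1 : R)); rewrite /GRing.scale/= mulr1; exact.
Qed.

Lemma continuous_expRM (a : R) : continuous (fun x : R => expR (a * x)).
Proof. by apply: is_derive1_continuous => t; exact: is_derive_expRM. Qed.

Lemma continuous_expRabs (a : R) : continuous (fun t : R => expR (a * `|t|)).
Proof.
move=> t; apply: (@continuous_comp _ _ _ (fun t : R => `|t|) (fun x => expR (a * x))).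
  exact: norm_continuous.
exact: continuous_expRM.
Qed.

Lemma Rintegral_expR (a M : R) : 0 < a -> 0 < M ->
  \int[mu]_(s in `]0, M[) expR (- a * s) = (1 - expR (- a * M)) / a.
Proof.
move=> a0 M0.
have c1 := @continuous_expRM (- a).
have iC (b : R) : mu.-integrable `[0, b] (EFin \o (fun s => expR (- a * s))).
  apply: continuous_compact_integrable; first exact: segment_compact.
  exact: continuous_subspaceT.
rewrite Rintegral_itv_bndo_bndc; last first.
  by apply: integrableS (iC M) => // x /=; rewrite !in_itv/= => /andP[/ltW -> /ltW ->].
rewrite Rintegral_itv_obnd_cbnd; last first.
  by apply: integrableS (iC M) => // x /=; rewrite !in_itv/= => /andP[/ltW -> ->].
have D (t : R) : is_derive t (1 : R) (fun x => - a^-1 * expR (- a * x)) (expR (- a * t)).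
  apply: is_derive_eq (is_deriveZ (- a^-1) (is_derive_expRM (- a) t)) _.
  by rewrite /GRing.scale/=; field; rewrite gt_eqF.
rewrite /Rintegral (FTC2_segment D c1) ?(ltW M0)//= mulr0 expR0.
by field; rewrite gt_eqF.
Qed.

Lemma Rintegral_expR_abs (a l : R) : 0 < a -> 0 < l ->
  \int[mu]_(t in `]- l, l[) expR (- a * `|t|) = 2 * (1 - expR (- a * l)) / a.
Proof.
move=> a0 l0.
have D (b t : R) : b != 0 -> is_derive t (1 : R) (fun x => b^-1 * expR (b * x)) (expR (b * t)).
  move=> b0; apply: is_derive_eq (is_deriveZ b^-1 (is_derive_expRM b t)) _.
  by rewrite /GRing.scale/=; field.
have a_neq0 : a != 0 by rewrite gt_eqF.
have na : - a != 0 by rewrite oppr_eq0.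
rewrite (Rintegral_two_sided l0 (@continuous_expRabs (- a)) (@continuous_expRM a)
  (@continuous_expRM (- a)) (fun t => D _ t a_neq0) (fun t => D _ t na)).
- rewrite !mulr0 expR0 mulrN -mulNr; field; exact: a_neq0.
- by move=> t t0; rewrite ler0_norm// mulrNN.
- by move=> t t0; rewrite ger0_norm.
Qed.

Lemma Rintegral_expR_cos (c tau l : R) : 0 < c -> 0 < tau -> 0 < l ->
  \int[mu]_(t in `]- l, l[) (expR (- (tau * c) * `|t|) * cos (tau * t)) =
  2 / tau * (c + expR (- (tau * c) * l) * (sin (tau * l) - c * cos (tau * l))) / (1 + c ^+ 2).
Proof.
move=> c0 tau0 l0; set a := tau * c.
have c21 : 1 + c ^+ 2 != 0 by rewrite gt_eqF// ltr_pwDl// sqr_ge0.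
have tau_neq0 : tau != 0 by rewrite gt_eqF.
have dm (t : R) : is_derive t (1 : R) (fun x => tau * x) tau.
  by have := is_deriveZ tau (is_derive_id t (1 : R)); rewrite /GRing.scale/= mulr1; exact.
have dc (t : R) : is_derive t (1 : R) (fun x => cos (tau * x)) (- sin (tau * t) * tau).
  exact: (is_derive1_comp (is_derive_cos (tau * t)) (dm t)).
have ds (t : R) : is_derive t (1 : R) (fun x => sin (tau * x)) (cos (tau * t) * tau).
  exact: (is_derive1_comp (is_derive_sin (tau * t)) (dm t)).
have cc : continuous (fun t : R => cos (tau * t)) := is_derive1_continuous dc.
pose K := (tau * (1 + c ^+ 2))^-1.
(* The antiderivative is the real part of exp((sg a + i tau) t) / (sg a + i tau) with a = tau c; sg
   is 1 for t <= 0 and -1 for t >= 0. *)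
have D2 (sg t : R) : sg ^+ 2 = 1 -> is_derive t (1 : R)
    (fun x => K * (expR (sg * a * x) * (sin (tau * x) + sg * c * cos (tau * x))))
    (expR (sg * a * t) * cos (tau * t)).
  move=> sg2.
  have de := is_derive_expRM (sg * a) t.
  have dsc := is_deriveD (ds t) (is_deriveZ (sg * c) (dc t)).
  apply: is_derive_eq (is_deriveZ K (is_deriveM de dsc)) _.
  rewrite /K /a !fctE /GRing.scale/= -[(sg * c) *: cos _]/((sg * c) * cos (tau * t)).
  transitivity ((expR (sg * (tau * c) * t) * cos (tau * t)) * ((1 + sg ^+ 2 * c ^+ 2) / (1 + c ^+ 2))).
    by field; rewrite c21 tau_neq0.
  by rewrite sg2 mul1r mulfV// mulr1.
have cont (b : R) : continuous (fun t : R => expR (b * t) * cos (tau * t)).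
  by move=> t; apply: cvgM; [exact: continuous_expRM | exact: cc].
have p1 : (1 : R) ^+ 2 = 1 by rewrite expr1n.
have m1 : (- 1 : R) ^+ 2 = 1 by rewrite sqrrN expr1n.
have cf : continuous (fun t : R => expR (- a * `|t|) * cos (tau * t)).
  by move=> t; apply: cvgM; [exact: continuous_expRabs | exact: cc].
rewrite (Rintegral_two_sided l0 cf (cont (1 * a)) (cont (- 1 * a))
  (fun t => D2 1 t p1) (fun t => D2 (- 1) t m1)).
- rewrite !mulr0 expR0 sin0 cos0 !mulrN sinN cosN mul1r mulN1r /K !mulNr !mul1r; field.
  by rewrite c21 tau_neq0.
- by move=> t t0; rewrite ler0_norm// mulrNN mul1r.
- by move=> t t0; rewrite ger0_norm// mulN1r.
Qed.

End OneDimensional.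

Section ConeWeights.
Context {R : realType}.
Notation mu := (@lebesgue_measure R).
Variables (e : plane R) (c l M : R).
Hypothesis e1 : e.1 ^+ 2 + e.2 ^+ 2 = 1.
Hypothesis c0 : 0 < c.
Hypothesis l0 : 0 < l.
Hypothesis M0 : 0 < M.
Notation S := (cone_rect e c l M : set (mplane R)).

Let mS : measurable S := measurable_cone_rect e c l M.

Lemma measurable_tc : measurable_fun (setT : set (mplane R)) (tc e).
Proof. by apply: continuous_measurable_plane => //; exact: continuous_tc. Qed.

Lemma measurable_sc : measurable_fun (setT : set (mplane R)) (sc e c).
Proof. by apply: continuous_measurable_plane => //; exact: continuous_sc. Qed.

Lemma integral_cone_prod (wa wb : R -> R) :
  measurable_fun setT wa -> measurable_fun setT wb ->
  (forall t, 0 <= wa t) -> (forall s, 0 <= wb s) ->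
  (\int[area]_(x in S) (wa (tc e x) * wb (sc e c x))%:E =
   (\int[mu]_(t in `](- l)%R, l[) (wa t)%:E) * \int[mu]_(s in `]0%R, M[) (wb s)%:E)%E.
Proof.
move=> mwa mwb wa0 wb0.
have p0 (t s : R) : (0 <= (wa t * wb s)%:E)%E by rewrite lee_fin mulr_ge0.
rewrite integral_cone_rect//; last first.
  apply/measurable_EFinP; apply: measurable_funTS; apply: measurable_funM.
    exact: (measurableT_comp mwa measurable_tc).
  exact: (measurableT_comp mwb measurable_sc).
under eq_integral do rewrite tc_chart// sc_chart//.
have ma : measurable_fun (setT : set (mplane R)) (fun x => wa x.1).
  exact: (measurableT_comp mwa measurable_fst).
have mb : measurable_fun (setT : set (mplane R)) (fun x => wb x.2).
  exact: (measurableT_comp mwb measurable_snd).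
rewrite (@tonelli_setX R _ _ (fun x => (wa x.1 * wb x.2)%:E))//; last first.
  by apply/measurable_EFinP; exact: measurable_funM.
have mwaE : measurable_fun (`]- l, l[%classic : set (measurableTypeR R)) (fun t => (wa t)%:E).
  by apply/measurable_EFinP; exact: measurable_funTS.
have mwbE : measurable_fun (`]0, M[%classic : set (measurableTypeR R)) (fun t => (wb t)%:E).
  by apply/measurable_EFinP; exact: measurable_funTS.
have K0 : (0 <= \int[mu]_(s in `]0%R, M[) (wb s)%:E)%E.
  by apply: integral_ge0 => s _; rewrite lee_fin.
have waE t : `]- l, l[%classic t -> (0 <= (wa t)%:E)%E by rewrite lee_fin.
rewrite -(ge0_integralZr mu _ mwaE waE K0)//.
apply: eq_integral => t _ /=.
under eq_integral do rewrite EFinM.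
by rewrite ge0_integralZl_EFin// => s _; rewrite lee_fin.
Qed.

(** As the weight wb of the Poincare inequality, it isolates the strip of width d along the
    edges. *)
Definition upto (d s : R) : R := if s <= d then 1 else 0.

Lemma measurable_upto d : measurable_fun setT (upto d).
Proof.
have -> : upto d = \1_(`]-oo, d]%classic).
  apply/funext => x; rewrite indicE /upto; case: ifPn => h.
    by rewrite mem_set//= in_itv.
  by rewrite memNset//= in_itv/=; exact/negP.
exact: measurable_indic.
Qed.

Lemma upto_itv d s : 0 <= upto d s <= 1.
Proof. by rewrite /upto; case: ifP; rewrite ?lexx ?ler01. Qed.

Lemma integral_upto d : 0 < d -> (\int[mu]_(s in `]0%R, M[) (upto d s)%:E <= d%:E)%E.
Proof.
move=> d0; apply: (@le_trans _ _ (\int[mu]_(s in `]0%R, d]) (1%:E))%E).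
  rewrite integral_mkcond [leRHS]integral_mkcond; apply: ge0_le_integralW => s _.
    by rewrite /patch; case: ifP => // _; rewrite lee_fin; case/andP: (upto_itv d s).
  rewrite /patch; case: ifPn => [/set_mem sM|_]; last by case: ifP => //; rewrite lee_fin.
  move: sM; rewrite /= in_itv/= => /andP[s0 _].
  have [sd|sd] := leP s d.
    by rewrite ifT /upto ?sd// mem_set//= in_itv/= s0 sd.
  rewrite /upto (lt_geF sd); by case: ifP => //; rewrite lee_fin.
by rewrite integral_cst//= lebesgue_measure_itv/= lte_fin d0 mul1e -EFinB subr0.
Qed.

Lemma integral_itv1 (a b : R) : a < b ->
  (\int[mu]_(t in `]a, b[) (cst 1 t : R)%:E = (b - a)%:E)%E.
Proof.
move=> ab; rewrite -[LHS]/(\int[mu]_(t in `]a, b[) cst 1%:E t)%E integral_cst//=.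
by rewrite lebesgue_measure_itv/= lte_fin ab mul1e EFinB.
Qed.

Let ll : - l < l. Proof. by rewrite (@lt_trans _ _ 0)// oppr_lt0. Qed.

Lemma strip_area d : 0 < d ->
  (\int[area]_(x in S) (if (sc e c x <= d)%R then 1 else 0)%:E <= (2 * l * d)%:E)%E.
Proof.
move=> d0.
have := @integral_cone_prod (cst 1) (upto d) (measurable_cst _) (measurable_upto d) (fun=> ler01)
  (fun s => (andP (upto_itv d s)).1).
under eq_integral do rewrite mul1r.
rewrite integral_itv1// {1}/upto => ->.
have -> : (2 * l * d)%:E = ((l - - l)%:E * d%:E)%E by rewrite -EFinM; congr EFin; ring.
by rewrite lee_wpmul2l ?lee_fin ?integral_upto// subr_ge0 ltW.
Qed.

Lemma area_cone_rect : area S = (2 * l * M)%:E.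
Proof.
have := @integral_cone_prod (cst 1) (cst 1) (measurable_cst _) (measurable_cst _) (fun=> ler01) (fun=> ler01).
under eq_integral do rewrite mul1r.
rewrite !integral_itv1// -EFinM -[X in X = _ -> _]/(\int[area]_(t in S) cst 1%:E t)%E integral_cst// mul1e => ->.
congr EFin; have -> : l - - l = 2 * l by ring.
by rewrite subr0.
Qed.

Definition height (x : plane R) : R := dot x (rot90 e).
Definition decay (tau : R) (x : plane R) : R := expR (- tau * height x).

Lemma heightE x : height x = sc e c x + c * `|tc e x|.
Proof. by rewrite /sc subrK. Qed.

(** In the chart the exponential is a product of a function of each coordinate: it can serve as the
    weights wa and wb, and its integrals factor. *)
Lemma decayE tau x :
  decay tau x = expR (- (tau * c) * `|tc e x|) * expR (- tau * sc e c x).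
Proof. by rewrite /decay heightE mulrDr expRD mulrC -mulNr mulrA. Qed.

Lemma continuous_decay tau : continuous (decay tau).
Proof.
move=> x; apply: (@continuous_comp _ _ _ height (fun y => expR (- tau * y))).
  exact: continuous_dotr.
exact: continuous_expRM.
Qed.

Lemma cone_rect_height x : S x -> 0 < height x /\ sc e c x <= height x /\ `|tc e x| <= height x / c.
Proof.
move=> [_ /andP[s0 _]]; rewrite heightE; have t0 := normr_ge0 (tc e x).
split; first by rewrite ltr_pwDl// mulr_ge0// ltW.
split; first by rewrite lerDl mulr_ge0// ltW.
by rewrite ler_pdivlMr// mulrC lerDr ltW.
Qed.

Lemma decay_le1 tau x : 0 <= tau -> S x -> decay tau x <= 1.
Proof.
move=> t0 /cone_rect_height[h0 _]; rewrite -expR0 ler_expR mulNr oppr_le0.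
by rewrite mulr_ge0// ltW.
Qed.

Lemma EFin_Rintegral_ge0 (D : set R) (f : R -> R) : measurable D -> mu.-integrable D (EFin \o f) ->
  (\int[mu]_(x in D) (f x)%:E)%E = (\int[mu]_(x in D) f x)%:E.
Proof. by move=> mD iF; rewrite /Rintegral fineK//; exact: integrable_fin_num iF. Qed.

Lemma continuous_integrable_itv (f : R -> R) (a b : R) : continuous f ->
  mu.-integrable `]a, b[ (EFin \o f).
Proof.
move=> cf; have : mu.-integrable `[a, b] (EFin \o f).
  apply: continuous_compact_integrable; first exact: segment_compact.
  exact: continuous_subspaceT.
by apply: integrableS => // x /=; rewrite !in_itv/= => /andP[/ltW -> /ltW ->].
Qed.

(** The order tau^(-2) found here is the one against which every error is measured. *)
Lemma integral_decay tau : 0 < tau ->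
  (\int[area]_(x in S) (decay tau x)%:E <= (2 / (c * tau ^+ 2))%:E)%E.
Proof.
move=> tau0; have tc0 : 0 < tau * c by rewrite mulr_gt0.
under eq_integral do rewrite decayE.
rewrite (@integral_cone_prod (fun t => expR (- (tau * c) * `|t|)) (fun s => expR (- tau * s))); last 4 first.
- by apply: continuous_measurable_fun; exact: continuous_expRabs.
- by apply: continuous_measurable_fun; exact: continuous_expRM.
- by move=> t; exact: expR_ge0.
- by move=> t; exact: expR_ge0.
rewrite !EFin_Rintegral_ge0//; last 2 first.
- by apply: continuous_integrable_itv; exact: continuous_expRM.
- by apply: continuous_integrable_itv; exact: continuous_expRabs.
rewrite Rintegral_expR_abs// Rintegral_expR// -EFinM lee_fin.
apply: (@le_trans _ _ (2 * 1 / (tau * c) * (1 / tau))); last first.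
  by rewrite le_eqVlt; apply/orP; left; apply/eqP; field; rewrite !gt_eqF.
have le1 (a : R) : 0 < a -> 0 <= 1 - expR (- a) <= 1.
  by move=> a0; rewrite subr_ge0 -{1}expR0 ler_expR oppr_le0 (ltW a0)/= gerBl.
have /andP[h1 h2] := le1 _ (mulr_gt0 tc0 l0).
have /andP[h3 h4] := le1 _ (mulr_gt0 tau0 M0).
rewrite !mulNr; apply: ler_pM.
- by rewrite divr_ge0 ?mulr_ge0// ltW.
- by rewrite divr_ge0// ltW.
- by rewrite ler_wpM2r ?invr_ge0 ?(ltW tc0)// ler_wpM2l.
- by rewrite ler_wpM2r ?invr_ge0 ?(ltW tau0).
Qed.

(** A factor y is paid for with half of the exponent: tau y / 2 <= exp(tau y / 2). *)
Lemma mul_expR_half (tau y : R) : 0 < tau -> 0 <= y ->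
  y * expR (- tau * y) <= 2 / tau * expR (- (tau / 2) * y).
Proof.
move=> tau0 y0; have -> : - tau * y = - (tau / 2) * y + - (tau / 2) * y by field.
rewrite expRD mulrA ler_wpM2r ?expR_ge0// mulNr expRN.
rewrite ler_pdivrMr ?expR_gt0//.
rewrite -ler_pdivrMl ?divr_gt0//.
have -> : (2 / tau)^-1 * y = tau / 2 * y by field; rewrite gt_eqF.
by apply: le_trans (expR_ge1Dx _); rewrite lerDr.
Qed.

Lemma integral_height_decay tau : 0 < tau ->
  (\int[area]_(x in S) (height x * decay tau x)%:E <= (16 / (c * tau ^+ 3))%:E)%E.
Proof.
move=> tau0; have tau2 : 0 < tau / 2 by rewrite divr_gt0.
apply: (@le_trans _ _ (\int[area]_(x in S) ((2 / tau)%:E * (decay (tau / 2) x)%:E))%E).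
  apply: ge0_le_integralW => x /cone_rect_height[h0 _].
    by rewrite lee_fin mulr_ge0 ?expR_ge0// ltW.
  by rewrite -EFinM lee_fin mul_expR_half// ltW.
rewrite ge0_integralZl_EFin//; last 3 first.
- by move=> x _; rewrite lee_fin expR_ge0.
- by apply/measurable_EFinP; apply: continuous_measurable_plane => //; exact: continuous_decay.
- by rewrite divr_ge0// ltW.
apply: (@le_trans _ _ ((2 / tau)%:E * (2 / (c * (tau / 2) ^+ 2))%:E)%E).
  by rewrite lee_wpmul2l ?lee_fin ?divr_ge0 ?(ltW tau0)// integral_decay.
rewrite -EFinM lee_fin le_eqVlt; apply/orP; left; apply/eqP; field.
by rewrite !gt_eqF.
Qed.

End ConeWeights.

Lemma expR_decay_cvg {R : realType} (a : R) (tau : nat -> R) : 0 < a ->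
  tau n @[n --> \oo] --> +oo -> expR (- (tau n * a)) @[n --> \oo] --> (0 : R).
Proof.
move=> a0 htau; have id : (r : R) @[r --> +oo] --> +oo by exact: cvg_id.
have ta : tau n * a @[n --> \oo] --> +oo by exact: (cvg_comp _ _ htau (gt0_cvgMly a0 id)).
exact: (cvg_comp _ _ ta (@cvgr_expR R)).
Qed.

Section ConeOscillation.
Context {R : realType}.
Notation mu := (@lebesgue_measure R).
Variables (e : plane R) (c l M : R).
Hypothesis e1 : e.1 ^+ 2 + e.2 ^+ 2 = 1.
Hypothesis c0 : 0 < c.
Hypothesis l0 : 0 < l.
Hypothesis M0 : 0 < M.
Notation S := (cone_rect e c l M : set (mplane R)).

Let mS : measurable S := measurable_cone_rect e c l M.

Lemma frame_coord (x : plane R) : x.1 = tc e x * e.1 - height e x * e.2 /\ x.2 = tc e x * e.2 + height e x * e.1.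
Proof.
rewrite /tc /height /dot /rot90/=; split.
  by rewrite -[LHS]mulr1 -e1; ring.
by rewrite -[LHS]mulr1 -e1; ring.
Qed.

Lemma frame_le1 : `|e.1| <= 1 /\ `|e.2| <= 1.
Proof.
have h := sqr_ge0 e.1; have h' := sqr_ge0 e.2.
by split; rewrite -(@ler_pXn2r _ 2)// ?nnegrE// expr1n real_normK ?num_real// -e1 (lerDl, lerDr).
Qed.

Lemma frame_cbox (A B : R) (x : plane R) : `|tc e x| <= A -> `|height e x| <= B -> cbox (A + B) x.
Proof.
move=> tA hB; have [a1 a2] := frame_le1; have [x1 x2] := frame_coord x; apply/cboxP; rewrite x1 x2.
have [t0 h0] := (normr_ge0 (tc e x), normr_ge0 (height e x)).
have K (a b : R) : `|a| <= 1 -> `|b| <= 1 -> `|tc e x * a| + `|height e x * b| <= A + B.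
  move=> ha hb; rewrite !normrM; apply: lerD.
    by rewrite -[leRHS]mulr1 ler_pM.
  by rewrite -[leRHS]mulr1 ler_pM.
split; first by apply: le_trans (ler_normB _ _) _; exact: K.
by apply: le_trans (ler_normD _ _) _; exact: K.
Qed.

Lemma cone_rect_cbox : S `<=` cbox (l + (M + c * l)).
Proof.
move=> x [/andP[t1 t2] /andP[s1 s2]].
have tl : `|tc e x| <= l by rewrite ler_norml !ltW.
apply: frame_cbox => //.
rewrite (heightE e c) ger0_norm ?lerD ?(ltW s2) ?ler_wpM2l ?(ltW c0)//.
by rewrite addr_ge0 ?(ltW s1)// mulr_ge0// ltW.
Qed.

Lemma bounded_cone_rect : bounded_set S.
Proof.
have [K [Kr hK]] := @bounded_cbox R (l + (M + c * l)); exists K; split=> // N KN x Sx.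
exact: hK _ KN _ (cone_rect_cbox Sx).
Qed.

Lemma continuous_integrable_cone (f : plane R -> R) : continuous f -> area.-integrable S (EFin \o f).
Proof. by move=> cf; apply: continuous_integrable_bounded => //; exact: bounded_cone_rect. Qed.

Lemma Rintegral_cone_prod (wa wb : R -> R) : continuous wa -> continuous wb ->
  (forall t, 0 <= wa t) -> (forall t, 0 <= wb t) ->
  \int[area]_(x in S) (wa (tc e x) * wb (sc e c x)) =
  (\int[mu]_(t in `](- l), l[) wa t) * \int[mu]_(s in `]0, M[) wb s.
Proof.
move=> ca cb a0 b0; rewrite {1}/Rintegral integral_cone_prod//.
- by rewrite !EFin_Rintegral_ge0//; exact: continuous_integrable_itv.
- exact: continuous_measurable_fun.
- exact: continuous_measurable_fun.
Qed.

Lemma integral_decay_cos tau : 0 < tau ->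
  \int[area]_(x in S) (decay e tau x * cos (tau * tc e x)) =
  (1 - expR (- tau * M)) / tau *
  (2 / tau * (c + expR (- (tau * c) * l) * (sin (tau * l) - c * cos (tau * l))) / (1 + c ^+ 2)).
Proof.
move=> tau0.
have cc : continuous (fun t : R => cos (tau * t)).
  move=> t; apply: (@continuous_comp _ _ _ (fun t : R => tau * t) cos); last exact: continuous_cos.
  by apply: cvgMl_tmp; exact: cvg_id.
have ccp : continuous (fun x : plane R => cos (tau * tc e x)).
  move=> x; apply: (@continuous_comp _ _ _ (tc e) (fun t : R => cos (tau * t))); last exact: cc.
  exact: continuous_tc.
have iW := continuous_integrable_cone (@continuous_decay R e tau).
have cWc : continuous (fun x => decay e tau x * cos (tau * tc e x)).
  by move=> x; apply: cvgM; [exact: continuous_decay | exact: ccp].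
have iWc := continuous_integrable_cone cWc.
have ea := @continuous_expRabs R (- (tau * c)).
have eb := @continuous_expRM R (- tau).
have eac : continuous (fun t : R => expR (- (tau * c) * `|t|) * cos (tau * t)).
  by move=> t; apply: cvgM; [exact: ea | exact: cc].
have eac1 : continuous (fun t : R => expR (- (tau * c) * `|t|) * (1 + cos (tau * t))).
  by move=> t; apply: cvgM; [exact: ea | apply: cvgD; [exact: cvg_cst | exact: cc]].
(* [Rintegral_cone_prod] takes nonnegative factors and cos changes sign: the integrals against 1 and
   against 1 + cos are computed and subtracted. *)
have P1 := @Rintegral_cone_prod _ _ ea eb (fun t => expR_ge0 _) (fun t => expR_ge0 _).
have p2 (t : R) : 0 <= expR (- (tau * c) * `|t|) * (1 + cos (tau * t)).
  by rewrite mulr_ge0 ?expR_ge0// -lerBlDl sub0r cos_geN1.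
have P2 := @Rintegral_cone_prod _ _ eac1 eb p2 (fun t => expR_ge0 _).
have PD := RintegralD mS iW iWc.
move: PD; under eq_Rintegral do rewrite -[X in X + _]mulr1 -mulrDr (decayE e c) mulrAC.
rewrite P2; under [X in _ = X + _ -> _]eq_Rintegral do rewrite (decayE e c); rewrite P1.
under [X in X * _ = _ -> _]eq_Rintegral do rewrite mulrDr mulr1.
rewrite RintegralD//; [|exact: continuous_integrable_itv..].
rewrite mulrDl => /addrI <-.
by rewrite Rintegral_expR_cos// Rintegral_expR// mulrC.
Qed.

Lemma integral_decay_cos_cvg (tau : nat -> R) : (forall n, 0 < tau n) ->
  tau n @[n --> \oo] --> +oo ->
  tau n ^+ 2 * \int[area]_(x in S) (decay e (tau n) x * cos (tau n * tc e x)) @[n --> \oo]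
    --> 2 * c / (1 + c ^+ 2).
Proof.
move=> tau0 htau; have c21 : 1 + c ^+ 2 != 0 by rewrite gt_eqF// ltr_pwDl// sqr_ge0.
have E1 := @expR_decay_cvg R (c * l) tau (mulr_gt0 c0 l0) htau.
have E2 := expR_decay_cvg M0 htau.
pose b n := sin (tau n * l) - c * cos (tau n * l).
have Eb : expR (- (tau n * (c * l))) * b n @[n --> \oo] --> (0 : R).
  apply: norm_cvg0; apply: (@squeeze_cvgr _ _ _ _ (fun=> 0) (fun n => expR (- (tau n * (c * l))) * (1 + c))).
  - apply: nearW => n; rewrite normr_ge0/= normrM ger0_norm ?expR_ge0// ler_wpM2l ?expR_ge0//.
    apply: le_trans (ler_normB _ _) _; rewrite normrM (gtr0_norm c0); apply: lerD.
      by rewrite ler_norml sin_geN1 sin_le1.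
    by rewrite ler_piMr ?(ltW c0)// ler_norml cos_geN1 cos_le1.
  - exact: cvg_cst.
  - by rewrite -(mul0r (1 + c)); apply: cvgMr_tmp.
have := cvgM (cvgB (@cvg_cst _ (1 : R) _ \oo _) E2)
  (cvgMr_tmp (b := (1 + c ^+ 2)^-1) (cvgMl_tmp (a := 2) (cvgD (@cvg_cst _ c _ \oo _) Eb))).
rewrite subr0 addr0 mul1r => H.
rewrite (_ : (fun n => _) = (fun n => (1 - expR (- (tau n * M))) *
  (2 * (c + expR (- (tau n * (c * l))) * b n) * (1 + c ^+ 2)^-1))); first exact: H.
apply/funext => n; rewrite integral_decay_cos// /b !mulNr -(mulrA _ c l); field.
by rewrite c21 gt_eqF.
Qed.

End ConeOscillation.

Lemma EFin_Rintegral d (T : measurableType d) (R : realType) (m : {measure set T -> \bar R})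
    (D : set T) (f : T -> R) : measurable D -> m.-integrable D (EFin \o f) ->
  (\int[m]_(x in D) (f x)%:E)%E = (\int[m]_(x in D) f x)%:E.
Proof. by move=> mD iF; rewrite /Rintegral fineK//; exact: integrable_fin_num iF. Qed.

Section WeightedDecay.
Context {R : realType}.
Notation mu := (@lebesgue_measure R).
Variables (e : plane R) (c l M : R).
Hypothesis e1 : e.1 ^+ 2 + e.2 ^+ 2 = 1.
Hypothesis c0 : 0 < c.
Hypothesis l0 : 0 < l.
Hypothesis M0 : 0 < M.
Notation S := (cone_rect e c l M : set (mplane R)).

Let mS : measurable S := measurable_cone_rect e c l M.

Variables u G : plane R -> R.
Hypothesis Lu : L2r area S u.
Hypothesis LG : L2r area S G.
Hypothesis poincare : forall wa wb : R -> R,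
  measurable_fun setT wa -> measurable_fun setT wb ->
  (forall t, 0 <= wa t <= 1) -> (forall s, 0 <= wb s <= 1) ->
  (\int[area]_(x in S) (wa (tc e x) * wb (sc e c x) * u x ^+ 2)%:E <=
   8 * \int[mu]_(s in `]0%R, M[) (s * wb s)%:E * \int[area]_(x in S) (wa (tc e x) * G x ^+ 2)%:E)%E.

Let IG := \int[area]_(x in S) G x ^+ 2.

Let intG2 : area.-integrable S (EFin \o (fun x => G x ^+ 2)) := L2r_sq_integrable mS LG.

(** With wb the indicator of s <= d, the factor int s wb is at most d^2. This quadratic rate is what
    Green's formula asks of u near the edges. *)
Lemma strip_sq d : 0 < d ->
  (\int[area]_(x in S) ((if (sc e c x <= d)%R then 1 else 0) * u x ^+ 2)%:E <=
   (8 * IG * d ^+ 2)%:E)%E.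
Proof.
move=> d0.
have b1 (t : R) : 0 <= cst (1 : R) t <= 1 by rewrite /= ler01 lexx.
have := poincare (@measurable_cst _ _ _ _ _ (1 : R)) (measurable_upto d) b1 (upto_itv d).
under eq_integral do rewrite mul1r.
under [in X in (_ <= _ * X)%E -> _]eq_integral do rewrite mul1r.
move=> /le_trans; apply.
have -> : (\int[area]_(x in S) (G x ^+ 2)%:E)%E = IG%:E.
  by rewrite /IG /Rintegral fineK//; exact: integrable_fin_num intG2.
rewrite (mulrC 8 IG) -mulrA mulrC EFinM lee_wpmul2r ?lee_fin//.
  by apply: Rintegral_ge0 => x _; exact: sqr_ge0.
rewrite EFinM lee_wpmul2l// ?lee_fin//.
apply: (@le_trans _ _ (d%:E * \int[mu]_(s in `]0%R, M[) (upto d s)%:E)%E).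
  rewrite -ge0_integralZl_EFin//; last 3 first.
  - by move=> s _; rewrite lee_fin; case/andP: (upto_itv d s).
  - by apply/measurable_EFinP; apply: measurable_funTS; exact: measurable_upto.
  - exact: ltW.
  apply: ge0_le_integralW => s; rewrite /= in_itv/= => /andP[s0 _].
    by rewrite lee_fin mulr_ge0 ?(ltW s0)//; case/andP: (upto_itv d s).
  by rewrite -EFinM lee_fin /upto; case: ifP; rewrite ?mulr1 ?mulr0.
by rewrite expr2 EFinM lee_wpmul2l ?lee_fin ?(ltW d0)// integral_upto.
Qed.

(** The absolute value keeps the exponential weight at most 1 on the whole line, as the Poincare
    inequality requires. *)
Lemma integral_mul_expR tau : 0 < tau ->
  (\int[mu]_(s in `]0%R, M[) (s * expR (- tau * `|s|))%:E <= (4 / tau ^+ 2)%:E)%E.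
Proof.
move=> tau0; have t2 : 0 < tau / 2 by rewrite divr_gt0.
apply: (@le_trans _ _ (\int[mu]_(s in `]0%R, M[) ((2 / tau)%:E * (expR (- (tau / 2) * s))%:E))%E).
  apply: ge0_le_integralW => s; rewrite /= in_itv/= => /andP[s0 _].
    by rewrite lee_fin mulr_ge0 ?(ltW s0) ?expR_ge0.
  by rewrite -EFinM lee_fin ger0_norm ?mul_expR_half// ltW.
have cE := @continuous_expRM R (- (tau / 2)).
rewrite ge0_integralZl_EFin//; last 2 first.
- by apply/measurable_EFinP; apply: measurable_funTS; exact: continuous_measurable_fun.
- by rewrite divr_ge0// ltW.
rewrite EFin_Rintegral_ge0//; last exact: continuous_integrable_itv.
rewrite Rintegral_expR// -EFinM lee_fin.
apply: (@le_trans _ _ (2 / tau * (1 / (tau / 2)))); last first.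
  by rewrite le_eqVlt; apply/orP; left; apply/eqP; field; rewrite gt_eqF.
by rewrite ler_wpM2l ?divr_ge0 ?(ltW tau0)// ler_wpM2r ?invr_ge0 ?(ltW t2)// gerBl expR_ge0.
Qed.

Let D (tau : R) := \int[area]_(x in S) (expR (- (tau * c) * `|tc e x|) * G x ^+ 2).

Lemma measurable_axis : measurable [set x : mplane R | tc e x = 0].
Proof.
by have := @measurable_tc R e measurableT _ (@measurable_set1 R 0); rewrite setTI.
Qed.

Lemma axis_negligible : area (S `&` [set x | tc e x = 0]) = 0%E.
Proof.
have mz : measurable_fun setT (\1_[set (0 : R)] : R -> R) by exact: measurable_indic.
have i0 (t : R) : 0 <= \1_[set (0 : R)] t :> R by rewrite indicE.
have := integral_cone_prod c l M e1 mz (@measurable_cst _ _ _ _ _ (1 : R)) i0 (fun=> ler01).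
have -> : (\int[mu]_(t in `](- l)%R, l[) (\1_[set (0 : R)] t)%:E)%E = 0%E.
  rewrite integral_indic//; apply/eqP; rewrite -measure_le0 -(lebesgue_measure_set1 (0 : R)).
  by apply: le_measure; rewrite ?inE//; exact: measurableI.
rewrite mul0e => <-.
rewrite setIC -integral_indic//; last exact: measurable_axis.
by apply: eq_integral => x _; rewrite mulr1 !indicE.
Qed.

Let energy tau (x : mplane R) := expR (- (tau * c) * `|tc e x|) * G x ^+ 2.

Lemma measurable_energy tau : measurable_fun S (energy tau).
Proof.
have mG : measurable_fun S (fun x => G x ^+ 2) := (measurable_EFinP _ _).1 (measurable_int _ intG2).
rewrite /energy; apply: measurable_funM => //; apply: measurable_funTS.
exact: (measurableT_comp (continuous_measurable_fun (@continuous_expRabs R (- (tau * c)))) (@measurable_tc R e)).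
Qed.

Lemma energy_le tau x : 0 <= tau -> `|energy tau x| <= G x ^+ 2.
Proof.
move=> tau0; rewrite /energy normrM [X in _ * X]ger0_norm ?sqr_ge0// ger0_norm ?expR_ge0//.
rewrite ler_piMl ?sqr_ge0// -expR0 ler_expR mulNr oppr_le0.
by rewrite mulr_ge0// mulr_ge0// ltW.
Qed.

Lemma energy_integrable tau : 0 <= tau -> area.-integrable S (EFin \o energy tau).
Proof.
move=> tau0; apply: le_integrable intG2 => //; first by apply/measurable_EFinP; exact: measurable_energy.
by move=> x _; rewrite /= lee_fin [leRHS]ger0_norm ?sqr_ge0// energy_le.
Qed.

Lemma decay_energy_cvg (tau : nat -> R) : (forall n, 0 < tau n) ->
  tau n @[n --> \oo] --> +oo -> D (tau n) @[n --> \oo] --> (0 : R).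
Proof.
move=> tau0 htau.
(* The pointwise limit of the energies. On the axis the weight is constantly 1, so this limit
   vanishes only almost everywhere. *)
pose f (x : plane R) := \1_[set x : mplane R | tc e x = 0] x * G x ^+ 2.
have mG : measurable_fun S (fun x => G x ^+ 2) := (measurable_EFinP _ _).1 (measurable_int _ intG2).
pose N := S `&` [set x : mplane R | tc e x = 0].
have mN : measurable N.
  by apply: measurableI => //; exact: measurable_axis.
have mf : measurable_fun S f.
  apply: measurable_funM => //; apply: measurable_funTS.
  by apply: measurable_indic; exact: measurable_axis.
have f1 x : tc e x = 0 -> f x = G x ^+ 2 by move=> t0; rewrite /f indicE mem_set// mul1r.
have f0 x : tc e x != 0 -> f x = 0 by move=> t0; rewrite /f indicE memNset ?mul0r//; exact/eqP.
have intf : area.-integrable S (EFin \o f).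
  apply: le_integrable intG2 => //; first exact/measurable_EFinP.
  move=> x _; rewrite /= lee_fin; have [/eqP/f1 ->//|/f0 ->] := boolP (tc e x == 0).
  by rewrite normr0 normr_ge0.
have -> : 0 = \int[area]_(x in S) f x :> R.
  rewrite /Rintegral (@negligible_integral _ _ _ _ _ N)//; last exact: axis_negligible.
  rewrite integral0_eq// => x [Sx nN]; rewrite f0//; apply/negP => /eqP t0.
  by apply: nN.
suff : \int[area]_(x in S) energy (tau n) x @[n --> \oo] --> \int[area]_(x in S) f x by [].
apply: (@Rdct _ (mplane R) R area S (fun n => energy (tau n)) f (fun x => G x ^+ 2)) => //.
- by move=> n; exact: measurable_energy.
- move=> x Sx; rewrite /energy; have [/eqP t0|t0] := boolP (tc e x == 0).
    rewrite f1// t0.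
    by rewrite normr0; under eq_fun do rewrite mulr0 expR0 mul1r; exact: cvg_cst.
  rewrite f0// -(mul0r (G x ^+ 2)); apply: cvgMr_tmp.
  under eq_fun do rewrite mulNr -mulrA.
  by apply: expR_decay_cvg => //; rewrite mulr_gt0// normr_gt0.
- by move=> n x _; rewrite energy_le// ltW.
Qed.

(* Young's inequality and the weighted Poincare inequality: the integral is o(tau^-2),
   the gradient being weighted by exp(- tau c |t|), which tends to 0. *)
Lemma abs_decay_cvg (tau : nat -> R) : (forall n, 0 < tau n) ->
  tau n @[n --> \oo] --> +oo ->
  tau n ^+ 2 * \int[area]_(x in S) (`|u x| * decay e (tau n) x) @[n --> \oo] --> (0 : R).
Proof.
move=> tau0 htau.
have mW n : measurable_fun S (decay e (tau n)).
  by apply: continuous_measurable_plane => //; exact: continuous_decay.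
have W1 n x : S x -> `|decay e (tau n) x| <= 1.
  by move=> Sx; rewrite ger0_norm ?expR_ge0// (decay_le1 c0 (ltW (tau0 n)) Sx).
have LuW n := L2r_mul_bounded mS Lu (mW n) (W1 n).
have Lau : L2r area S (fun x => `|u x|).
  case: Lu => mu2 su; split; first exact: measurableT_comp mu2.
  by under eq_integral do rewrite real_normK ?num_real//.
have LW n : L2r area S (decay e (tau n)).
  by apply: L2r_bounded (W1 n) => //; rewrite area_cone_rect// ltry.
have i1 n : area.-integrable S (EFin \o (fun x => `|u x| * decay e (tau n) x)) by exact: L2r_mul.
have i2 n : area.-integrable S (EFin \o (fun x => u x * (u x * decay e (tau n) x))) by exact: L2r_mul.
have i3 n : area.-integrable S (EFin \o decay e (tau n)).
  by apply: continuous_integrable_cone => //; exact: continuous_decay.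
have B3 n : \int[area]_(x in S) decay e (tau n) x <= 2 / (c * tau n ^+ 2).
  by rewrite -lee_fin -EFin_Rintegral// integral_decay.
(* The Poincare inequality with the two factors of the exponential as weights; 32 is 8 times the 4
   of [integral_mul_expR]. The factor in |t| stays on the gradient inside D. *)
have B2 n : \int[area]_(x in S) (u x * (u x * decay e (tau n) x)) <= 32 / tau n ^+ 2 * D (tau n).
  rewrite -lee_fin -EFin_Rintegral//.
  have wa01 (t : R) : 0 <= expR (- (tau n * c) * `|t|) <= 1.
    rewrite expR_ge0 -expR0 ler_expR mulNr oppr_le0/=.
    by rewrite !mulr_ge0 ?(ltW c0) ?(ltW (tau0 n)).
  have wb01 (t : R) : 0 <= expR (- tau n * `|t|) <= 1.
    by rewrite expR_ge0 -expR0 ler_expR mulNr oppr_le0/= mulr_ge0 ?(ltW (tau0 n)).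
  have := poincare (continuous_measurable_fun (@continuous_expRabs R (- (tau n * c))))
    (continuous_measurable_fun (@continuous_expRabs R (- tau n))) wa01 wb01.
  have iD : area.-integrable S (EFin \o (fun x => expR (- (tau n * c) * `|tc e x|) * G x ^+ 2)).
    exact: (energy_integrable (ltW (tau0 n))).
  rewrite (EFin_Rintegral mS iD) => H.
  apply: (@le_trans _ _ (8 * (4 / tau n ^+ 2)%:E * (D (tau n))%:E)%E).
    apply: le_trans (le_trans _ H) _.
      apply: ge0_le_integralW => x [_ /andP[s0 _]].
        by rewrite lee_fin mulrA -expr2 mulr_ge0 ?sqr_ge0 ?expR_ge0.
      by rewrite lee_fin (decayE e c) (gtr0_norm s0) mulrA -expr2 mulrC.
    rewrite lee_wpmul2r ?lee_fin//.
      by apply: Rintegral_ge0 => x _; rewrite mulr_ge0 ?expR_ge0 ?sqr_ge0.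
    by rewrite lee_wpmul2l// ?lee_fin// integral_mul_expR.
  rewrite -!EFinM lee_fin le_eqVlt; apply/orP; left; apply/eqP; field.
  by rewrite gt_eqF.
(* From |u| <= a u^2 / 2 + 1 / (2 a), with a free: the last term is made small by taking a large,
   and D (tau n) then tends to 0 for this fixed a. *)
have B1 a n : 0 < a -> tau n ^+ 2 * \int[area]_(x in S) (`|u x| * decay e (tau n) x) <=
    16 * a * D (tau n) + 1 / (a * c).
  move=> a0.
  have iZ2 : area.-integrable S (EFin \o (fun x => a / 2 * (u x * (u x * decay e (tau n) x)))).
    exact: (integrableZl mS (a / 2) (i2 n)).
  have iZ3 : area.-integrable S (EFin \o (fun x => (2 * a)^-1 * decay e (tau n) x)).
    exact: (integrableZl mS (2 * a)^-1 (i3 n)).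
  have : \int[area]_(x in S) (`|u x| * decay e (tau n) x) <= \int[area]_(x in S)
      (a / 2 * (u x * (u x * decay e (tau n) x)) + (2 * a)^-1 * decay e (tau n) x).
    apply: le_Rintegral => //; first exact: (integrableD mS iZ2 iZ3).
    move=> x Sx; have -> : a / 2 * (u x * (u x * decay e (tau n) x)) + (2 * a)^-1 * decay e (tau n) x =
        (a / 2 * `|u x| ^+ 2 + (2 * a)^-1) * decay e (tau n) x.
      by rewrite real_normK ?num_real//; ring.
    rewrite ler_wpM2r ?expR_ge0// -subr_ge0.
    have -> : a / 2 * `|u x| ^+ 2 + (2 * a)^-1 - `|u x| = (2 * a)^-1 * (a * `|u x| - 1) ^+ 2.
      by field; rewrite gt_eqF.
    by rewrite mulr_ge0 ?sqr_ge0// invr_ge0 mulr_ge0// ltW.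
  rewrite RintegralD// !RintegralZl// => H.
  have t2 : 0 < tau n ^+ 2 by rewrite exprn_gt0.
  rewrite -ler_pdivlMl//; apply: le_trans H _.
  have h2 : a / 2 * (\int[area]_(x in S) (u x * (u x * decay e (tau n) x))) <= a / 2 * (32 / tau n ^+ 2 * D (tau n)).
    by rewrite ler_wpM2l// divr_ge0// ltW.
  have h3 : (2 * a)^-1 * (\int[area]_(x in S) decay e (tau n) x) <= (2 * a)^-1 * (2 / (c * tau n ^+ 2)).
    by rewrite ler_wpM2l// invr_ge0 mulr_ge0// ltW.
  apply: le_trans (lerD h2 h3) _; rewrite le_eqVlt; apply/orP; left; apply/eqP; field.
  by rewrite !gt_eqF.
apply/cvgrPdist_le => eps eps0; pose a := 2 / (c * eps).
have a0 : 0 < a by rewrite divr_gt0// mulr_gt0.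
have /cvgrPdist_le/(_ (eps / (32 * a))) H := decay_energy_cvg tau0 htau.
have {}H := H (divr_gt0 eps0 (mulr_gt0 (ltr0Sn _ _) a0)).
near=> n; rewrite sub0r normrN ger0_norm; last first.
  rewrite mulr_ge0 ?sqr_ge0//; apply: Rintegral_ge0 => x _.
  by rewrite mulr_ge0// expR_ge0.
apply: le_trans (B1 a n a0) _.
have : `|0 - D (tau n)| <= eps / (32 * a) by near: n.
rewrite sub0r normrN => /(le_trans (ler_norm _)) hD.
have -> : eps = 16 * a * (eps / (32 * a)) + 1 / (a * c).
  by rewrite /a; field; rewrite !gt_eqF.
by rewrite lerD2r ler_wpM2l// mulr_ge0// ltW.
Unshelve. all: by end_near.
Qed.

End WeightedDecay.

(** * Traces *)

Lemma ge0_le_integral_subset d (T : measurableType d) (R : realType)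
    (mu : {measure set T -> \bar R}) (D E : set T) (f g : T -> \bar R) : D `<=` E ->
  (forall x, D x -> (0 <= f x)%E) -> (forall x, D x -> (f x <= g x)%E) ->
  (forall x, E x -> (0 <= g x)%E) ->
  (\int[mu]_(x in D) f x <= \int[mu]_(x in E) g x)%E.
Proof.
move=> DE f0 fg g0; rewrite integral_mkcond [leRHS]integral_mkcond.
apply: ge0_le_integralW => x _; rewrite /patch.
  by case: ifPn => // Dx; apply: f0; exact: set_mem.
case: ifPn => [Dx|_].
  by have Dx' := set_mem Dx; rewrite (mem_set (DE _ Dx')); exact: fg.
by case: ifPn => // Ex; apply: g0; exact: set_mem.
Qed.

Section SquareConvergence.
Context d (T : measurableType d) (R : realType) (mu : {measure set T -> \bar R}).
Implicit Types (D : set T) (a b : T -> R).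

Definition sqcvg D (a_ : nat -> T -> R) a := (\int[mu]_(x in D) ((a_ n x - a x) ^+ 2)%:E)%E @[n --> \oo] --> 0%E.

Lemma sqcvg_comb D (a_ b_ : nat -> T -> R) a b (j k : R) : measurable D -> `|j| <= 1 -> `|k| <= 1 ->
  (forall n, measurable_fun D (a_ n)) -> (forall n, measurable_fun D (b_ n)) ->
  measurable_fun D a -> measurable_fun D b -> sqcvg D a_ a -> sqcvg D b_ b ->
  sqcvg D (fun n x => j * a_ n x + k * b_ n x) (fun x => j * a x + k * b x).
Proof.
move=> mD j1 k1 ma_ mb_ ma mb ca cb.
have i0 (f : T -> R) : (0 <= \int[mu]_(x in D) (f x ^+ 2)%:E)%E.
  by apply: integral_ge0 => x _; rewrite lee_fin sqr_ge0.
apply/ecvg0P => [n|eps eps0]; first exact: i0.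
have e4 : 0 < eps / 4 by rewrite divr_gt0.
have /ecvg0P/(_ _ e4) Ha := ca; have {}Ha := Ha (fun n => i0 _).
have /ecvg0P/(_ _ e4) Hb := cb; have {}Hb := Hb (fun n => i0 _).
near=> n.
have m1 : measurable_fun D (fun x => ((a_ n x - a x) ^+ 2)%:E).
  by apply/measurable_EFinP; apply: measurable_funX; exact: measurable_funB.
have m2 : measurable_fun D (fun x => ((b_ n x - b x) ^+ 2)%:E).
  by apply/measurable_EFinP; apply: measurable_funX; exact: measurable_funB.
apply: (@le_trans _ _ (\int[mu]_(x in D) (2%:E * ((a_ n x - a x) ^+ 2)%:E + 2%:E * ((b_ n x - b x) ^+ 2)%:E))%E).
  apply: ge0_le_integralW => x _; first by rewrite lee_fin sqr_ge0.
  rewrite -!EFinM -EFinD lee_fin.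
  set y := a_ n x - a x; set z := b_ n x - b x.
  have -> : j * a_ n x + k * b_ n x - (j * a x + k * b x) = j * y + k * z by rewrite /y /z; ring.
  have hj : (j * y) ^+ 2 <= y ^+ 2.
    by rewrite exprMn ler_piMl ?sqr_ge0// -[leRHS](expr1n R 2) sqr_le_bound.
  have hk : (k * z) ^+ 2 <= z ^+ 2.
    by rewrite exprMn ler_piMl ?sqr_ge0// -[leRHS](expr1n R 2) sqr_le_bound.
  by have := sqr_ge0 (j * y - k * z); nra.
rewrite ge0_integralD//; last 4 first.
- by move=> x _; rewrite mule_ge0 ?lee_fin ?sqr_ge0.
- exact: measurable_funeM.
- by move=> x _; rewrite mule_ge0 ?lee_fin ?sqr_ge0.
- exact: measurable_funeM.
have p0 (f : T -> R) x : D x -> (0 <= (f x ^+ 2)%:E)%E by rewrite lee_fin sqr_ge0.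
rewrite !ge0_integralZl_EFin//; [|exact: p0..].
apply: (@le_trans _ _ (2%:E * (eps / 4)%:E + 2%:E * (eps / 4)%:E)%E).
  by rewrite leeD// lee_wpmul2l ?lee_fin//; near: n.
by rewrite -!EFinM -EFinD lee_fin; lra.
Unshelve. all: by end_near.
Qed.

End SquareConvergence.

Section Traces.
Context {R : realType}.
Implicit Types (D Omega S : set (plane R)) (u w g : plane R -> R[i]).

Lemma smooth_B (f g : plane R -> R) : smooth f -> smooth g -> smooth (fun x => f x - g x).
Proof.
move=> sf sg n; elim: n f g sf sg => [|n IH] f g sf sg; split=> //.
- by move=> x; apply: cvgB; exact: smooth_continuous.
- by move=> x; apply: cvgB; exact: smooth_continuous.
move=> i; have [df dg] := (smooth_is_derive i ^~ sf, smooth_is_derive i ^~ sg).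
split; first by move=> x; apply: ex_derive; exact: is_deriveB.
have -> : 'D_(axis i) (fun x => f x - g x) = (fun x => 'D_(axis i) f x - 'D_(axis i) g x).
  by apply/funext => x; exact: (@derive_val _ _ _ _ _ _ _ (is_deriveB (df x) (dg x))).
by apply: IH; exact: smooth_derive.
Qed.

(** [wpartial] is a choice with default 0; it is a weak derivative as soon as one exists. *)
Lemma wpartial_spec D i u g : is_wpartial D i u g -> is_wpartial D i u (wpartial D i u).
Proof. by move=> H; rewrite /wpartial; apply: (@xgetPex _ _ [set g | is_wpartial D i u g]); exists g. Qed.

Lemma wpartial_ae D i u g im : open D -> bounded_set D -> is_wpartial D i u g ->
  {ae area, forall x, D x -> cpart im (wpartial D i u x) = cpart im (g x)}.
Proof.
move=> oD bD H; have mD : measurable (D : set (mplane R)) := measurable_open oD.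
have /(is_wpartialP _ _ _ mD) H1 := H; have /(is_wpartialP _ _ _ mD) H2 := wpartial_spec H.
exact: wpart_unique (H2 im) (H1 im).
Qed.

(** [H1norm] contains the chosen weak derivative of the difference phi n - w. By uniqueness it is
    almost everywhere the difference g n i of the derivatives, which is the quantity to be
    controlled. *)
Lemma trace_approx Omega S w (phi : nat -> plane R -> R[i]) im :
  open Omega -> bounded_set Omega -> measurable (S : set (mplane R)) -> S `<=` Omega ->
  Hk 1 Omega w -> (forall n, csmooth (phi n)) ->
  H1norm Omega (fun x => phi n x - w x) @[n --> \oo] --> 0%E ->
  sqcvg area (S : set (mplane R)) (fun n x => cpart im (phi n x)) (fun x => cpart im (w x)) /\
  forall i, sqcvg area (S : set (mplane R)) (fun n x => 'D_(axis i) (fun x => cpart im (phi n x)) x)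
    (fun x => cpart im (wpartial Omega i w x)).
Proof.
move=> oO bO mS SO [L2w Dw] sphi cphi.
have mO : measurable (Omega : set (mplane R)) := measurable_open oO.
have sphi' n k : smooth (fun x => cpart k (phi n x)) by have [? ?] := sphi n; case: k.
have Dw' i : is_wpartial Omega i w (wpartial Omega i w).
  by have [g gw _] := Dw i; exact: wpartial_spec gw.
pose g n i x := ('D_(axis i) (fun x => cpart false (phi n x)) x -
                cpart false (wpartial Omega i w x)) +i*
  ('D_(axis i) (fun x => cpart true (phi n x)) x - cpart true (wpartial Omega i w x)).
have gE n i k x : cpart k (g n i x) =
   'D_(axis i) (fun x => cpart k (phi n x)) x - cpart k (wpartial Omega i w x).
  by case: k.
have gP n i : is_wpartial Omega i (fun x => phi n x - w x) (g n i).
  apply/is_wpartialP => // k; have /(is_wpartialP _ _ _ mO)/(_ k) W := Dw' i.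
  under eq_fun do rewrite cpartB; under [X in wpart _ _ _ X]eq_fun do rewrite gE.
  apply: wpart_B => //; first exact: smooth_L2r.
    by move: L2w => /(L2P _ _ mO); exact.
  exact: wpart_smooth.
have q0 D' (f : plane R -> R[i]) : (0 <= sqint area D' f)%E.
  by apply: integral_ge0 => x _; rewrite lee_fin sqr_ge0.
pose X n := (sqint area Omega (fun x => phi n x - w x)%R
    + sqint area Omega (wpartial Omega false (fun x => phi n x - w x)%R)
    + sqint area Omega (wpartial Omega true (fun x => phi n x - w x)%R))%E.
have X0 n : (0 <= X n)%E by rewrite /X; apply: adde_ge0; [apply: adde_ge0|]; exact: q0.
have cX : X n @[n --> \oo] --> 0%E.
  apply/ecvg0P => // eps eps0.
  have s0 : 0 < Num.sqrt eps by rewrite sqrtr_gt0.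
  have /ecvg0P/(_ _ s0) H := cphi; have {}H := H (fun n => poweR_ge0 _ _).
  near=> n; rewrite -(sqr_sqrtr (ltW eps0)); apply: (poweR_half_le (X0 n) (ltW s0)).
  by near: n.
have part_le k (z : R[i]) : ((cpart k z ^+ 2)%:E <= (Normc.normc z ^+ 2)%:E)%E.
  by rewrite lee_fin; apply: sqr_le_bound; exact: cpart_le_normc.
rewrite /sqcvg; split=> [|i].
  apply: ecvg0_le cX => n; first by apply: integral_ge0 => x _; rewrite lee_fin sqr_ge0.
  rewrite /X -addeA; apply: (@le_trans _ _ (sqint area Omega (fun x => (phi n x - w x)%R))).
    apply: ge0_le_integral_subset => // x _; rewrite ?lee_fin ?sqr_ge0// -cpartB.
    exact: part_le.
  by rewrite leeDl//; apply: adde_ge0; exact: q0.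
apply: ecvg0_le cX => n; first by apply: integral_ge0 => x _; rewrite lee_fin sqr_ge0.
apply: (@le_trans _ _ (sqint area Omega (wpartial Omega i (fun x => phi n x - w x)%R))).
  have aE := wpartial_ae im oO bO (gP n i).
  have [Lg _] := gP n i; have [Lw _] := wpartial_spec (gP n i).
  move: Lg => /(L2P _ _ mO)/(_ im)[mg _]; move: Lw => /(L2P _ _ mO)/(_ im)[mw _].
  apply: (@le_trans _ _ (\int[area]_(x in (Omega : set (mplane R))) (cpart im (g n i x) ^+ 2)%:E)%E).
    apply: ge0_le_integral_subset => // x _; rewrite ?lee_fin ?sqr_ge0//.
    by rewrite gE.
  rewrite (@ge0_ae_eq_integral _ _ _ area Omega _ (fun x => (cpart im (wpartial Omega i (fun x => phi n x - w x) x) ^+ 2)%:E))//.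
  - by apply: ge0_le_integralW => x _; rewrite ?lee_fin ?sqr_ge0//; exact: part_le.
  - by apply/measurable_EFinP; exact: measurable_funX.
  - by apply/measurable_EFinP; exact: measurable_funX.
  - by move=> x _; rewrite lee_fin sqr_ge0.
  - by move=> x _; rewrite lee_fin sqr_ge0.
  - by apply: ae_area_mono aE => x E /E ->.
rewrite /X; case: (i).
  by rewrite leeDr//; apply: adde_ge0; exact: q0.
by rewrite addeAC leeDr//; apply: adde_ge0; exact: q0.
Unshelve. all: by end_near.
Qed.

End Traces.

(** * The corner of the domain *)

Section SectorGeometry.
Context {R : realType}.
Implicit Types (x : plane R).

Lemma sector_cone (tm tM : R) : 0 < tM - tm < pi ->
  exists (e : plane R) (c : R), [/\ e.1 ^+ 2 + e.2 ^+ 2 = 1, 0 < c &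
    forall x, sector tm tM x <-> 0 < sc e c x].
Proof.
move=> /andP[d0 dpi]; set de := (tM - tm) / 2; set tb := (tm + tM) / 2.
have de0 : 0 < de by rewrite divr_gt0.
have depi : de < pi / 2 by rewrite ltr_pM2r// invr_gt0.
have sd : 0 < sin de by rewrite sin_gt0_pihalf// de0.
have cd : 0 < cos de by rewrite cos_gt0_pihalf// depi andbT (lt_trans _ de0)// oppr_lt0 divr_gt0// pi_gt0.
(* [rot90 e] points along the bisector, and c is the cotangent of half the opening, positive since
   the opening is less than pi. *)
pose e : plane R := (sin tb, - cos tb); pose c := cos de / sin de.
have e1 : e.1 ^+ 2 + e.2 ^+ 2 = 1 by rewrite /= sqrrN addrC cos2Dsin2.
have c0 : 0 < c by rewrite divr_gt0.
exists e, c; split=> // x; have hE := heightE e c x; split.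
  move=> [r [t [r0 tmt ttM ->]]].
  have tcE : tc e (r * cos t, r * sin t) = r * sin (tb - t) by rewrite /tc /dot/= sinB; ring.
  have heE : height e (r * cos t, r * sin t) = r * cos (tb - t) by rewrite /height /dot/= cosB; ring.
  have f1 : - de < tb - t < de by apply/andP; split; rewrite /de /tb; lra.
  have [h1 h2] := andP f1.
  have pi2 : (pi : R) / 2 + pi / 2 = pi by rewrite -splitr.
  have s1 : 0 < sin (de - (tb - t)) by apply: sin_gt0_pi; apply/andP; split; lra.
  have s2 : 0 < sin (de + (tb - t)) by apply: sin_gt0_pi; apply/andP; split; lra.
  rewrite -[sc _ _ _](addrK (c * `|tc e (r * cos t, r * sin t)|)) -heightE heE tcE.
  rewrite normrM (gtr0_norm r0) mulrCA -mulrBr mulr_gt0// subr_gt0.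
  rewrite /c mulrAC ltr_pdivrMr// -[X in X * _](gtr0_norm cd) -normrM ltr_norml.
  move: s1 s2; rewrite (sinB de) (sinD de) => s1 s2.
  by rewrite [cos _ * sin de]mulrC; apply/andP; split; lra.
set tt := tc e x => sc0; have hh : height e x = sc e c x + c * `|tt| by exact: hE.
set y := height e x in hh.
have y0 : 0 < y by rewrite hh ltr_pwDl// mulr_ge0// ltW.
have ty : c * `|tt| < y by rewrite hh ltrDr.
(* The angle to the bisector, in ]-pi/2, pi/2[ as the height y is positive; x then has argument tb -
   phi. *)
pose phi := atan (tt / y).
have phi1 : - (pi / 2) < phi by exact: atan_gtNpi2.
have phi2 : phi < pi / 2 by exact: atan_ltpi2.
have cphi : 0 < cos phi by rewrite cos_gt0_pihalf// phi1.
have sphi : sin phi = tt / y * cos phi.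
  by rewrite -(atanK (tt / y)) -/phi /tan divfK// gt_eqF.
have pi2 : (pi : R) / 2 + pi / 2 = pi by rewrite -splitr.
(* Both signs at once: sg phi >= de would give sin (sg phi - de) >= 0, that is y <= c sg tt, against
   0 < sc. *)
have key (sg : R) : sg ^+ 2 = 1 -> sg * phi < de.
  move=> sg2; rewrite ltNge; apply/negP => le.
  have : 0 <= sin (sg * phi - de).
    apply: sin_ge0_pi; rewrite subr_ge0 le/=.
    have : `|phi| <= pi / 2 by rewrite ler_norml !ltW.
    have : sg * phi <= `|phi|.
      apply: le_trans (ler_norm _) _; rewrite normrM.
      suff -> : `|sg| = 1 by rewrite mul1r.
      by apply/eqP; rewrite -sqrp_eq1// real_normK ?num_real// sg2.
    by lra.
  have sgE : sg = 1 \/ sg = - 1.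
    by move/eqP: sg2; rewrite sqrf_eq1 => /orP[] /eqP ->; [left|right].
  have -> : sin (sg * phi - de) = cos phi / y * (sg * tt * cos de - y * sin de).
    have y_neq0 : y != 0 by rewrite gt_eqF.
    by case: sgE => ->; rewrite ?mul1r ?mulN1r sinB ?sinN ?cosN sphi; field.
  rewrite pmulr_rge0 ?divr_gt0// subr_ge0 => h.
  have : sg * tt <= `|tt|.
    by case: sgE => ->; rewrite ?mul1r ?mulN1r ?ler_norm// -normrN ler_norm.
  move=> h'; have : y <= c * `|tt|.
    rewrite /c mulrAC ler_pdivlMr//; apply: le_trans h _.
    by rewrite mulrC ler_wpM2l// ltW.
  by rewrite leNgt ty.
have k1 := key 1 (expr1n _ _); have k2 : - phi < de by rewrite -mulN1r key// sqrrN expr1n.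
rewrite mul1r in k1.
exists (y / cos phi), (tb - phi); split; first by rewrite divr_gt0.
- by move: k1; rewrite /de /tb; lra.
- by move: k2; rewrite /de /tb; lra.
have [X1 X2] := frame_coord e1 x; rewrite [LHS]surjective_pairing X1 X2 -/tt -/y.
have n1 : cos phi != 0 by rewrite gt_eqF.
have n2 : y != 0 by rewrite gt_eqF.
by congr pair; rewrite /= (cosB, sinB) sphi; field; rewrite n1 n2.
Qed.

Lemma enorm_le_cbox (x : plane R) (r : R) : cbox r x -> enorm x <= 2 * r.
Proof.
move=> /cboxP[x1 x2]; have r0 : 0 <= r := le_trans (normr_ge0 _) x1.
rewrite /enorm -(ger0_norm (mulr_ge0 (ler0n _ 2) r0)) -sqrtr_sqr ler_wsqrtr//.
have a1 := sqr_le_bound x1; have a2 := sqr_le_bound x2.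
apply: le_trans (lerD a1 a2) _.
by have := sqr_ge0 r; rewrite exprMn; lra.
Qed.

Lemma cbox_le_enorm (x : plane R) : cbox (enorm x) x.
Proof.
have K (a b : R) : `|a| <= Num.sqrt (a ^+ 2 + b ^+ 2).
  by rewrite -sqrtr_sqr ler_wsqrtr// lerDl sqr_ge0.
by apply/cboxP; split; rewrite /enorm ?K// addrC K.
Qed.

Lemma continuous_enorm : continuous (@enorm R).
Proof.
move=> x; rewrite /enorm; apply: (@continuous_comp _ _ _ (fun y : plane R => y.1 ^+ 2 + y.2 ^+ 2) (@Num.sqrt R)).
  by apply: cvgD; apply: (@continuous_comp _ _ _ _ (fun y : R => y ^+ 2)); [exact: cvg_fst | exact: exprn_continuous | exact: cvg_snd | exact: exprn_continuous].
exact: sqrt_continuous.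
Qed.

Lemma disc0E (h : R) : disc 0 h = [set x : plane R | enorm x < h].
Proof. by apply/funext => x; rewrite /disc /mkset subr0. Qed.

Lemma open_disc0 (h : R) : open (disc 0 h : set (plane R)).
Proof.
rewrite disc0E; apply: (@open_comp _ _ (@enorm R) [set y | y < h]); last exact: open_lt.
by move=> x _; exact: continuous_enorm.
Qed.

Lemma small_cbox (U : set (plane R)) (h : R) : open U -> U 0 -> 0 < h ->
  exists2 r : R, 0 < r & cbox r `<=` U `&` disc 0 h.
Proof.
move=> oU U0 h0; have : nbhs (0 : plane R) U by exact: open_nbhs_nbhs.
move=> /nbhs_ballP[eps /= eps0 HU].
exists (Num.min (eps / 2) (h / 3)); first by rewrite lt_min !divr_gt0.
move=> x xr; have [x1 x2] := (cboxP _ _).1 xr; split.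
  apply: HU; split; rewrite /ball/= sub0r normrN.
    by apply: (le_lt_trans x1); rewrite gt_min gtr_pMr// invf_lt1 ?ltr1n.
  by apply: (le_lt_trans x2); rewrite gt_min gtr_pMr// invf_lt1 ?ltr1n.
rewrite disc0E /mkset; apply: le_lt_trans (enorm_le_cbox xr) _.
apply: (@le_lt_trans _ _ (2 * (h / 3))); last by lra.
by rewrite ler_wpM2l// ge_min lexx orbT.
Qed.

Section Cone.
Variables (e : plane R) (c : R).
Hypothesis e1 : e.1 ^+ 2 + e.2 ^+ 2 = 1.
Hypothesis c0 : 0 < c.

Lemma cone_chart0E t : cone_chart e c (t, 0) = graph_curve e (fun t => c * `|t|) t.
Proof. by rewrite /cone_chart /rot /graph_curve /= add0r. Qed.

Lemma cone_chart_cbox t s : 0 <= s -> cbox (`|t| + (s + c * `|t|)) (cone_chart e c (t, s)).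
Proof.
move=> s0; apply: (frame_cbox e1); first by rewrite tc_chart.
by rewrite /height dot_chart//= ger0_norm// addr_ge0// mulr_ge0// ltW.
Qed.

Lemma lipschitz_cone : lipschitz (fun t : R => c * `|t|).
Proof.
exists c; split; first exact: num_real.
move=> M cM [s t] _ /=; rewrite -mulrBr normrM (gtr0_norm c0).
apply: (@le_trans _ _ (c * `|s - t|)).
  by rewrite ler_wpM2l ?(ltW c0)// ler_dist_dist.
by rewrite ler_wpM2r// ltW.
Qed.

Variables (Omega : set (plane R)) (h : R).
Hypothesis h0 : 0 < h.
Hypothesis oO : open Omega.
Hypothesis Ocone : forall x, disc 0 h x -> (Omega x <-> 0 < sc e c x).

Lemma graph_chart_cone : graph_chart Omega 0 h e (fun t => c * `|t|).
Proof.
split=> //; first by rewrite /enorm e1 sqrtr1.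
- exact: lipschitz_cone.
- by move=> x /Ocone ->; rewrite /sc subr_gt0.
Qed.

Lemma bdry_cone t : disc 0 h (cone_chart e c (t, 0)) -> bdry Omega (cone_chart e c (t, 0)).
Proof.
move=> Dt; split; last first.
  move=> /interior_subset /(Ocone Dt); by rewrite sc_chart//= ltxx.
move=> B BN.
have cl : (cone_chart e c (t, s) : plane R) @[s --> (0 : R)] --> cone_chart e c (t, 0).
  exact: continuous_chart_line.
have nB : nbhs (cone_chart e c (t, 0)) (B `&` disc 0 h).
  by apply: filterI => //; apply: open_nbhs_nbhs; split => //; exact: open_disc0.
have /nbhs_ballP[eps /= eps0 Heps] := cl _ nB.
have [] := Heps (eps / 2).
  by rewrite /ball/= sub0r normrN gtr0_norm ?divr_gt0// gtr_pMr// invf_lt1 ?ltr1n.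
move=> Bs Ds; exists (cone_chart e c (t, eps / 2)); split => //.
by apply/(Ocone Ds); rewrite sc_chart//= divr_gt0.
Qed.

End Cone.

End SectorGeometry.

Section TraceDifference.
Context {R : realType}.
Notation mu := (@lebesgue_measure R).
Variables (e : plane R) (c l M r h : R).
Hypothesis e1 : e.1 ^+ 2 + e.2 ^+ 2 = 1.
Hypothesis c0 : 0 < c.
Hypothesis l0 : 0 < l.
Hypothesis M0 : 0 < M.
Hypothesis h0 : 0 < h.
Hypothesis lMr : l + (M + c * l) <= r.
Variables (Omega Gamma U : set (plane R)).
Hypothesis oO : open Omega.
Hypothesis bO : bounded_set Omega.
Hypothesis oU : open U.
Hypothesis GammaE : Gamma = bdry Omega `&` U.
Hypothesis rU : cbox r `<=` U `&` disc 0 h.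
Hypothesis Ocone : forall x, disc 0 h x -> (Omega x <-> 0 < sc e c x).
Notation S := (cone_rect e c l M : set (mplane R)).
Notation curve := (graph_curve e (fun t => c * `|t|)).

Let mS : measurable S := measurable_cone_rect e c l M.
Let mO : measurable (Omega : set (mplane R)) := measurable_open oO.

Lemma cbox_mono (a b : R) : a <= b -> cbox a `<=` cbox b.
Proof. by move=> ab x /cboxP[x1 x2]; apply/cboxP; split; exact: le_trans ab. Qed.

Lemma cone_rect_Omega : S `<=` Omega.
Proof.
move=> x Sx; have := cone_rect_cbox e1 c0 Sx => /(cbox_mono lMr)/rU[_ Dx].
by apply/(Ocone Dx); case: Sx => _ /andP[].
Qed.

Lemma curve_Gamma t : `](- l), l[%classic t -> (Gamma `&` disc 0 h) (curve t).
Proof.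
rewrite /= in_itv/= => /andP[t1 t2]; have tl : `|t| <= l by rewrite ler_norml !ltW.
have := cone_chart_cbox e1 c0 t (lexx 0).
have le : `|t| + (0 + c * `|t|) <= r.
  apply: le_trans lMr; apply: lerD => //; apply: lerD; first exact: ltW.
  by rewrite ler_wpM2l// ltW.
move=> /(cbox_mono le)/rU[Ut Dt]; rewrite -cone_chart0E.
split=> //; rewrite GammaE; split => //.
exact: (bdry_cone e1 Ocone).
Qed.

Lemma continuous_curve : continuous (curve : R -> plane R).
Proof.
move=> t; have -> : curve = (fun t => cone_chart e c (t, 0)).
  by apply/funext => s; rewrite cone_chart0E.
exact: continuous_chart_edge.
Qed.

Let J : set (measurableTypeR R) := [set t | (Gamma `&` disc 0 h) (curve t)].

Lemma measurable_J : measurable J.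
Proof.
have mc : measurable_fun (setT : set (measurableTypeR R)) (curve : measurableTypeR R -> mplane R).
  apply: measurable_fun_pair.
    apply: continuous_measurable_fun => t.
    by apply: (@continuous_comp _ _ _ curve fst); [exact: continuous_curve|exact: cvg_fst].
  apply: continuous_measurable_fun => t.
  by apply: (@continuous_comp _ _ _ curve snd); [exact: continuous_curve|exact: cvg_snd].
have mG : measurable (Gamma `&` disc 0 h : set (mplane R)).
  apply: measurableI; last exact: (measurable_open (@open_disc0 R h)).
  rewrite GammaE; apply: measurableI; last exact: measurable_open.
  apply: measurableD; first by apply: measurable_closed; exact: closed_closure.
  by apply: measurable_open; exact: open_interior.
by have := mc measurableT _ mG; rewrite setTI.
Qed.

Variables (w v g : plane R -> R[i]).
Hypothesis Hw : Hk 1 Omega w.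
Hypothesis Hv : Hk 1 Omega v.
Hypothesis tw : has_trace Omega Gamma w g.
Hypothesis tv : has_trace Omega Gamma v g.
Variable im : bool.

Definition jump x := cpart im (w x) - cpart im (v x).
Definition jump_partial i x :=
  cpart im (wpartial Omega i w x) - cpart im (wpartial Omega i v x).
Definition jump_dirb x :=
  (rot90 e).1 * jump_partial false x + (rot90 e).2 * jump_partial true x.

Let I : set (measurableTypeR R) := `](- l), l[%classic.

Lemma trace_edge (phi : nat -> plane R -> R[i]) :
  (\int[mu]_(t in J)
      (Normc.normc (phi n (curve t) - g (curve t)) ^+ 2
            * Num.sqrt (1 + derive1 (fun t => c * `|t|) t ^+ 2))%:E)%E @[n --> \oo] --> 0%E ->
  sqcvg mu I (fun n t => cpart im (phi n (curve t))) (fun t => cpart im (g (curve t))).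
Proof.
apply: ecvg0_le => n; first by apply: integral_ge0 => x _; rewrite lee_fin sqr_ge0.
apply: ge0_le_integral_subset => x.
- exact: curve_Gamma.
- by rewrite lee_fin sqr_ge0.
- move=> _; rewrite lee_fin -cpartB.
  apply: le_trans (sqr_le_bound (cpart_le_normc _ _)) _.
  rewrite ler_peMr ?sqr_ge0// -[leLHS]sqrtr1 ler_wsqrtr// lerDl; exact: sqr_ge0.
- by move=> _; rewrite lee_fin mulr_ge0 ?sqr_ge0 ?sqrtr_ge0.
Qed.

Lemma L2_part (D : set (plane R)) (f : plane R -> R[i]) : measurable (D : set (mplane R)) ->
  L2 area D f -> L2r area (D : set (mplane R)) (fun x => cpart im (f x)).
Proof. by move=> mD /(L2P _ _ mD). Qed.

Lemma wpartial_Hk1 (f : plane R -> R[i]) i : Hk 1 Omega f ->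
  is_wpartial Omega i f (wpartial Omega i f).
Proof. by move=> [_ /(_ i)[g' gP _]]; exact: wpartial_spec gP. Qed.

Lemma L2r_jump : L2r area (Omega : set (mplane R)) jump.
Proof. by case: Hw Hv => [L1 _] [L2' _]; apply: L2r_B => //; exact: L2_part. Qed.

Lemma wpart_jump i : wpart Omega i jump (jump_partial i).
Proof.
have [L1 _] := Hw; have [L2' _] := Hv.
apply: wpart_B => //; try exact: L2_part.
  by have /(is_wpartialP _ _ _ mO)/(_ im) := wpartial_Hk1 i Hw.
by have /(is_wpartialP _ _ _ mO)/(_ im) := wpartial_Hk1 i Hv.
Qed.

Lemma L2r_jump_dirb : L2r area (Omega : set (mplane R)) jump_dirb.
Proof.
have [[L0 _] [L1 _]] := (wpart_jump false, wpart_jump true).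
have Z (k : R) (f : plane R -> R) : L2r area (Omega : set (mplane R)) f ->
    L2r area (Omega : set (mplane R)) (fun x => k * f x).
  move=> Lf; have := L2r_mul_bounded mO Lf (measurable_cst k) (fun _ _ => lexx `|k|).
  by under eq_fun do rewrite /= mulrC.
by apply: L2r_D => //; exact: Z.
Qed.

(** The smooth approximants of w and those of v converge on the edges to the same g, so their
    differences chi n tend to 0 there, as [weighted_poincare] demands. *)
Lemma jump_poincare (wa wb : R -> R) :
  measurable_fun setT wa -> measurable_fun setT wb ->
  (forall t, 0 <= wa t <= 1) -> (forall s, 0 <= wb s <= 1) ->
  (\int[area]_(x in S) (wa (tc e x) * wb (sc e c x) * jump x ^+ 2)%:E <=
   8 * \int[mu]_(s in `]0%R, M[) (s * wb s)%:E * \int[area]_(x in S) (wa (tc e x) * jump_dirb x ^+ 2)%:E)%E.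
Proof.
move=> mwa mwb wa01 wb01.
have [phi [sphi cphi tphi]] := tw; have [psi [spsi cpsi tpsi]] := tv.
(* The traces are read in every local chart; the graph of c |t| is one of them, centred at the
   corner. *)
have gc := graph_chart_cone e1 c0 h0 Ocone.
have [mg ephi] := tphi _ _ _ _ gc; have [_ epsi] := tpsi _ _ _ _ gc.
have [aphi dphi] := trace_approx im oO bO mS cone_rect_Omega Hw sphi cphi.
have [apsi dpsi] := trace_approx im oO bO mS cone_rect_Omega Hv spsi cpsi.
have sphi' n : smooth (fun x => cpart im (phi n x)) by have [? ?] := sphi n; case: (im).
have spsi' n : smooth (fun x => cpart im (psi n x)) by have [? ?] := spsi n; case: (im).
have mS' f : L2r area (Omega : set (mplane R)) f -> measurable_fun S f.
  by move=> /(L2r_subset mO mS cone_rect_Omega)[].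
have msm f : smooth f -> measurable_fun S f.
  by move=> sf; apply: continuous_measurable_plane => //; exact: smooth_continuous.
have mD i f : Hk 1 Omega f -> measurable_fun S (fun x => cpart im (wpartial Omega i f x)).
  move=> Hf; apply: mS'.
  by have /(is_wpartialP _ _ _ mO)/(_ im)[] := wpartial_Hk1 i Hf.
have mF f : Hk 1 Omega f -> measurable_fun S (fun x => cpart im (f x)).
  by move=> [Lf _]; apply: mS'; exact: L2_part.
pose chi n x := cpart im (phi n x) - cpart im (psi n x).
have schi n : smooth (chi n) by exact: smooth_B.
have [b1 b2] := frame_le1 e1.
have b1' : `|(rot90 e).1| <= 1 by rewrite /= normrN.
have n1 : `|1 : R| <= 1 by rewrite normr1.
have n1' : `|- 1 : R| <= 1 by rewrite normrN normr1.
apply: (weighted_poincare e1 schi) => //.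
- exact: mS' L2r_jump.
- exact: mS' L2r_jump_dirb.
- have := sqcvg_comb mS n1 n1' (fun n => msm _ (sphi' n)) (fun n => msm _ (spsi' n)) (mF _ Hw) (mF _ Hv) aphi apsi.
  rewrite /sqcvg /chi /jump; under [X in X @ _ --> _ -> _]eq_fun do under eq_integral do rewrite !mul1r !mulN1r.
  exact.
- have H i := sqcvg_comb mS n1 n1' (fun n => msm _ (smooth_derive i (sphi' n))) (fun n => msm _ (smooth_derive i (spsi' n))) (mD i _ Hw) (mD i _ Hv) (dphi i) (dpsi i).
  have mH i := measurable_funD (measurable_funM (measurable_cst (1 : R)) (mD i _ Hw)) (measurable_funM (measurable_cst (- 1 : R)) (mD i _ Hv)).
  have mHn i n := measurable_funD (measurable_funM (measurable_cst (1 : R)) (msm _ (smooth_derive i (sphi' n))))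
    (measurable_funM (measurable_cst (- 1 : R)) (msm _ (smooth_derive i (spsi' n)))).
  have K := sqcvg_comb mS b1' b1 (mHn false) (mHn true) (mH false) (mH true) (H false) (H true).
  have dE n i x : 'D_(axis i) (chi n) x = 'D_(axis i) (fun x => cpart im (phi n x)) x -
      'D_(axis i) (fun x => cpart im (psi n x)) x.
    by exact: (@derive_val _ _ _ _ _ _ _ (is_deriveB (smooth_is_derive i x (sphi' n)) (smooth_is_derive i x (spsi' n)))).
  have X (p q a b a' b' : R) : p * (1 * a + - 1 * b) + q * (1 * a' + - 1 * b') = p * (a - b) + q * (a' - b').
    by rewrite !mul1r !mulN1r.
  rewrite (_ : (fun n => _) = (fun n => \int[area]_(x in S) (((rot90 e).1 * (1 * 'D_(axis false) (fun x => cpart im (phi n x)) x +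
      - 1 * 'D_(axis false) (fun x => cpart im (psi n x)) x) +
      (rot90 e).2 * (1 * 'D_(axis true) (fun x => cpart im (phi n x)) x +
      - 1 * 'D_(axis true) (fun x => cpart im (psi n x)) x) -
      ((rot90 e).1 * (1 * cpart im (wpartial Omega false w x) + - 1 * cpart im (wpartial Omega false v x)) +
       (rot90 e).2 * (1 * cpart im (wpartial Omega true w x) + - 1 * cpart im (wpartial Omega true v x)))) ^+ 2)%:E)%E); first exact: K.
  apply/funext => n; apply: eq_integral => x _; congr ((_ - _) ^+ 2)%:E.
    by rewrite X /dirb (dE n false) (dE n true).
  by rewrite X.
- have mI : measurable I by exact: measurable_itv.
  have mcurve f : smooth f -> measurable_fun I (fun t => f (curve t)).
    move=> sf; apply: measurable_funTS; apply: continuous_measurable_fun => t.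
    apply: (@continuous_comp _ _ _ curve f); first exact: continuous_curve.
    exact: smooth_continuous.
  have mgI : measurable_fun I (fun t => cpart im (g (curve t))).
    move: mg => /Cmeasurable_cpart/(_ im); apply: measurable_funS; first exact: measurable_J.
    exact: curve_Gamma.
  have := sqcvg_comb mI n1 n1' (fun n => mcurve _ (sphi' n)) (fun n => mcurve _ (spsi' n)) mgI mgI (trace_edge ephi) (trace_edge epsi).
  rewrite /sqcvg /chi.
  under [X in X @ _ --> _ -> _]eq_fun do under eq_integral do rewrite !mul1r !mulN1r subrr subr0 -cone_chart0E.
  exact.
Qed.

End TraceDifference.

(** * Oscillating test functions *)

Section FrameLaplacian.
Context {R : realType}.
Variable e : plane R.
Hypothesis e1 : e.1 ^+ 2 + e.2 ^+ 2 = 1.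

Lemma dotC (x y : plane R) : dot x y = dot y x.
Proof. by rewrite /dot !(mulrC x.1) !(mulrC x.2). Qed.

Lemma is_derive_tc (x v : plane R) : is_derive x v (tc e) (tc e v).
Proof.
have -> : tc e = dot e by apply/funext => y; rewrite /tc dotC.
exact: is_derive_dot.
Qed.

Lemma is_derive_height (x v : plane R) : is_derive x v (height e) (height e v).
Proof.
have -> : height e = dot (rot90 e) by apply/funext => y; rewrite /height dotC.
exact: is_derive_dot.
Qed.

Lemma is_derive_frame (a a' b b' : R -> R) (x v : plane R) :
  (forall s, is_derive s (1 : R) a (a' s)) -> (forall s, is_derive s (1 : R) b (b' s)) ->
  is_derive x v (fun x => a (height e x) * b (tc e x))
   (height e v * (a' (height e x) * b (tc e x)) + tc e v * (a (height e x) * b' (tc e x))).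
Proof.
move=> Da Db.
have Ha := @is_derive_compl R (plane R : normedModType R) _ _ _ _ _ _ (Da (height e x)) (is_derive_height x v).
have Hb := @is_derive_compl R (plane R : normedModType R) _ _ _ _ _ _ (Db (tc e x)) (is_derive_tc x v).
by apply: is_derive_eq (is_deriveM Ha Hb) _; rewrite /GRing.scale/=; ring.
Qed.

(** The Laplacian is invariant under rotations. The product form is required on the open set S only,
    because it is there that the cutoff in [tc] is invisible. *)
Lemma laplacian_frame (S : set (plane R)) (f : plane R -> R) (a a' a'' b b' b'' : R -> R) : open S ->
  (forall s, is_derive s (1 : R) a (a' s)) -> (forall s, is_derive s (1 : R) a' (a'' s)) ->
  (forall s, is_derive s (1 : R) b (b' s)) -> (forall s, is_derive s (1 : R) b' (b'' s)) ->
  (forall x, S x -> f x = a (height e x) * b (tc e x)) ->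
  forall x, S x -> laplacian f x = a'' (height e x) * b (tc e x) + a (height e x) * b'' (tc e x).
Proof.
move=> oS Da Da' Db Db' fE x Sx.
have near_S y (P : plane R -> Prop) : S y -> (forall z, S z -> P z) -> \near y, P y.
  by move=> Sy SP; apply: filterS (open_nbhs_nbhs (conj oS Sy)) => z; exact: SP.
have D1 i y : S y -> 'D_(axis i) f y = height e (axis i) * (a' (height e y) * b (tc e y)) +
    tc e (axis i) * (a (height e y) * b' (tc e y)).
  move=> Sy; have := is_derive_frame y (axis i) Da Db.
  move=> /(near_eq_is_derive (near_S _ _ Sy _)) H.
  by apply: derive_val; apply: H => z Sz; rewrite fE.
have D2 i : 'D_(axis i) ('D_(axis i) f) x =
    height e (axis i) * (height e (axis i) * (a'' (height e x) * b (tc e x)) + tc e (axis i) * (a' (height e x) * b' (tc e x))) +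
    tc e (axis i) * (height e (axis i) * (a' (height e x) * b' (tc e x)) + tc e (axis i) * (a (height e x) * b'' (tc e x))).
  have H1 := is_derive_frame x (axis i) Da' Db; have H2 := is_derive_frame x (axis i) Da Db'.
  have := is_deriveD (is_deriveZ (height e (axis i)) H1) (is_deriveZ (tc e (axis i)) H2).
  move=> /(near_eq_is_derive (near_S _ _ Sx _)) H.
  by apply: derive_val; apply: H => z Sz; rewrite D1.
rewrite /laplacian !D2 /height /tc /dot /rot90/= !(mul0r, mul1r, addr0, add0r).
set A := a _; set A1 := a' _; set A2 := a'' _; set B := b _; set B1 := b' _; set B2 := b'' _.
transitivity ((e.1 ^+ 2 + e.2 ^+ 2) * (A2 * B + A * B2)); first by ring.
by rewrite e1 mul1r.
Qed.

End FrameLaplacian.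

Section Probe.
Context {R : realType}.
Variables (e : plane R) (c m : R).
Hypothesis e1 : e.1 ^+ 2 + e.2 ^+ 2 = 1.
Hypothesis c0 : 0 < c.
Hypothesis m0 : 0 < m.
(** The cutoff in height vanishes beyond 2 m, where the cone has half-width 2 m / c. The factor 3
    leaves a margin, so that the support of the probe meets the cone inside S. *)
Let l : R := 3 * m / c.
Let M : R := 3 * m.
Notation S := (cone_rect e c l M : set (mplane R)).

Let l0 : 0 < l. Proof. by rewrite divr_gt0// mulr_gt0. Qed.

Definition cutoff (s : R) : R := bump (m^-1 * s).

(* The real part of the harmonic function exp(tau (- y2 + i y1)) in the frame of the
   corner, truncated; on the cone the cutoff in y1 is 1 wherever that in y2 is not 0. *)
Definition probe (tau : R) (x : plane R) : R :=
  cutoff (height e x) * (decay e tau x * (cos (tau * tc e x) * bump (l^-1 * tc e x))).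

Lemma elem1_cutoff : elem1 cutoff.
Proof.
have -> : cutoff = bump \o (fun r => m^-1 * r + 0) by apply/funext => r /=; rewrite addr0.
by apply: Elem1_comp; [exact: elem1_bump | exact: elem1_affine].
Qed.

Lemma elem1_expRM (k : R) : elem1 (fun s => expR (k * s)).
Proof.
have -> : (fun s => expR (k * s)) = expR \o (fun r => k * r + 0) by apply/funext => r /=; rewrite addr0.
apply: Elem1_comp; last exact: elem1_affine.
exact: (Elem1_tower 0 (@tower_expR R)).
Qed.

Lemma elem1_cosM (k : R) : elem1 (fun s => cos (k * s)).
Proof.
have -> : (fun s => cos (k * s)) = cos \o (fun r => k * r + 0) by apply/funext => r /=; rewrite addr0.
apply: Elem1_comp; last exact: elem1_affine.
have := Elem1_tower 0 (@tower_cos R).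
by under eq_fun do rewrite /= mul0r addr0.
Qed.

Lemma elem_probe tau : elem (probe tau).
Proof.
have hE : elem (height e).
  have -> : height e = dot (rot90 e) by apply/funext => y; rewrite /height dotC.
  exact: Elem_lin.
have tE : elem (tc e).
  have -> : tc e = dot e by apply/funext => y; rewrite /tc dotC.
  exact: Elem_lin.
have -> : probe tau = (cutoff \o height e) \* (((fun s => expR (- tau * s)) \o height e) \*
   (((fun s => cos (tau * s)) \o tc e) \* ((bump \o (fun r => l^-1 * r + 0)) \o tc e))).
  by apply/funext => y; rewrite /probe /= addr0.
apply: Elem_mul; first by apply: Elem_comp => //; exact: elem1_cutoff.
apply: Elem_mul; first by apply: (@Elem_comp _ (fun s => expR (- tau * s))) => //; exact: elem1_expRM.
apply: Elem_mul; first by apply: (@Elem_comp _ (fun s => cos (tau * s))) => //; exact: elem1_cosM.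
by apply: Elem_comp => //; apply: Elem1_comp; [exact: elem1_bump | exact: elem1_affine].
Qed.

Lemma supp_probe tau x : supp (probe tau) x -> `|height e x| <= 2 * m /\ `|tc e x| <= 2 * l.
Proof.
have K (g : plane R -> R) (B : R) : 0 < B -> continuous g ->
    (forall y, probe tau y != 0 -> bump (B^-1 * g y) != 0) -> supp (probe tau) x -> `|g x| <= 2 * B.
  move=> B0 cg H; rewrite leNgt => sx; apply/negP => gx.
  have : nbhs x [set y | 2 * B < `|g y|].
    apply: open_nbhs_nbhs; split => //.
    apply: (@open_comp _ _ (fun y => `|g y|) [set z | 2 * B < z]); last exact: open_gt.
    by move=> y _; apply: continuous_comp; [exact: cg | exact: norm_continuous].
  move=> /sx[y [/H/eqP py /= gy]]; apply: py; apply: bump0.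
  by rewrite normrM normfV (gtr0_norm B0) mulrC ler_pdivlMr// ltW.
move=> sx; split.
  apply: K sx => //; first exact: continuous_dotr.
  by move=> y; rewrite /probe /cutoff; apply: contra_neq => ->; rewrite mul0r.
apply: K sx => //; first exact: continuous_tc.
by move=> y; rewrite /probe; apply: contra_neq => ->; rewrite !mulr0.
Qed.

Lemma supp_probe_cbox tau : supp (probe tau) `<=` cbox (2 * l + 2 * m).
Proof. by move=> x /supp_probe[hx tx]; exact: (frame_cbox e1 tx hx). Qed.

Lemma compact_supp_probe tau : compact (supp (probe tau)).
Proof.
apply: subclosed_compact (@supp_probe_cbox tau); last exact: compact_cbox.
exact: closed_closure.
Qed.

Lemma test_fun_probe tau : test_fun setT (probe tau).
Proof. by split=> //; [apply: elem_smooth; exact: elem_probe | exact: compact_supp_probe]. Qed.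

Lemma supp_probe_rect tau x : supp (probe tau) x -> 0 < sc e c x -> S x.
Proof.
move=> /supp_probe[hx _] s0; have hE := heightE e c x.
have hm : height e x <= 2 * m by apply: le_trans hx; exact: ler_norm.
have t0 := mulr_ge0 (ltW c0) (normr_ge0 (tc e x)).
have tl : `|tc e x| < l.
  by rewrite /l ltr_pdivlMr// mulrC; lra.
move: tl; rewrite ltr_norml => tl; split; first exact: tl.
by apply/andP; split=> //; rewrite /M; lra.
Qed.

Lemma probeE tau x : S x -> probe tau x = cutoff (height e x) * (decay e tau x * cos (tau * tc e x)).
Proof.
move=> [/andP[t1 t2] _]; rewrite /probe bump1 ?mulr1//.
by rewrite normrM normfV (gtr0_norm l0) mulrC ler_pdivrMr// mul1r ler_norml !ltW.
Qed.

(** Every surviving term contains a derivative of the cutoff, hence sits at height at least m, where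
    the exponential is at most exp(- tau m). *)
Lemma laplacian_probe_le : exists2 C, 0 <= C &
  forall tau x, 0 < tau -> S x -> `|laplacian (probe tau) x| <= C * (1 + 2 * tau) * expR (- tau * m).
Proof.
have [al1 E1 D1] := elem1_derive elem1_cutoff; have [al2 E2 D2] := elem1_derive E1.
(* On S the height is at most M + c l = 6 m. *)
have [C1 C10 B1] := elem1_bounded (6 * m) E1; have [C2 C20 B2] := elem1_bounded (6 * m) E2.
have z1 s : `|s| < m -> al1 s = 0.
  move=> sm; apply: (is_derive_locally_cst (c := 1) (D1 s)).
  have : nbhs s [set y | `|y| < m].
    apply: open_nbhs_nbhs; split => //.
    apply: (@open_comp _ _ (fun y : R => `|y|) [set z | z < m]); last exact: open_lt.
    by move=> y _; exact: norm_continuous.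
  apply: filterS => y ym; apply: bump1.
  by rewrite normrM normfV (gtr0_norm m0) mulrC ler_pdivrMr// mul1r ltW.
have z2 s : `|s| < m -> al2 s = 0.
  move=> sm; apply: (is_derive_locally_cst (c := 0) (D2 s)).
  have : nbhs s [set y | `|y| < m].
    apply: open_nbhs_nbhs; split => //.
    apply: (@open_comp _ _ (fun y : R => `|y|) [set z | z < m]); last exact: open_lt.
    by move=> y _; exact: norm_continuous.
  by apply: filterS => y; exact: z1.
exists (C1 + C2); first by rewrite addr_ge0.
move=> tau x tau0 Sx.
have Da (f f' : R -> R) s : (forall s, is_derive s (1 : R) f (f' s)) ->
    is_derive s (1 : R) (fun s => f s * expR (- tau * s)) ((f' s - tau * f s) * expR (- tau * s)).
  move=> Df; apply: is_derive_eq (is_deriveM (Df s) (is_derive_expRM (- tau) s)) _.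
  by rewrite /GRing.scale/=; ring.
have Df2 s : is_derive s (1 : R) (fun s => al1 s - tau * cutoff s) (al2 s - tau * al1 s).
  exact: is_deriveB (D2 s) (is_deriveZ tau (D1 s)).
have dm (t : R) : is_derive t (1 : R) (fun x => tau * x) tau.
  by have := is_deriveZ tau (is_derive_id t (1 : R)); rewrite /GRing.scale/= mulr1; exact.
have dc (t : R) : is_derive t (1 : R) (fun x => cos (tau * x)) (- sin (tau * t) * tau).
  exact: (is_derive1_comp (is_derive_cos (tau * t)) (dm t)).
have ds (t : R) : is_derive t (1 : R) (fun x => - sin (tau * x) * tau) (- (cos (tau * t) * tau) * tau).
  have H := is_derive1_comp (is_derive_sin (tau * t)) (dm t).
  by apply: is_derive_eq (is_deriveM (is_deriveN H) (is_derive_cst tau t (1 : R))) _; rewrite /GRing.scale/= mulr0 add0r mulrC.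
rewrite (laplacian_frame e1 (@open_cone_rect R e c l M) (fun s => Da _ _ s D1) (fun s => Da _ _ s Df2) dc ds _ Sx); last first.
  by move=> y Sy; rewrite probeE// mulrA.
set y := height e x; set z := tc e x.
(* The terms carrying the undifferentiated cutoff, both in tau^2, cancel: this is the harmonicity of
   exp(- tau y2) cos(tau y1). *)
have -> : (al2 y - tau * al1 y - tau * (al1 y - tau * cutoff y)) * expR (- tau * y) * cos (tau * z) +
   cutoff y * expR (- tau * y) * (- (cos (tau * z) * tau) * tau) =
   (al2 y - 2 * tau * al1 y) * expR (- tau * y) * cos (tau * z) by ring.
have [y0 [_ tz]] := cone_rect_height c0 Sx.
have [ym|ym] := ltP y m.
  have ym' : `|y| < m by rewrite gtr0_norm.
  rewrite (z1 _ ym') (z2 _ ym') mulr0 subrr !mul0r normr0.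
  by rewrite !mulr_ge0 ?expR_ge0 ?addr_ge0 ?(ltW tau0) ?mulr_ge0 ?(ltW tau0).
have y6 : `|y| <= 6 * m.
  rewrite gtr0_norm// /y (heightE e c); case: Sx => [/andP[t1 t2] /andP[s1 s2]].
  have : c * `|tc e x| <= c * l by rewrite ler_wpM2l ?(ltW c0)// ler_norml !ltW.
  have -> : c * l = 3 * m by rewrite /l; field; rewrite gt_eqF.
  by move: s2; rewrite /M; lra.
rewrite normrM -[leRHS]mulr1; apply: ler_pM => //; last by rewrite ler_norml cos_geN1 cos_le1.
rewrite normrM [`|expR _|]ger0_norm ?expR_ge0//; apply: ler_pM => //.
  apply: le_trans (ler_normB _ _) _; rewrite normrM (gtr0_norm (mulr_gt0 (ltr0Sn _ 1) tau0)).
  have := B1 _ y6; have := B2 _ y6 => b2 b1.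
  have : 2 * tau * `|al1 y| <= 2 * tau * C1 by rewrite ler_wpM2l// mulr_ge0// ltW.
  by have := mulr_ge0 C20 (ltW tau0); lra.
by rewrite ler_expR !mulNr lerN2 ler_wpM2l// ltW.
Qed.

End Probe.

(** Each of the three powers of tau is paid for by halving the exponent once, and an exponential
    remains. *)
Lemma pow_decay_cvg (R : realType) (m : R) (tau : nat -> R) : 0 < m -> (forall n, 0 < tau n) ->
  tau n @[n --> \oo] --> +oo ->
  tau n ^+ 2 * ((1 + 2 * tau n) * expR (- tau n * m)) @[n --> \oo] --> (0 : R).
Proof.
move=> m0 tau0 htau.
have step (p s : R) : 0 < p -> 0 < s -> s * expR (- (s * p)) <= 2 / p * expR (- (s * (p / 2))).
  move=> p0 s0; have := mul_expR_half p0 (ltW s0).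
  by rewrite !mulNr (mulrC s p) (mulrC s (p / 2)).
have m2 : 0 < m / 2 by rewrite divr_gt0.
have m4 : 0 < m / 2 / 2 by rewrite divr_gt0.
have m8 : 0 < m / 2 / 2 / 2 by rewrite divr_gt0.
pose K1 : R := 2 / m * (2 / (m / 2)); pose K2 : R := K1 * (2 / (m / 2 / 2)).
have K10 : 0 < K1 by rewrite mulr_gt0// divr_gt0.
have E4 := expR_decay_cvg m4 htau; have E8 := expR_decay_cvg m8 htau.
apply: (@squeeze_cvgr _ _ _ _ (fun=> 0)
  (fun n => K1 * expR (- (tau n * (m / 2 / 2))) + 2 * K2 * expR (- (tau n * (m / 2 / 2 / 2))))).
- apply: nearW => n; have t0 := tau0 n; rewrite mulr_ge0 ?sqr_ge0 ?mulr_ge0 ?expR_ge0 ?addr_ge0 ?mulr_ge0 ?(ltW t0)//=.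
  have h2 : tau n ^+ 2 * expR (- (tau n * m)) <= K1 * expR (- (tau n * (m / 2 / 2))).
    apply: (@le_trans _ _ (tau n * (2 / m * expR (- (tau n * (m / 2)))))).
      by rewrite expr2 -mulrA ler_wpM2l ?(ltW t0)// step.
    rewrite mulrCA /K1 -(mulrA (2 / m)) ler_wpM2l ?divr_ge0 ?(ltW m0)//; exact: step.
  have h3 : tau n * (tau n ^+ 2 * expR (- (tau n * m))) <= K2 * expR (- (tau n * (m / 2 / 2 / 2))).
    apply: (@le_trans _ _ (tau n * (K1 * expR (- (tau n * (m / 2 / 2)))))).
      by rewrite ler_wpM2l ?(ltW t0).
    rewrite mulrCA /K2 -(mulrA K1) ler_wpM2l ?(ltW K10)//; exact: step.
  rewrite mulNr (_ : tau n ^+ 2 * _ = tau n ^+ 2 * expR (- (tau n * m)) +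
    2 * (tau n * (tau n ^+ 2 * expR (- (tau n * m))))); last by ring.
  by rewrite lerD// -mulrA ler_wpM2l.
- exact: cvg_cst.
- rewrite -[X in _ --> X]addr0 -[X in _ --> X + _](mulr0 K1) -[X in _ --> _ + X](mulr0 (2 * K2)).
  by apply: cvgD; apply: cvgMl_tmp.
Qed.

(** * The difference of the two equations tested with the probe *)

Section GreenLimit.
Context {R : realType}.
Notation mu := (@lebesgue_measure R).
Implicit Types (Omega : set (plane R)).

Lemma Rintegral_restrict (S Omega : set (mplane R)) (f : plane R -> R) : S `<=` Omega ->
  (forall x, Omega x -> ~ S x -> f x = 0) ->
  \int[area]_(x in Omega) f x = \int[area]_(x in S) f x.
Proof.
move=> SO f0; rewrite /Rintegral integral_mkcond [in RHS]integral_mkcond; congr fine.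
apply: eq_integral => x _; rewrite /patch.
have [Sx|nSx] := boolP (x \in S); first by rewrite (mem_set (SO _ (set_mem Sx))).
case: ifPn => // Ox; rewrite f0//; first exact: set_mem.
by move/mem_set; apply/negP.
Qed.

Lemma not_supp_laplacian0 (f : plane R -> R) x : ~ supp f x -> laplacian f x = 0.
Proof.
move=> nx; have nD i : 'D_(axis i) ('D_(axis i) f) x = 0.
  have : \near x, 'D_(axis i) f x = cst 0 x.
    have oS : open (~` supp f) by apply: closed_openC; exact: closed_closure.
    by apply: filterS (open_nbhs_nbhs (conj oS nx)) => y; exact: not_supp_derive0.
  by move=> /near_eq_derive ->; rewrite derive_cst.
by rewrite /laplacian !nD addr0.
Qed.

(** The normal derivative is defined through the chosen [wlaplacian]; uniqueness identifies it with
    the right-hand side of the equation. *)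
Lemma wlaplacian_ae Omega u g im : open Omega -> bounded_set Omega -> is_wlaplacian Omega u g ->
  L2 area Omega (wlaplacian Omega u) /\
  {ae area, forall x, Omega x -> cpart im (wlaplacian Omega u x) = cpart im (g x)}.
Proof.
move=> oO bO H; have mO : measurable (Omega : set (mplane R)) := measurable_open oO.
have H' : is_wlaplacian Omega u (wlaplacian Omega u).
  by rewrite /wlaplacian; apply: (@xgetPex _ _ [set g | is_wlaplacian Omega u g]); exists g.
split; first by case: H'.
have [L1 H1] := H'; have [L2' H2] := H.
apply: dubois_reymond2 => //; [exact: L2_part|exact: L2_part|].
move=> psi tpsi; have := H1 psi tpsi; rewrite (H2 psi tpsi) => /(congr1 (cpart im)).
rewrite !cpart_integral; under eq_Rintegral do rewrite cpart_mulr.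
by under [in RHS]eq_Rintegral do rewrite cpart_mulr.
Qed.

Variables (e : plane R) (c m r h : R).
Hypothesis e1 : e.1 ^+ 2 + e.2 ^+ 2 = 1.
Hypothesis c0 : 0 < c.
Hypothesis m0 : 0 < m.
Hypothesis h0 : 0 < h.
Let l : R := 3 * m / c.
Let M : R := 3 * m.
Hypothesis mr : 2 * l + 6 * m <= r.
Variables (Omega Gamma U : set (plane R)).
Hypothesis oO : open Omega.
Hypothesis bO : bounded_set Omega.
Hypothesis oU : open U.
Hypothesis GammaE : Gamma = bdry Omega `&` U.
Hypothesis rU : cbox r `<=` U `&` disc 0 h.
Hypothesis Ocone : forall x, disc 0 h x -> (Omega x <-> 0 < sc e c x).
Notation S := (cone_rect e c l M : set (mplane R)).

Let mS : measurable S := measurable_cone_rect e c l M.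
Let mO : measurable (Omega : set (mplane R)) := measurable_open oO.

Let l0 : 0 < l. Proof. by rewrite divr_gt0// mulr_gt0. Qed.
Let M0 : 0 < M. Proof. by rewrite mulr_gt0. Qed.

Let lMr : l + (M + c * l) <= r.
Proof.
apply: le_trans mr; have -> : c * l = 3 * m by rewrite /l; field; rewrite gt_eqF.
by rewrite /M; move: l0; lra.
Qed.

Variables (w v g fw fv : plane R -> R[i]).
Hypothesis Hw : Hk 1 Omega w.
Hypothesis Hv : Hk 1 Omega v.
Hypothesis tw : has_trace Omega Gamma w g.
Hypothesis tv : has_trace Omega Gamma v g.
Hypothesis lw : is_wlaplacian Omega w fw.
Hypothesis lv : is_wlaplacian Omega v fv.
Hypothesis nwv : eq_normal_derivative Omega Gamma w v.

Let SO : S `<=` Omega := cone_rect_Omega e1 c0 lMr rU Ocone.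

Lemma supp_probe_U tau x : supp (probe e c m tau) x -> (U `&` disc 0 h) x.
Proof.
move=> /(supp_probe_cbox e1 c0 m0) /cboxP[x1 x2]; apply: rU; apply/cboxP.
have le : 2 * (3 * m / c) + 2 * m <= r by apply: le_trans mr; rewrite lerD2l ler_wpM2r ?(ltW m0)// ler_nat.
by split; exact: le_trans le.
Qed.

Let X2 (a b a' b' p q : R) : (a - b) * p + (a' - b') * q = (a * p + a' * q) - (b * p + b' * q).
Proof. by ring. Qed.

Let X3 (Aw Fw Av Fv J : R) : Aw + Fw = Av + Fv -> Aw - Av = - J -> Fw - Fv = J.
Proof. by lra. Qed.

(** The support of the probe meets the boundary inside Gamma, so equality of the normal derivatives
    says that int grad(w - v) . grad(phi) + int (fw - fv) phi = 0; [cone_green] then moves the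
    gradient onto phi. *)
Lemma probe_green im tau :
  \int[area]_(x in S) ((cpart im (fw x) - cpart im (fv x)) * probe e c m tau x) =
  \int[area]_(x in S) (jump w v im x * laplacian (probe e c m tau) x).
Proof.
set phi := probe e c m tau.
have Ephi : elem phi := elem_probe e c m tau.
have tphi : test_fun setT phi := test_fun_probe e1 c0 m0 tau.
have [sphi cphi _] := tphi.
have pS x : supp phi x -> Omega x -> S x.
  move=> sx Ox; have [_ Dx] := supp_probe_U sx.
  by apply: supp_probe_rect sx _ => //; apply/(Ocone Dx).
have out x : Omega x -> ~ S x -> ~ supp phi x by move=> Ox nS sx; apply: nS; exact: pS.
have LJ := L2r_jump oO Hw Hv im; have WJ := wpart_jump oO bO Hw Hv im.
have pn : supp phi `&` bdry Omega `<=` Gamma.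
  by move=> x [/supp_probe_U[Ux _] bx]; rewrite GammaE.
have ND := nwv tphi pn.
have poin := jump_poincare e1 c0 M0 h0 lMr oO bO oU GammaE rU Ocone Hw Hv tw tv im.
have LJS := L2r_subset mO mS SO LJ.
have LDS := L2r_subset mO mS SO (L2r_jump_dirb e oO bO Hw Hv im).
(* The strip bounds that [cone_green] asks for: quadratic in the width for the jump, by the Poincare
   inequality, and linear for the area. *)
have := cone_green oO bO (ltW c0) LJ WJ (strip_sq LDS poin) (fun d d0 => strip_area c M e1 l0 d0)
  Ephi cphi _ pS SO.
have phi_cone x : supp phi x -> Omega x <-> 0 < sc e c x.
  by move=> /supp_probe_U[_ /Ocone].
move=> /(_ phi_cone) GR; clearbody phi.
have R1 : \int[area]_(x in Omega) ((cpart im (fw x) - cpart im (fv x)) * phi x) =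
    \int[area]_(x in S) ((cpart im (fw x) - cpart im (fv x)) * phi x).
  apply: (@Rintegral_restrict S Omega (fun x => (cpart im (fw x) - cpart im (fv x)) * phi x) SO) => x Ox nS.
  have z : phi x = 0 := not_supp0 (out x Ox nS).
  by rewrite z mulr0.
have R2 : \int[area]_(x in Omega) (jump w v im x * laplacian phi x) =
    \int[area]_(x in S) (jump w v im x * laplacian phi x).
  apply: (@Rintegral_restrict S Omega (fun x => jump w v im x * laplacian phi x) SO) => x Ox nS.
  have z := not_supp_laplacian0 (out x Ox nS).
  by rewrite z mulr0.
rewrite -{}R1 -{}R2.
have Lphi : L2r area (Omega : set (mplane R)) phi := smooth_L2r oO bO sphi.
have LD i : L2r area (Omega : set (mplane R)) ('D_(axis i) phi) := smooth_L2r oO bO (smooth_derive i sphi).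
have Lg i u : Hk 1 Omega u -> L2r area (Omega : set (mplane R)) (fun x => cpart im (wpartial Omega i u x)).
  by move=> Hu; have /(is_wpartialP _ _ _ mO)/(_ im)[] := wpartial_Hk1 i Hu.
have IA i u : Hk 1 Omega u ->
    area.-integrable (Omega : set (mplane R)) (EFin \o (fun x => cpart im (wpartial Omega i u x) * 'D_(axis i) phi x)).
  by move=> Hu; exact: (L2r_mul mO (Lg i u Hu) (LD i)).
have IA2 u Hu := integrableD mO (IA false u Hu) (IA true u Hu).
have IL u f : is_wlaplacian Omega u f ->
    area.-integrable (Omega : set (mplane R)) (EFin \o (fun x => cpart im (f x) * phi x)).
  by move=> [Lf _]; exact: (L2r_mul mO (L2_part im mO Lf) Lphi).
have NE u f : Hk 1 Omega u -> is_wlaplacian Omega u f -> cpart im (normal_derivative Omega u phi) =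
    \int[area]_(x in Omega) (cpart im (wpartial Omega false u x) * 'D_(axis false) phi x +
       cpart im (wpartial Omega true u x) * 'D_(axis true) phi x) +
    \int[area]_(x in Omega) (cpart im (f x) * phi x).
  move=> Hu Hf; rewrite cpart_integral.
  have X (z1 z2 z3 : R[i]) (s1 s2 s3 : R) : cpart im (z1 * s1%:C + z2 * s2%:C + z3 * s3%:C) =
      cpart im z1 * s1 + cpart im z2 * s2 + cpart im z3 * s3.
    by rewrite 2!cpartD 3!cpart_mulr.
  have [Lw aw] := wlaplacian_ae im oO bO Hf.
  have IB := L2r_mul mO (L2_part im mO Lw) Lphi.
  have E3 : \int[area]_(x in Omega) (cpart im (wlaplacian Omega u x) * phi x) =
      \int[area]_(x in Omega) (cpart im (f x) * phi x).
    have ae : ae_eq area (Omega : set (mplane R)) (EFin \o (fun x => cpart im (wlaplacian Omega u x) * phi x))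
        (EFin \o (fun x => cpart im (f x) * phi x)).
      by apply: ae_area_mono aw => x H Ox /=; rewrite (H Ox).
    exact: (congr1 fine (ae_eq_integral _ _ mO (measurable_int area IB) (measurable_int area (IL _ _ Hf)) ae)).
  rewrite -E3; transitivity (\int[area]_(x in Omega)
     ((cpart im (wpartial Omega false u x) * 'D_(axis false) phi x +
       cpart im (wpartial Omega true u x) * 'D_(axis true) phi x) + cpart im (wlaplacian Omega u x) * phi x)).
    by apply: eq_Rintegral => x _; exact: X.
  exact: (RintegralD mO (IA2 u Hu) IB).
have {}ND := etrans (esym (NE w fw Hw lw)) (etrans (congr1 (cpart im) ND) (NE v fv Hv lv)).
have GE : \int[area]_(x in Omega) (jump_partial Omega w v im false x * 'D_(axis false) phi x +
      jump_partial Omega w v im true x * 'D_(axis true) phi x) =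
    \int[area]_(x in Omega) (cpart im (wpartial Omega false w x) * 'D_(axis false) phi x +
       cpart im (wpartial Omega true w x) * 'D_(axis true) phi x) -
    \int[area]_(x in Omega) (cpart im (wpartial Omega false v x) * 'D_(axis false) phi x +
       cpart im (wpartial Omega true v x) * 'D_(axis true) phi x).
  rewrite -[RHS](RintegralB mO (IA2 w Hw) (IA2 v Hv)); apply: eq_Rintegral => x _.
  exact: X2.
have FE : \int[area]_(x in Omega) ((cpart im (fw x) - cpart im (fv x)) * phi x) =
    \int[area]_(x in Omega) (cpart im (fw x) * phi x) - \int[area]_(x in Omega) (cpart im (fv x) * phi x).
  rewrite -[RHS](RintegralB mO (IL _ _ lw) (IL _ _ lv)); apply: eq_Rintegral => x _; exact: mulrBl.
rewrite FE; move: GR; rewrite GE => GR.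
exact: X3 ND GR.
Qed.

(** After Green's formula the factor next to w - v is exponentially small uniformly on S, so
    integrability of w - v is enough against tau^2. *)
Lemma jump_laplacian_cvg im (tau : nat -> R) : (forall n, 0 < tau n) ->
  tau n @[n --> \oo] --> +oo ->
  tau n ^+ 2 * \int[area]_(x in S) ((cpart im (fw x) - cpart im (fv x)) * probe e c m (tau n) x) @[n --> \oo] --> (0 : R).
Proof.
move=> tau0 htau; have [C C0 HC] := laplacian_probe_le e1 c0 m0.
have LJS := L2r_subset mO mS SO (L2r_jump oO Hw Hv im).
have Sfin : (area S < +oo)%E by rewrite area_cone_rect// ltry.
have IJ := L2r_integrable mS Sfin LJS.
have IJa : area.-integrable S (EFin \o (fun x => `|jump w v im x|)) by exact: (integrable_norm IJ).
pose K := \int[area]_(x in S) `|jump w v im x|.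
have K0 : 0 <= K by apply: Rintegral_ge0.
have E := pow_decay_cvg m0 tau0 htau.
apply: norm_cvg0; apply: (@squeeze_cvgr _ _ _ _ (fun=> 0)
  (fun n => (C * K) * (tau n ^+ 2 * ((1 + 2 * tau n) * expR (- tau n * m))))).
- apply: nearW => n; rewrite normr_ge0/= probe_green normrM ger0_norm ?sqr_ge0//.
  rewrite mulrCA ler_wpM2l ?sqr_ge0//.
  set b := (1 + 2 * tau n) * _.
  have mlap : measurable_fun S (laplacian (probe e c m (tau n))).
    have sm := elem_smooth (elem_probe e c m (tau n)).
    have cD i := smooth_continuous (smooth_derive i (smooth_derive i sm)).
    have cl : continuous (laplacian (probe e c m (tau n))) by move=> x; exact: cvgD (cD false x) (cD true x).
    exact: (continuous_measurable_plane cl mS).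
  have Llap : L2r area S (laplacian (probe e c m (tau n))).
    by apply: (@L2r_bounded _ _ _ _ _ _ (C * b)) => // x Sx; rewrite /b mulrA; exact: HC.
  have I1 := L2r_mul mS LJS Llap.
  apply: le_trans (le_normr_Rintegral mS I1) _.
  apply: (@le_trans _ _ (\int[area]_(x in S) (C * b * `|jump w v im x|))).
    apply: le_Rintegral => //; first exact: (integrable_norm I1).
      exact: (integrableZl mS (C * b) IJa).
    by move=> x Sx; rewrite normrM mulrC ler_wpM2r// /b mulrA; exact: HC.
  by rewrite RintegralZl// mulrAC.
- exact: cvg_cst.
- by rewrite -[X in _ --> X](mulr0 (C * K)); apply: cvgMl_tmp.
Qed.

End GreenLimit.

Section ComplexProducts.
Context {R : realType}.
Implicit Types (z a b : R[i]).

Lemma normcD_le a b : Normc.normc (a + b) <= Normc.normc a + Normc.normc b.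
Proof. exact: (@le_normcD R a b). Qed.

Lemma cpart_mul im a b : cpart im (a * b) =
  if im then cpart false a * cpart true b + cpart true a * cpart false b
  else cpart false a * cpart false b - cpart true a * cpart true b.
Proof. by case: im a b => -[? ?] [? ?]. Qed.

Lemma cpart_mul_le im a b (K : R) : Normc.normc a <= K ->
  `|cpart im (a * b)| <= K * (`|cpart false b| + `|cpart true b|).
Proof.
move=> aK; apply: le_trans (cpart_le_normc _ _) _; rewrite Normc.normcM.
by apply: ler_pM => //; [exact: normc_ge0 | exact: normc_ge0 | exact: normc_le_parts].
Qed.

Lemma measurable_cmul d (T : measurableType d) (D : set T) (f g : T -> R[i]) :
  Cmeasurable D f -> Cmeasurable D g -> forall im, measurable_fun D (fun x => cpart im (f x * g x)).
Proof.
move=> /Cmeasurable_cpart mf /Cmeasurable_cpart mg im.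
under eq_fun do rewrite cpart_mul.
by case: im; [apply: measurable_funD | apply: measurable_funB]; apply: measurable_funM.
Qed.

End ComplexProducts.

Section AeDomination.
Context d (T : measurableType d) (R : realType) (mu : {measure set T -> \bar R}).
Implicit Types (D : set T) (f g : T -> R).

Lemma integrable_ae_le D f g : measurable D -> measurable_fun D f -> mu.-integrable D (EFin \o g) ->
  (forall x, D x -> 0 <= f x) -> (forall x, D x -> 0 <= g x) ->
  {ae mu, forall x, D x -> f x <= g x} ->
  mu.-integrable D (EFin \o f) /\ \int[mu]_(x in D) f x <= \int[mu]_(x in D) g x.
Proof.
move=> mD mf ig f0 g0 fg.
have H : (\int[mu]_(x in D) (f x)%:E <= \int[mu]_(x in D) (g x)%:E)%E.
  apply: ae_ge0_le_integral => //.
  - by apply/measurable_EFinP.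
  - exact: (measurable_int mu ig).
have jf : mu.-integrable D (EFin \o f).
  apply/integrableP; split; first exact/measurable_EFinP.
  rewrite (eq_integral (fun x => (f x)%:E)); last first.
    by move=> x /set_mem Dx; rewrite gee0_abs//= lee_fin f0.
  apply: le_lt_trans H _; rewrite EFin_Rintegral//; exact: ltry.
by split=> //; rewrite -lee_fin -!EFin_Rintegral.
Qed.

Lemma L2r_ae_le D f g : measurable D -> measurable_fun D f -> L2r mu D g ->
  {ae mu, forall x, D x -> `|f x| <= g x} -> L2r mu D f.
Proof.
move=> mD mf [mg Ig] fg; split=> //; apply: le_lt_trans Ig.
apply: ae_ge0_le_integral => //.
- by move=> x _; rewrite lee_fin sqr_ge0.
- by apply/measurable_EFinP; exact: measurable_funX.
- by move=> x _; rewrite lee_fin sqr_ge0.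
- by apply/measurable_EFinP; exact: measurable_funX.
- by apply: filterS fg => x H Dx; rewrite lee_fin sqr_le_bound// H.
Qed.

Lemma L2r_abs D f : L2r mu D f -> L2r mu D (fun x => `|f x|).
Proof.
move=> [mf If]; split; first exact: measurableT_comp mf.
by under eq_integral do rewrite real_normK ?num_real//.
Qed.

Lemma L2r_Z D f (a : R) : measurable D -> L2r mu D f -> L2r mu D (fun x => a * f x).
Proof.
move=> mD Lf; have := L2r_mul_bounded mD Lf (measurable_cst a) (fun _ _ => lexx `|a|).
by under eq_fun do rewrite /= mulrC.
Qed.

End AeDomination.

Section CornerLimit.
Context {R : realType}.
Variables (e : plane R) (c m r h k : R).
Hypothesis e1 : e.1 ^+ 2 + e.2 ^+ 2 = 1.
Hypothesis c0 : 0 < c.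
Hypothesis m0 : 0 < m.
Hypothesis h0 : 0 < h.
Hypothesis k0 : 0 < k.
Let l : R := 3 * m / c.
Let M : R := 3 * m.
Hypothesis mr : 2 * l + 6 * m <= r.
Variables (Omega Gamma U : set (plane R)).
Hypothesis oO : open Omega.
Hypothesis bO : bounded_set Omega.
Hypothesis oU : open U.
Hypothesis GammaE : Gamma = bdry Omega `&` U.
Hypothesis rU : cbox r `<=` U `&` disc 0 h.
Hypothesis Ocone : forall x, disc 0 h x -> (Omega x <-> 0 < sc e c x).
Notation S := (cone_rect e c l M : set (mplane R)).

Let mS : measurable S := measurable_cone_rect e c l M.
Let mO : measurable (Omega : set (mplane R)) := measurable_open oO.

Let l0 : 0 < l. Proof. by rewrite divr_gt0// mulr_gt0. Qed.
Let M0 : 0 < M. Proof. by rewrite mulr_gt0. Qed.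

Let lMr : l + (M + c * l) <= r.
Proof.
apply: le_trans mr; have -> : c * l = 3 * m by rewrite /l; field; rewrite gt_eqF.
by rewrite /M; move: l0; lra.
Qed.

Variables (V w v : plane R -> R[i]).
Hypothesis LV : Linfty Omega V.
Hypothesis TE : transmission_eigenfunctions Omega Gamma k (fun x => 1 + V x) v w.

Let SO : S `<=` Omega := cone_rect_Omega e1 c0 lMr rU Ocone.

Lemma jump_decay_cvg im (tau : nat -> R) : (forall n, 0 < tau n) ->
  tau n @[n --> \oo] --> +oo ->
  tau n ^+ 2 * \int[area]_(x in S) (`|jump w v im x| * decay e (tau n) x) @[n --> \oo] --> (0 : R).
Proof.
have [[Hv Hw] _ _ _ [[g tw tv] _]] := TE.
have poin := jump_poincare e1 c0 M0 h0 lMr oO bO oU GammaE rU Ocone Hw Hv tw tv im.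
have LJS := L2r_subset mO mS SO (L2r_jump oO Hw Hv im).
have LDS := L2r_subset mO mS SO (L2r_jump_dirb e oO bO Hw Hv im).
exact: (abs_decay_cvg e1 c0 l0 M0 LJS LDS poin).
Qed.

Lemma L2r_Vv im : L2r area (Omega : set (mplane R)) (fun x => cpart im (V x * v x)).
Proof.
have [[[Lv _] _] _ _ _ _] := TE; have [mV [K HK]] := LV.
have La k' := L2r_abs (L2_part k' mO Lv).
have LG := L2r_Z `|K| mO (L2r_D mO (La false) (La true)).
have mVv : measurable_fun (Omega : set (mplane R)) (fun x => cpart im (V x * v x)).
  by apply: measurable_cmul => //; case: Lv.
apply: (L2r_ae_le mO mVv LG).
apply: ae_area_mono HK => x H Ox; apply: cpart_mul_le.
by apply: le_trans (H Ox) _; exact: ler_norm.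
Qed.

Lemma probe_le tau x : S x -> `|probe e c m tau x| <= decay e tau x.
Proof.
move=> Sx; rewrite probeE// normrM ger0_norm ?bump_ge0// normrM ger0_norm ?expR_ge0//.
rewrite -[leRHS]mul1r; apply: ler_pM; rewrite ?bump_ge0 ?bump_le1 ?mulr_ge0 ?expR_ge0//.
by rewrite ler_piMr ?expR_ge0// ler_norml cos_geN1 cos_le1.
Qed.

Let split_identity (kk f j p : R) : kk != 0 -> f = - kk * (p + j) -> p = - kk^-1 * f - j.
Proof. by move=> kn ->; field. Qed.

Let mulrBl_scale (a f j x : R) : (a * f - j) * x = a * (f * x) - j * x.
Proof. by ring. Qed.

Lemma corner_limit im (tau : nat -> R) : (forall n, 0 < tau n) ->
  tau n @[n --> \oo] --> +oo ->
  tau n ^+ 2 * \int[area]_(x in S) (cpart im (V x * v x) * probe e c m (tau n) x) @[n --> \oo] --> (0 : R).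
Proof.
move=> tau0 htau.
have [[Hv Hw] _ lw lv [[g tw tv] nwv]] := TE.
have [mV [K0 HK0]] := LV; pose K := `|K0|.
have HK : {ae area, forall x, Omega x -> Normc.normc (V x) <= K}.
  by apply: ae_area_mono HK0 => x H Ox; apply: le_trans (H Ox) _; exact: ler_norm.
set fw := (fun x => - _) in lw; set fv := (fun x => - _) in lv.
pose F x := cpart im (fw x) - cpart im (fv x).
pose J x := cpart im ((1 + V x) * (w x - v x)).
pose P x := cpart im (V x * v x).
(* Subtracting the equations gives fw - fv = - k^2 (V v + (1 + V) (w - v)), solved here for V v. *)
have PE x : P x = - (k ^+ 2)^-1 * F x - J x.
  apply: split_identity; first by rewrite expf_neq0// gt_eqF.
  rewrite /F /P /J /fw /fv -cpartB -cpartD.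
  have -> : - ((k ^+ 2)%:C * (1 + V x) * w x) - - ((k ^+ 2)%:C * v x) =
      - ((V x * v x + (1 + V x) * (w x - v x)) * (k ^+ 2)%:C) by ring.
  by rewrite cpartN cpart_mulr mulNr mulrC.
have Lw := Hw.1; have Lv := Hv.1.
have LF : L2r area S F.
  exact: (L2r_subset mO mS SO (L2r_B mO (L2_part im mO lw.1) (L2_part im mO lv.1))).
have LP : L2r area S P := L2r_subset mO mS SO (L2r_Vv im).
have L2F := L2r_Z (- (k ^+ 2)^-1) mS LF.
have LJ : L2r area S J.
  have -> : J = (fun x => - (k ^+ 2)^-1 * F x - P x) by apply/funext => x; rewrite PE; ring.
  exact: L2r_B.
have Sfin : (area S < +oo)%E by rewrite area_cone_rect// ltry.
pose X n := probe e c m (tau n).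
have sX n : smooth (X n) := elem_smooth (elem_probe e c m (tau n)).
have LX n : L2r area S (X n) := L2r_subset mO mS SO (smooth_L2r oO bO (sX n)).
have LW n : L2r area S (decay e (tau n)).
  apply: (@L2r_bounded _ _ _ _ _ _ 1) => //.
    by apply: continuous_measurable_plane => //; exact: continuous_decay.
  by move=> x Sx; rewrite ger0_norm ?expR_ge0// (decay_le1 c0 (ltW (tau0 n)) Sx).
have La k' := L2r_abs (L2r_subset mO mS SO (L2r_jump oO Hw Hv k')).
have IFX n := L2r_mul mS L2F (LX n); have IJX n := L2r_mul mS LJ (LX n).
have IJW n := L2r_mul mS (L2r_abs LJ) (LW n).
have Ia k' n := L2r_mul mS (La k') (LW n).
have intE n : \int[area]_(x in S) (P x * X n x) =
    - (k ^+ 2)^-1 * \int[area]_(x in S) (F x * X n x) - \int[area]_(x in S) (J x * X n x).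
  rewrite -RintegralZl//; last exact: (L2r_mul mS LF (LX n)).
  have IFX' : area.-integrable S (EFin \o (fun x => - (k ^+ 2)^-1 * (F x * X n x))).
    by have := IFX n; under eq_fun do rewrite -mulrA.
  rewrite -(RintegralB mS IFX' (IJX n)); apply: eq_Rintegral => x _.
  rewrite PE; exact: mulrBl_scale.
have Jle : {ae area, forall x, S x -> `|J x| <= (1 + K) * (`|jump w v false x| + `|jump w v true x|)}.
  apply: ae_area_mono HK => x H Sx; rewrite /J /jump -!cpartB; apply: cpart_mul_le.
  by apply: le_trans (normcD_le _ _) _; rewrite Normc.normc1 lerD2l H//; exact: SO.
have JW n : `|\int[area]_(x in S) (J x * X n x)| <= (1 + K) *
    (\int[area]_(x in S) (`|jump w v false x| * decay e (tau n) x) +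
     \int[area]_(x in S) (`|jump w v true x| * decay e (tau n) x)).
  apply: le_trans (le_normr_Rintegral mS (IJX n)) _.
  rewrite -(RintegralD mS (Ia false n) (Ia true n)) -RintegralZl//; last exact: (integrableD mS (Ia false n) (Ia true n)).
  apply: (integrable_ae_le mS _ _ _ _ _).2.
  - apply: measurableT_comp => //; apply/measurable_EFinP; exact: (measurable_int area (IJX n)).
  - exact: (integrableZl mS (1 + K) (integrableD mS (Ia false n) (Ia true n))).
  - by [].
  - move=> x _; apply: mulr_ge0; first by rewrite addr_ge0// /K.
    by apply: addr_ge0; apply: mulr_ge0 => //; exact: expR_ge0.
  apply: ae_area_mono Jle => x H Sx; rewrite normrM -mulrDl mulrA.
  by apply: ler_pM => //; [exact: H | exact: probe_le].
have c1 := jump_laplacian_cvg e1 c0 m0 h0 mr oO bO oU GammaE rU Ocone Hw Hv tw tv lw lv nwv im tau0 htau.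
have c2 := jump_decay_cvg false tau0 htau; have c3 := jump_decay_cvg true tau0 htau.
have c4 : tau n ^+ 2 * \int[area]_(x in S) (J x * X n x) @[n --> \oo] --> (0 : R).
  have := cvgMl_tmp (a := 1 + K) (cvgD c2 c3); rewrite addr0 mulr0 => c23.
  apply: norm_cvg0; apply: (@squeeze_cvgr _ _ _ _ (fun=> 0) (fun n => (1 + K) *
     (tau n ^+ 2 * \int[area]_(x in S) (`|jump w v false x| * decay e (tau n) x) +
      tau n ^+ 2 * \int[area]_(x in S) (`|jump w v true x| * decay e (tau n) x)))).
  - apply: nearW => n; rewrite normr_ge0/= normrM ger0_norm ?sqr_ge0// -mulrDr mulrCA.
    by rewrite ler_wpM2l ?sqr_ge0.
  - exact: cvg_cst.
  - exact: c23.
have := cvgB (cvgMl_tmp (a := - (k ^+ 2)^-1) c1) c4; rewrite mulr0 subr0 => H.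
rewrite (_ : (fun n => _) = (fun n => - (k ^+ 2)^-1 * (tau n ^+ 2 * \int[area]_(x in S) (F x * X n x)) -
   tau n ^+ 2 * \int[area]_(x in S) (J x * X n x))); first exact: H.
by apply/funext => n; rewrite -/(P _) intE; ring.
Qed.

End CornerLimit.

(** * The value at the corner *)

Section LimitValue.
Context {R : realType}.
Variables (e : plane R) (c m : R).
Hypothesis e1 : e.1 ^+ 2 + e.2 ^+ 2 = 1.
Hypothesis c0 : 0 < c.
Hypothesis m0 : 0 < m.
Let l : R := 3 * m / c.
Let M : R := 3 * m.
Notation S := (cone_rect e c l M : set (mplane R)).

Let mS : measurable S := measurable_cone_rect e c l M.
Let l0 : 0 < l. Proof. by rewrite divr_gt0// mulr_gt0. Qed.
Let M0 : 0 < M. Proof. by rewrite mulr_gt0. Qed.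
Let Sfin : (area S < +oo)%E. Proof. by rewrite area_cone_rect// ltry. Qed.

(** A linear bound suffices: an extra factor of height gains a power of tau under the
    exponential. *)
Lemma cutoff_defect y : 0 < y -> 0 <= 1 - cutoff m y <= y / m.
Proof.
move=> y0; rewrite subr_ge0 bump_le1/=; have [ym|ym] := leP y m.
  rewrite /cutoff bump1 ?subrr ?divr_ge0 ?(ltW y0) ?(ltW m0)//.
  by rewrite normrM normfV !gtr0_norm// mulrC ler_pdivrMr// mul1r.
apply: (@le_trans _ _ 1); first by rewrite gerBl bump_ge0.
by rewrite ler_pdivlMr// mul1r ltW.
Qed.

Variable tau : nat -> R.
Hypothesis tau0 : forall n, 0 < tau n.
Hypothesis htau : tau n @[n --> \oo] --> +oo.

Let W n := decay e (tau n).
Let X n := probe e c m (tau n).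

Lemma L2r_decay n : L2r area S (decay e (tau n)).
Proof.
apply: (@L2r_bounded _ _ _ _ _ _ 1) => //.
  by apply: continuous_measurable_plane => //; exact: continuous_decay.
by move=> x Sx; rewrite ger0_norm ?expR_ge0// (decay_le1 c0 (ltW (tau0 n)) Sx).
Qed.

Lemma continuous_probe n : continuous (probe e c m (tau n)).
Proof. exact: elem_continuous (elem_probe e c m (tau n)). Qed.

Lemma L2r_probe n : L2r area S (probe e c m (tau n)).
Proof.
apply: (@L2r_bounded _ _ _ _ _ _ 1) => //.
  by apply: continuous_measurable_plane => //; exact: continuous_probe.
by move=> x Sx; apply: le_trans (probe_le c0 m0 (tau n) Sx) _; exact: (decay_le1 c0 (ltW (tau0 n)) Sx).
Qed.

Lemma invtau_cvg : (tau n)^-1 @[n --> \oo] --> (0 : R).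
Proof. by apply/gtr0_cvgV0 => //; exact: nearW. Qed.

(** By [cutoff_defect] the truncation changes the integral by O(tau^(-3)), so the limit is that of
    the untruncated exponential. *)
Lemma integral_probe_cvg :
  tau n ^+ 2 * \int[area]_(x in S) probe e c m (tau n) x @[n --> \oo] --> 2 * c / (1 + c ^+ 2).
Proof.
have H1 := integral_decay_cos_cvg e1 c0 l0 M0 tau0 htau.
pose Y n x := decay e (tau n) x * cos (tau n * tc e x).
have cY n : continuous (Y n).
  move=> x; apply: cvgM; first exact: continuous_decay.
  apply: (@continuous_comp _ _ _ (fun x => tau n * tc e x) cos); last exact: continuous_cos.
  by apply: cvgMl_tmp; exact: continuous_tc.
have IY n := continuous_integrable_cone l M e1 c0 (cY n).
have IX n := continuous_integrable_cone l M e1 c0 (@continuous_probe n).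
have cHW n : continuous (fun x => height e x * decay e (tau n) x).
  by move=> x; apply: cvgM; [exact: continuous_dotr | exact: continuous_decay].
have IHW n := continuous_integrable_cone l M e1 c0 (cHW n).
have D n : `|\int[area]_(x in S) Y n x - \int[area]_(x in S) probe e c m (tau n) x| <= m^-1 * (16 / (c * tau n ^+ 3)).
  rewrite -(RintegralB mS (IY n) (IX n)).
  apply: le_trans (le_normr_Rintegral mS (integrableB mS (IY n) (IX n))) _.
  apply: (@le_trans _ _ (\int[area]_(x in S) (m^-1 * (height e x * decay e (tau n) x)))).
    apply: le_Rintegral => //.
    - exact: (integrable_norm (integrableB mS (IY n) (IX n))).
    - exact: (integrableZl mS m^-1 (IHW n)).
    move=> x Sx; rewrite /Y probeE//; have [y0 _] := cone_rect_height c0 Sx.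
    have /andP[h1 h2] := cutoff_defect y0.
    rewrite -[X in X - _]mul1r -mulrBl normrM ger0_norm// mulrA; apply: ler_pM => //.
      by rewrite mulrC.
    by rewrite normrM (ger0_norm (expR_ge0 _)) ler_piMr ?expR_ge0// ler_norml cos_geN1 cos_le1.
  rewrite RintegralZl// ler_wpM2l ?invr_ge0 ?(ltW m0)//.
  by rewrite -lee_fin -EFin_Rintegral// integral_height_decay.
have E : tau n ^+ 2 * (\int[area]_(x in S) Y n x - \int[area]_(x in S) probe e c m (tau n) x) @[n --> \oo] --> (0 : R).
  apply: norm_cvg0; apply: (@squeeze_cvgr _ _ _ _ (fun=> 0) (fun n => (16 / (m * c)) * (tau n)^-1)).
  - apply: nearW => n; rewrite normr_ge0/= normrM ger0_norm ?sqr_ge0//.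
    apply: (@le_trans _ _ (tau n ^+ 2 * (m^-1 * (16 / (c * tau n ^+ 3))))).
      by rewrite ler_wpM2l ?sqr_ge0.
    have t0 := tau0 n; rewrite le_eqVlt; apply/orP; left; apply/eqP; field.
    by rewrite !gt_eqF.
  - exact: cvg_cst.
  - by rewrite -[X in _ --> X](mulr0 (16 / (m * c))); apply: cvgMl_tmp; exact: invtau_cvg.
have := cvgB H1 E; rewrite subr0 => H.
rewrite (_ : (fun n => _) = (fun n => tau n ^+ 2 * \int[area]_(x in S) Y n x -
  tau n ^+ 2 * (\int[area]_(x in S) Y n x - \int[area]_(x in S) probe e c m (tau n) x))); first exact: H.
by apply/funext => n; rewrite mulrBr opprB addrC subrK.
Qed.

Variable P : plane R -> R.
Hypothesis LP : L2r area S P.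
Hypothesis HP : tau n ^+ 2 * \int[area]_(x in S) (P x * probe e c m (tau n) x) @[n --> \oo] --> (0 : R).

(** Here the nonzero limit kap is used: t I is at least kap / 2, and p is recovered from p I = A - B
    by division. *)
Let ratio_bound (p I A B B' t N kap eps : R) : 0 <= t -> 0 < kap -> 0 <= eps -> 0 <= N ->
  p * I = A - B -> `|B| <= B' -> `|0 - t * A| <= eps * kap / 4 ->
  t * B' <= eps * kap / 4 * (1 + N) -> `|kap - t * I| <= kap / 2 -> `|p| <= eps * (1 + N).
Proof.
move=> t0 kap0 eps0 N0 pI BB' hA hB hI; set d := eps * kap / 4 in hA hB *.
have d0 : 0 <= d by rewrite divr_ge0// mulr_ge0// ltW.
have tI : kap / 2 <= t * I by move: hI; rewrite ler_distl => /andP[_]; lra.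
have tI0 : 0 <= t * I by apply: le_trans tI; rewrite divr_ge0// ltW.
rewrite sub0r normrN in hA.
have h1 : `|p| * (t * I) <= d + d * (1 + N).
  rewrite -[X in _ * X]ger0_norm// -normrM mulrCA pI mulrBr.
  apply: le_trans (ler_normB _ _) _; apply: lerD => //.
  by rewrite normrM ger0_norm//; apply: le_trans hB; rewrite ler_wpM2l.
have h2 : `|p| * (kap / 2) <= `|p| * (t * I) by rewrite ler_wpM2l.
have h3 : `|p| * (kap / 2) <= eps * (1 + N) * (kap / 2).
  apply: le_trans h2 (le_trans h1 _).
  have -> : eps * (1 + N) * (kap / 2) = 2 * d * (1 + N) by rewrite /d; field.
  by have := mulr_ge0 d0 N0; lra.
by rewrite ler_pM2r ?divr_gt0 in h3.
Qed.

(* The factor 1 + N n lets the error depend on the unknown value p n itself. *)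
Lemma limit_value (p N : nat -> R) : (forall n, 0 <= N n) ->
  (forall eps, 0 < eps -> \forall n \near \oo,
    tau n ^+ 2 * \int[area]_(x in S) (`|P x - p n| * decay e (tau n) x) <= eps * (1 + N n)) ->
  forall eps, 0 < eps -> \forall n \near \oo, `|p n| <= eps * (1 + N n).
Proof.
move=> N0 H eps eps0; pose kap := 2 * c / (1 + c ^+ 2).
have kap0 : 0 < kap by rewrite divr_gt0 ?mulr_gt0// ltr_pwDl// sqr_ge0.
pose d := eps * kap / 4; have d0 : 0 < d by rewrite divr_gt0// mulr_gt0.
have k2 : 0 < kap / 2 by rewrite divr_gt0.
have /cvgrPdist_le/(_ _ k2) K := integral_probe_cvg.
have /cvgrPdist_le/(_ _ d0) HP' := HP.
have Hd := H d d0.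
near=> n.
have B1 : `|0 - tau n ^+ 2 * \int[area]_(x in S) (P x * X n x)| <= d by near: n.
have B2 : tau n ^+ 2 * \int[area]_(x in S) (`|P x - p n| * W n x) <= d * (1 + N n) by near: n.
have B3 : `|kap - tau n ^+ 2 * \int[area]_(x in S) X n x| <= kap / 2 by near: n.
have LC : L2r area S (cst (p n)).
  by apply: (@L2r_bounded _ _ _ _ _ _ `|p n|).
have LPp : L2r area S (fun x => P x - p n) by exact: (L2r_B mS LP LC).
have I1 := L2r_mul mS LP (L2r_probe n).
have I2 := L2r_mul mS LPp (L2r_probe n).
have I3 := L2r_mul mS (L2r_abs LPp) (L2r_decay n).
have IX := L2r_integrable mS Sfin (L2r_probe n).
have pX : p n * \int[area]_(x in S) X n x = \int[area]_(x in S) (P x * X n x) -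
    \int[area]_(x in S) ((P x - p n) * X n x).
  rewrite -(RintegralZl (p n) mS IX) -(RintegralB mS I1 I2); apply: eq_Rintegral => x _.
  by rewrite mulrBl opprB addrC subrK.
have B4 : `|\int[area]_(x in S) ((P x - p n) * X n x)| <= \int[area]_(x in S) (`|P x - p n| * W n x).
  apply: le_trans (le_normr_Rintegral mS I2) _; apply: le_Rintegral => //.
    exact: (integrable_norm I2).
  by move=> x Sx; rewrite normrM ler_wpM2l// (probe_le c0 m0 (tau n) Sx).
exact: (ratio_bound (sqr_ge0 (tau n)) kap0 (ltW eps0) (N0 n) pX B4 B1 B2 B3).
Unshelve. all: by end_near.
Qed.

End LimitValue.

Section AffineErrors.
Context {R : realType}.
Variables (e : plane R) (c l M : R).
Hypothesis e1 : e.1 ^+ 2 + e.2 ^+ 2 = 1.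
Hypothesis c0 : 0 < c.
Hypothesis l0 : 0 < l.
Hypothesis M0 : 0 < M.
Notation S := (cone_rect e c l M : set (mplane R)).

Let mS : measurable S := measurable_cone_rect e c l M.

(** Against the exponential, a constant has integral O(tau^(-2)) and the height O(tau^(-3)). A
    modulus of continuity in affine form thus leaves only its constant part in the limit. *)
Lemma decay_affine (g : plane R -> R) (a b tau : R) : measurable_fun S g -> 0 < tau -> 0 <= a -> 0 <= b ->
  {ae area, forall x, S x -> `|g x| <= a + b * height e x} ->
  area.-integrable S (EFin \o (fun x => `|g x| * decay e tau x)) /\
  tau ^+ 2 * \int[area]_(x in S) (`|g x| * decay e tau x) <= 2 * a / c + 16 * b / (c * tau).
Proof.
move=> mg tau0 a0 b0 gab.
have cW : continuous (decay e tau) by exact: continuous_decay.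
have cHW : continuous (fun x => height e x * decay e tau x).
  by move=> x; apply: cvgM; [exact: continuous_dotr | exact: cW].
have IW := continuous_integrable_cone l M e1 c0 cW.
have IHW := continuous_integrable_cone l M e1 c0 cHW.
have Ia := integrableZl mS a IW; have Ib := integrableZl mS b IHW.
have Iab : area.-integrable S (EFin \o (fun x => a * decay e tau x + b * (height e x * decay e tau x))).
  exact: (integrableD mS Ia Ib).
have ae : {ae area, forall x, S x -> `|g x| * decay e tau x <= a * decay e tau x + b * (height e x * decay e tau x)}.
  apply: ae_area_mono gab => x H Sx; rewrite (mulrA b) -mulrDl ler_wpM2r ?expR_ge0//; exact: H.
have [ig le1] := @integrable_ae_le _ _ _ area S (fun x => `|g x| * decay e tau x) _ mS
  (measurable_funM (measurableT_comp (@normr_measurable R setT) mg) (continuous_measurable_plane cW mS)) Iab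
  (fun x _ => mulr_ge0 (normr_ge0 _) (expR_ge0 _)) (fun x Sx => addr_ge0 (mulr_ge0 a0 (expR_ge0 _))
     (mulr_ge0 b0 (mulr_ge0 (ltW (cone_rect_height c0 Sx).1) (expR_ge0 _)))) ae.
split; first exact: ig.
have B1 : \int[area]_(x in S) decay e tau x <= 2 / (c * tau ^+ 2).
  by rewrite -lee_fin -EFin_Rintegral// integral_decay.
have B2 : \int[area]_(x in S) (height e x * decay e tau x) <= 16 / (c * tau ^+ 3).
  by rewrite -lee_fin -EFin_Rintegral// integral_height_decay.
have E := RintegralD mS Ia Ib; rewrite (RintegralZl a mS IW) (RintegralZl b mS IHW) in E.
have le2 : tau ^+ 2 * \int[area]_(x in S) (`|g x| * decay e tau x) <=
    tau ^+ 2 * (a * (2 / (c * tau ^+ 2)) + b * (16 / (c * tau ^+ 3))).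
  rewrite ler_wpM2l ?sqr_ge0//; apply: le_trans le1 _; rewrite [leLHS]E.
  by apply: lerD; rewrite ler_wpM2l.
apply: le_trans le2 _; rewrite le_eqVlt; apply/orP; left; apply/eqP; field.
by rewrite !gt_eqF.
Qed.

Lemma cone_rect_cbox_height x : S x -> cbox ((1 + c^-1) * height e x) x.
Proof.
move=> /(cone_rect_height c0)[y0 [_ tx]].
have -> : (1 + c^-1) * height e x = height e x / c + height e x by ring.
by apply: (frame_cbox e1) => //; rewrite gtr0_norm.
Qed.

(** Beyond distance rho from the corner, the bound K is itself at most a multiple of the height,
    since on the cone the height controls both coordinates. *)
Lemma affine_of_small (f : plane R -> R) (K : R) : 0 <= K ->
  (forall d, 0 < d -> exists2 rho, 0 < rho & forall x, S x -> cbox rho x -> f x <= d) ->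
  forall d, 0 < d -> exists2 b, 0 <= b & forall x, S x -> f x <= K -> f x <= d + b * height e x.
Proof.
move=> K0 H d d0; have [rho rho0 Hrho] := H d d0.
have c1 : 0 < 1 + c^-1 by rewrite addr_gt0// invr_gt0.
exists (K * (1 + c^-1) / rho); first by rewrite divr_ge0 ?mulr_ge0// ltW.
move=> x Sx fK; have [y0 _] := cone_rect_height c0 Sx.
have b0 : 0 <= K * (1 + c^-1) / rho * height e x.
  by rewrite mulr_ge0 ?(ltW y0)// divr_ge0 ?(ltW rho0)// mulr_ge0// ltW.
have [small|big] := leP ((1 + c^-1) * height e x) rho.
  apply: (@le_trans _ _ d); last by rewrite lerDl.
  apply: Hrho => //; exact: cbox_mono small _ (cone_rect_cbox_height Sx).
apply: le_trans fK _; apply: (@le_trans _ _ (K * (1 + c^-1) / rho * height e x)); last by rewrite lerDr ltW.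
have -> : K * (1 + c^-1) / rho * height e x = K * ((1 + c^-1) * height e x / rho) by ring.
by rewrite ler_peMr// ler_pdivlMr// mul1r ltW.
Qed.

End AffineErrors.

Section CornerValue.
Context {R : realType}.
Variables (e : plane R) (c m : R).
Hypothesis e1 : e.1 ^+ 2 + e.2 ^+ 2 = 1.
Hypothesis c0 : 0 < c.
Hypothesis m0 : 0 < m.
Let l : R := 3 * m / c.
Let M : R := 3 * m.
Notation S := (cone_rect e c l M : set (mplane R)).

Let mS : measurable S := measurable_cone_rect e c l M.
Let l0 : 0 < l. Proof. by rewrite divr_gt0// mulr_gt0. Qed.
Let M0 : 0 < M. Proof. by rewrite mulr_gt0. Qed.

Variables (D : set (plane R)) (V v Q : plane R -> R[i]) (K : R).
Hypothesis SD : S `<=` D.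
Hypothesis D0 : closure D 0.
Hypothesis rQ : continuous_rep D (fun x => 1 + V x) Q.
Hypothesis K0 : 0 <= K.
Hypothesis VK : {ae area, forall x, S x -> Normc.normc (V x) <= K}.
Hypothesis LP : forall im, L2r area S (fun x => cpart im (V x * v x)).
Hypothesis corner : forall im (tau : nat -> R), (forall n, 0 < tau n) ->
  tau n @[n --> \oo] --> +oo ->
  tau n ^+ 2 * \int[area]_(x in S) (cpart im (V x * v x) * probe e c m (tau n) x) @[n --> \oo] --> (0 : R).

Lemma normcN_eq (z : R[i]) : Normc.normc (- z) = Normc.normc z.
Proof. exact: (@normcN R z). Qed.

Lemma continuous_rep_small d : 0 < d ->
  exists2 rho, 0 < rho & forall x, D x -> cbox rho x -> Normc.normc (Q x - Q 0) <= d.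
Proof.
move=> d0; have [cRe cIm _] := rQ.
have d2 : 0 < d / 2 by rewrite divr_gt0.
have close im : \forall x \near (0 : plane R), closure D x -> `|cpart im (Q 0) - cpart im (Q x)| <= d / 2.
  have H : cpart im (Q x) @[x --> within (closure D) (nbhs (0 : plane R))] --> cpart im (Q 0).
    by case: im; [exact: ((subspace_continuousP _ _).1 cIm _ D0) | exact: ((subspace_continuousP _ _).1 cRe _ D0)].
  by move/cvgrPdist_le : H => /(_ _ d2).
have cl2 : nbhs (0 : plane R) [set x | (closure D x -> `|cpart false (Q 0) - cpart false (Q x)| <= d / 2) /\
    (closure D x -> `|cpart true (Q 0) - cpart true (Q x)| <= d / 2)].
  exact: filterI (close false) (close true).
have [eps /= eps0 H] := (nbhs_ballP _ _).1 cl2.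
exists (eps / 2); first by rewrite divr_gt0.
move=> x Dx /cboxP[x1 x2].
have [h1 h2] : (closure D x -> `|cpart false (Q 0) - cpart false (Q x)| <= d / 2) /\
     (closure D x -> `|cpart true (Q 0) - cpart true (Q x)| <= d / 2).
  apply: H; have h2 : eps / 2 < eps by rewrite gtr_pMr// invf_lt1 ?ltr1n.
  by split; rewrite /ball/= sub0r normrN; [exact: le_lt_trans x1 h2|exact: le_lt_trans x2 h2].
have cDx : closure D x by exact: subset_closure.
apply: le_trans (normc_le_parts _) _; rewrite !cpartB -[d](_ : d / 2 + d / 2 = d); last by rewrite -splitr.
by apply: lerD; rewrite distrC; [exact: h1|exact: h2].
Qed.

(** [Q 0 - 1] stands for V(0): V is known almost everywhere, and only its continuous representative
    has a value at the corner. Away from the corner the essential bound K on V takes over. *)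
Lemma Q_affine d : 0 < d -> exists2 b, 0 <= b &
  {ae area, forall x, S x -> Normc.normc (V x - (Q 0 - 1)) <= d + b * height e x}.
Proof.
move=> d0; have [_ _ VQ] := rQ.
have small d' : 0 < d' -> exists2 rho, 0 < rho & forall x, S x -> cbox rho x -> Normc.normc (Q x - Q 0) <= d'.
  by move=> /continuous_rep_small[rho rho0 H]; exists rho => // x /SD; exact: H.
have B0 : 0 <= 1 + K + Normc.normc (Q 0) by rewrite !addr_ge0// normc_ge0.
have [b b0 H] := affine_of_small e1 c0 B0 small d0.
exists b => //; apply: ae_area_mono (ae_area_and VQ VK) => x [xQ xK] Sx.
have QE : Q x = 1 + V x by rewrite -xQ//; exact: SD.
have -> : V x - (Q 0 - 1) = Q x - Q 0 by rewrite QE; ring.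
apply: H => //; apply: le_trans (normcD_le _ _) _; rewrite normcN_eq lerD2r QE.
by apply: le_trans (normcD_le _ _) _; rewrite Normc.normc1 lerD2l xK.
Qed.

Lemma hoelder_affine alpha (v0 : plane R -> R[i]) (r : R) : 0 < alpha -> 0 <= r -> S `<=` cbox r ->
  hoelder_on alpha (closure D) v0 ->
  exists2 C, 0 <= C & (forall x, S x -> Normc.normc (v0 x) <= C) /\
  forall d, 0 < d -> exists2 b, 0 <= b &
    forall x, S x -> Normc.normc (v0 x - v0 0) <= d + b * height e x.
Proof.
move=> al0 r0 Sr [H0 HH].
have cS x : S x -> closure D x by move=> Sx; apply: subset_closure; exact: SD.
have bnd x : S x -> Normc.normc (v0 x - v0 0) <= `|H0| * (enorm x `^ alpha).
  move=> Sx; have := HH x 0 (cS _ Sx) D0; rewrite subr0 => /le_trans; apply.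
  by rewrite ler_wpM2r ?powR_ge0// ler_norm.
have en0 (x : plane R) : 0 <= enorm x by exact: sqrtr_ge0.
pose C1 := `|H0| * ((2 * r) `^ alpha).
have C10 : 0 <= C1 by rewrite mulr_ge0// powR_ge0.
have bnd1 x : S x -> Normc.normc (v0 x - v0 0) <= C1.
  move=> Sx; apply: le_trans (bnd x Sx) _; rewrite ler_wpM2l// ge0_ler_powR ?(ltW al0)//.
  - by rewrite nnegrE.
  - by rewrite nnegrE mulr_ge0.
  - by apply: enorm_le_cbox; exact: Sr.
exists (Normc.normc (v0 0) + C1); first by rewrite addr_ge0// normc_ge0.
split=> [x Sx|].
  rewrite -[v0 x](subrK (v0 0)) addrC; apply: le_trans (normcD_le _ _) _.
  by rewrite lerD2l bnd1.
have small d : 0 < d -> exists2 rho, 0 < rho & forall x, S x -> cbox rho x -> Normc.normc (v0 x - v0 0) <= d.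
  move=> d0; have q0 : 0 < d / (`|H0| + 1) by rewrite divr_gt0// ltr_wpDl.
  (* The radius solves (|H0| + 1) (2 rho)^alpha = d: the factor 2 passes from the box to the
     Euclidean norm, and the 1 covers H0 = 0. *)
  exists ((d / (`|H0| + 1)) `^ alpha^-1 / 2); first by rewrite divr_gt0// powR_gt0.
  move=> x Sx /enorm_le_cbox; rewrite mulrC divfK// => ex.
  apply: le_trans (bnd x Sx) _; apply: (@le_trans _ _ (`|H0| * (d / (`|H0| + 1)))).
    rewrite ler_wpM2l//; apply: (@le_trans _ _ (((d / (`|H0| + 1)) `^ alpha^-1) `^ alpha)).
      by rewrite ge0_ler_powR ?(ltW al0)// nnegrE// powR_ge0.
    by rewrite -powRrM mulVf ?gt_eqF// powRr1// ltW.
  by rewrite mulrCA ler_piMr ?(ltW d0)// ler_pdivrMr ?ltr_wpDl// mul1r lerDl.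
move=> d d0; have [b b0 H] := affine_of_small e1 c0 C10 small d0.
by exists b => // x Sx; apply: H => //; exact: bnd1.
Qed.

Let affine_prod (nV nv q nd d C b1 b2 y : R) : 0 <= d -> 0 <= C -> 0 <= q -> 0 <= nV -> 0 <= nv ->
  0 <= b1 -> 0 <= y -> nV <= d / (C + 1) + b1 * y -> nv <= C -> nd <= d / (q + 1) + b2 * y ->
  nV * nv + q * nd <= 2 * d + (b1 * C + q * b2) * y.
Proof.
move=> d0 C0 q0 V0 v0 b10 y0 hV hv hd.
have f (t : R) : 0 <= t -> d / (t + 1) * t <= d.
  by move=> t0; rewrite mulrAC ler_pdivrMr ?ltr_wpDl// ler_wpM2l// lerDl.
have h1 : nV * nv <= (d / (C + 1) + b1 * y) * C by exact: ler_pM.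
have h2 : q * nd <= q * (d / (q + 1) + b2 * y) by rewrite ler_wpM2l.
have := f C C0; have := f q q0; move: h1 h2; rewrite !mulrDl !mulrDr.
set a1 := d / _; set a2 := d / _ => h1 h2 h3 h4; lra.
Qed.

Let eps_split (cc eps b t : R) : 0 < cc -> 0 < eps -> 0 <= b -> 0 < t ->
  `|0 - t^-1| <= cc * eps / (32 * (b + 1)) ->
  2 * (2 * (eps * cc / 8)) / cc + 16 * b / (cc * t) <= eps.
Proof.
move=> cc0 eps0 b0 t0; rewrite sub0r normrN gtr0_norm ?invr_gt0// => ti.
have -> : 2 * (2 * (eps * cc / 8)) / cc = eps / 2 by field; rewrite gt_eqF.
have -> : 16 * b / (cc * t) = 16 * b / cc * t^-1 by rewrite invfM mulrA.
have h : 16 * b / cc * t^-1 <= 16 * b / cc * (cc * eps / (32 * (b + 1))).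
  by rewrite ler_wpM2l// divr_ge0 ?mulr_ge0// ltW.
rewrite [leRHS](splitr eps) lerD2l; apply: le_trans h _.
have b1 : 0 < b + 1 by rewrite ltr_wpDl.
have -> : 16 * b / cc * (cc * eps / (32 * (b + 1))) = eps / 2 * (b / (b + 1)).
  by field; rewrite !gt_eqF.
by rewrite ler_piMr ?divr_ge0 ?(ltW eps0)// ler_pdivrMr// mul1r lerDl.
Qed.

Lemma hoelder_corner_value alpha (v0 : plane R -> R[i]) (r : R) : 0 < alpha -> 0 <= r -> S `<=` cbox r ->
  hoelder_on alpha (closure D) v0 -> ae_eq_on D v v0 -> Q 0 <> 1 -> v0 0 = 0.
Proof.
move=> al0 r0 Sr Hv0 vv0 Q1.
have [C C0 [vC vaff]] := hoelder_affine al0 r0 Sr Hv0.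
pose tau (n : nat) : R := n.+1%:R.
have tau0 n : 0 < tau n by rewrite ltr0Sn.
have htau : tau n @[n --> \oo] --> +oo.
  by have := @cvgr_idn R; rewrite -(cvg_shiftS (fun n : nat => n%:R : R)).
(* The value of V v at the corner. It does not depend on n, so [limit_value] applies with N = 0. *)
pose z0 := (Q 0 - 1) * v0 0.
have p0 im : cpart im z0 = 0.
  have H eps : 0 < eps -> \forall n \near \oo,
      tau n ^+ 2 * \int[area]_(x in S) (`|cpart im (V x * v x) - cpart im z0| * decay e (tau n) x) <= eps * (1 + 0).
    move=> eps0.
    have q0 : 0 <= Normc.normc (Q 0 - 1) by exact: normc_ge0.
    set q := Normc.normc (Q 0 - 1) in q0.
    (* The constant part 2 d of the affine bound costs 4 d / c = eps / 2; the linear part takes the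
       other half for large n. *)
    pose d := eps * c / 8; have d0 : 0 < d by rewrite divr_gt0// mulr_gt0.
    have dC : 0 < d / (C + 1) by rewrite divr_gt0// ltr_wpDl.
    have dq : 0 < d / (q + 1) by rewrite divr_gt0// ltr_wpDl.
    have [b1 b10 A1] := Q_affine dC; have [b2 b20 A2] := vaff _ dq.
    have mg : measurable_fun S (fun x => cpart im (V x * v x) - cpart im z0).
      by apply: measurable_funB => //; case: (LP im).
    pose b := b1 * C + q * b2.
    have b0 : 0 <= b by rewrite addr_ge0// mulr_ge0.
    have ae : {ae area, forall x, S x -> `|cpart im (V x * v x) - cpart im z0| <= 2 * d + b * height e x}.
      apply: ae_area_mono (ae_area_and A1 vv0) => x [xA1 xv] Sx.
      rewrite -cpartB; apply: le_trans (cpart_le_normc _ _) _.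
      rewrite xv; last exact: SD.
      have -> : V x * v0 x - z0 = (V x - (Q 0 - 1)) * v0 x + (Q 0 - 1) * (v0 x - v0 0) by rewrite /z0; ring.
      apply: le_trans (normcD_le _ _) _; rewrite !Normc.normcM -/q.
      have y0 := (cone_rect_height c0 Sx).1.
      exact: (affine_prod (ltW d0) C0 q0 (normc_ge0 _) (normc_ge0 _) b10 (ltW y0) (xA1 Sx) (vC x Sx) (A2 x Sx)).
    have e2 : 0 < c * eps / (32 * (b + 1)).
      by rewrite divr_gt0 ?mulr_gt0// ltr_wpDl.
    have /cvgrPdist_le/(_ _ e2) inv := invtau_cvg tau0 htau.
    near=> n.
    have [_ le1] := decay_affine e1 c0 l0 M0 mg (tau0 n) (mulr_ge0 (ler0n _ 2) (ltW d0)) b0 ae.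
    apply: le_trans le1 _; rewrite addr0 mulr1.
    have ti : `|0 - (tau n)^-1| <= c * eps / (32 * (b + 1)) by near: n.
    exact: eps_split c0 eps0 b0 (tau0 n) ti.
  have lim := limit_value e1 c0 m0 tau0 htau (LP im) (corner im tau0 htau) (p := fun=> cpart im z0)
    (N := fun=> 0) (fun=> lexx 0) H.
  apply/eqP; rewrite -normr_eq0 eq_le normr_ge0 andbT.
  apply/ler_addgt0Pr => eps eps0; rewrite add0r.
  by have [n _ /(_ n (leqnn n))] := lim eps eps0; rewrite /= addr0 mulr1.
have /eqP : z0 = 0 by apply: cpart_eq => im; rewrite p0; case: im.
by rewrite mulf_eq0 subr_eq0 => /orP[/eqP//|/eqP].
Unshelve. all: by end_near.
Qed.

End CornerValue.

(** * Herglotz waves *)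

Section Herglotz.
Context {R : realType}.
Notation mu := (@lebesgue_measure R).
Notation T := (@period R).

Lemma lipschitz_of_derive (f f' : R -> R) (a b : R) :
  (forall x, is_derive x (1 : R) f (f' x)) -> (forall x, `|f' x| <= 1) -> `|f a - f b| <= `|a - b|.
Proof.
move=> Df f1; wlog ab : a b / a <= b.
  by move=> H; case: (leP a b) => [/H//|/ltW/H]; rewrite distrC (distrC b).
move: ab; rewrite le_eqVlt => /orP[/eqP ->|ab]; first by rewrite !subrr normr0.
have cf : {within `[a, b], continuous f}.
  by apply: continuous_subspaceT; exact: is_derive1_continuous Df.
have [x _ E] := MVT ab (fun x _ => Df x) cf.
by rewrite distrC E normrM distrC ler_piMl.
Qed.

Lemma cos_lipschitz (a b : R) : `|cos a - cos b| <= `|a - b|.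
Proof.
apply: (@lipschitz_of_derive cos (fun x => - sin x)) => x.
by rewrite normrN ler_norml sin_geN1 sin_le1.
Qed.

Lemma sin_lipschitz (a b : R) : `|sin a - sin b| <= `|a - b|.
Proof.
apply: (@lipschitz_of_derive sin cos) => x.
by rewrite ler_norml cos_geN1 cos_le1.
Qed.

Lemma measurable_period : measurable T.
Proof. exact: measurable_itv. Qed.

Lemma period_measure : mu T = (2 * pi)%:E.
Proof. by rewrite /period lebesgue_measure_itv/= lte_fin mulr_gt0 ?pi_gt0// oppr0 adde0. Qed.

Let Tfin : (mu T < +oo)%E. Proof. by rewrite period_measure ltry. Qed.

Variables (k : R) (g : plane R -> R[i]).
Hypothesis k0 : 0 < k.
Hypothesis Lg : L2_circle g.

Let G i (t : R) := cpart i (g (circle_pt t)).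
Let ph x (t : R) := k * dot (circle_pt t) x.

Lemma continuous_phase x : continuous (ph x).
Proof.
move=> t; apply: cvgMl_tmp; apply: cvgD; apply: cvgMr_tmp; [exact: continuous_cos|exact: continuous_sin].
Qed.

Lemma L2r_density i : L2r mu T (G i).
Proof. by have /(L2P _ _ measurable_period) := Lg; exact. Qed.

Lemma phase_integrable (f : R -> R) i x : continuous f -> (forall s, `|f s| <= 1) ->
  mu.-integrable T (EFin \o (fun t => G i t * f (ph x t))).
Proof.
move=> cf f1.
have mf : measurable_fun T (fun t => f (ph x t)).
  apply: measurable_funTS; apply: continuous_measurable_fun => t.
  by apply: continuous_comp; [exact: continuous_phase|exact: cf].
exact: (L2r_integrable measurable_period Tfin (L2r_mul_bounded measurable_period (L2r_density i) mf (fun t _ => f1 (ph x t)))).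
Qed.

Lemma phase_diff (x y : plane R) t : `|ph x t - ph y t| <= k * (`|x.1 - y.1| + `|x.2 - y.2|).
Proof.
rewrite -mulrBr normrM (gtr0_norm k0) ler_wpM2l ?(ltW k0)//.
have -> : dot (circle_pt t) x - dot (circle_pt t) y = cos t * (x.1 - y.1) + sin t * (x.2 - y.2).
  by rewrite /dot /circle_pt /=; ring.
apply: le_trans (ler_normD _ _) _; rewrite !normrM; apply: lerD.
  by rewrite ler_piMl// ler_norml cos_geN1 cos_le1.
by rewrite ler_piMl// ler_norml sin_geN1 sin_le1.
Qed.

(** Young's inequality |G| <= G^2 / (2 N) + N / 2, integrated over a period of length 2 pi. *)
Lemma density_norm_le i (N : R) : 0 < N -> (L2_circle_norm g <= N%:E)%E ->
  mu.-integrable T (EFin \o (fun t => `|G i t|)) /\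
  \int[mu]_(t in T) `|G i t| <= (1 + 2 * pi) / 2 * N.
Proof.
move=> N0 gN; have mT := measurable_period.
have s0 : (0 <= sqint mu T (g \o circle_pt))%E by apply: integral_ge0 => t _; rewrite lee_fin sqr_ge0.
have sN := poweR_half_le s0 (ltW N0) gN.
have IG2 := L2r_sq_integrable mT (L2r_density i).
have IG := L2r_integrable mT Tfin (L2r_abs (L2r_density i)).
split; first exact: IG.
have G2 : \int[mu]_(t in T) (G i t ^+ 2) <= N ^+ 2.
  rewrite -lee_fin -EFin_Rintegral//; apply: le_trans sN.
  apply: ge0_le_integralW => t _; first by rewrite lee_fin sqr_ge0.
  by rewrite lee_fin; apply: sqr_le_bound; exact: cpart_le_normc.
have Ic : mu.-integrable T (EFin \o cst (N / 2)).
  exact: (L2r_integrable mT Tfin (L2r_bounded mT Tfin (measurable_cst _) (fun t _ => lexx `|N / 2|))).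
have IZ : mu.-integrable T (EFin \o (fun t => (2 * N)^-1 * G i t ^+ 2)) by exact: (integrableZl mT (2 * N)^-1 IG2).
apply: (@le_trans _ _ (\int[mu]_(t in T) ((2 * N)^-1 * G i t ^+ 2 + cst (N / 2) t))).
  apply: le_Rintegral => //; first exact: (integrableD mT IZ Ic).
  move=> t _; rewrite -subr_ge0 /=.
  have -> : (2 * N)^-1 * G i t ^+ 2 + N / 2 - `|G i t| = (2 * N)^-1 * (`|G i t| - N) ^+ 2.
    by rewrite -[G i t ^+ 2]real_normK ?num_real//; field; rewrite gt_eqF.
  by rewrite mulr_ge0 ?sqr_ge0// invr_ge0 mulr_ge0// ltW.
rewrite (RintegralD mT IZ Ic) (RintegralZl _ mT IG2) Rintegral_cst// [fine _](_ : _ = 2 * pi); last first.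
  by rewrite -[LHS]/(fine (mu T)) period_measure.
apply: (@le_trans _ _ ((2 * N)^-1 * N ^+ 2 + N / 2 * (2 * pi))).
  by rewrite lerD2r ler_wpM2l// invr_ge0 mulr_ge0// ltW.
by rewrite le_eqVlt; apply/orP; left; apply/eqP; field; rewrite gt_eqF.
Qed.

(** cos and sin are 1-Lipschitz and the phase is k-Lipschitz in x, so the difference is bounded
    through the L^1 norm of the density. Each part of the wave is a sum of two such integrals. *)
Lemma herglotz_lipschitz im (x y : plane R) (N : R) : 0 < N -> (L2_circle_norm g <= N%:E)%E ->
  `|cpart im (herglotz k g x) - cpart im (herglotz k g y)| <=
   k * (1 + 2 * pi) * N * (`|x.1 - y.1| + `|x.2 - y.2|).
Proof.
move=> N0 gN; have mT := measurable_period.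
have cos1 (s : R) : `|cos s| <= 1 by rewrite ler_norml cos_geN1 cos_le1.
have sin1 (s : R) : `|sin s| <= 1 by rewrite ler_norml sin_geN1 sin_le1.
have IC i z := phase_integrable i z (@continuous_cos R) cos1.
have IS i z := phase_integrable i z (@continuous_sin R) sin1.
pose DD := k * (`|x.1 - y.1| + `|x.2 - y.2|).
have DD0 : 0 <= DD by rewrite mulr_ge0 ?(ltW k0)// addr_ge0.
have hE z : cpart im (herglotz k g z) = if im then
   \int[mu]_(t in T) (G true t * cos (ph z t)) + \int[mu]_(t in T) (G false t * sin (ph z t)) else
   \int[mu]_(t in T) (G false t * cos (ph z t)) - \int[mu]_(t in T) (G true t * sin (ph z t)).
  rewrite /herglotz cpart_integral; case: im.
    rewrite [RHS]/= -(RintegralD mT (IC true z) (IS false z)); apply: eq_Rintegral => t _.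
    by rewrite (cpart_mul true) /= mulrC [X in _ + X]mulrC.
  rewrite [RHS]/= -(RintegralB mT (IC false z) (IS true z)); apply: eq_Rintegral => t _.
  by rewrite (cpart_mul false) /= mulrC [X in _ - X]mulrC.
have B i (f : R -> R) : continuous f -> (forall s, `|f s| <= 1) -> (forall a b, `|f a - f b| <= `|a - b|) ->
    `|\int[mu]_(t in T) (G i t * f (ph x t)) - \int[mu]_(t in T) (G i t * f (ph y t))| <= DD * ((1 + 2 * pi) / 2 * N).
  move=> cf f1 fl; have [I1 I2] := (phase_integrable i x cf f1, phase_integrable i y cf f1).
  have [IG GN] := density_norm_le i N0 gN.
  rewrite -(RintegralB mT I1 I2).
  apply: le_trans (le_normr_Rintegral mT (integrableB mT I1 I2)) _.
  apply: (@le_trans _ _ (\int[mu]_(t in T) (DD * `|G i t|))).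
    apply: le_Rintegral => //.
    - exact: (integrable_norm (integrableB mT I1 I2)).
    - exact: (integrableZl mT DD IG).
    - move=> t _; rewrite -mulrBr normrM mulrC ler_wpM2r//.
      by apply: le_trans (fl _ _) _; exact: phase_diff.
  by rewrite (RintegralZl _ mT IG) ler_wpM2l.
have -> : k * (1 + 2 * pi) * N * (`|x.1 - y.1| + `|x.2 - y.2|) =
    DD * ((1 + 2 * pi) / 2 * N) + DD * ((1 + 2 * pi) / 2 * N) by rewrite /DD; field.
have Bc i := B i cos (@continuous_cos R) cos1 cos_lipschitz.
have Bs i := B i sin (@continuous_sin R) sin1 sin_lipschitz.
rewrite !hE; case: im {hE}.
  by rewrite opprD addrACA; apply: le_trans (ler_normD _ _) _; apply: lerD.
rewrite opprD opprK addrACA; apply: le_trans (ler_normD _ _) _; apply: lerD => //.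
by rewrite addrC distrC; exact: Bs.
Qed.

End Herglotz.

Section Powers.
Context {R : realType}.

Lemma powR_pinfty (a : nat -> R) (d : R) : 0 < d -> (forall n, 0 <= a n) ->
  a n @[n --> \oo] --> +oo -> a n `^ d @[n --> \oo] --> +oo.
Proof.
move=> d0 a0 /cvgryPge ca; apply/cvgryPge => A.
have B0 : 0 <= `|A| + 1 by rewrite addr_ge0.
have := ca ((`|A| + 1) `^ d^-1); apply: filterS => n an.
apply: (@le_trans _ _ (`|A| + 1)); first by apply: le_trans (ler_norm _) _; rewrite lerDl.
have -> : `|A| + 1 = ((`|A| + 1) `^ d^-1) `^ d by rewrite -powRrM mulVf ?gt_eqF// powRr1.
by rewrite ge0_ler_powR ?(ltW d0)// nnegrE// powR_ge0.
Qed.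

Lemma powR_cvgV (a : nat -> R) (d : R) : 0 < d -> (forall n, 0 < a n) ->
  a n @[n --> \oo] --> +oo -> a n `^ (- d) @[n --> \oo] --> (0 : R).
Proof.
move=> d0 a0 ca; under eq_fun do rewrite powRN.
apply/gtr0_cvgV0; first by apply: nearW => n; rewrite powR_gt0.
by apply: powR_pinfty => // n; exact: ltW.
Qed.

Lemma natS_pinfty : (n.+1%:R : R) @[n --> \oo] --> +oo.
Proof. by have := @cvgr_idn R; rewrite -(cvg_shiftS (fun n : nat => n%:R : R)). Qed.

End Powers.

Section L2Decay.
Context {R : realType}.
Variables (e : plane R) (c l M : R).
Hypothesis e1 : e.1 ^+ 2 + e.2 ^+ 2 = 1.
Hypothesis c0 : 0 < c.
Hypothesis l0 : 0 < l.
Hypothesis M0 : 0 < M.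
Notation S := (cone_rect e c l M : set (mplane R)).

Let mS : measurable S := measurable_cone_rect e c l M.

Lemma integral_decay_sq tau : 0 < tau ->
  area.-integrable S (EFin \o (fun x => decay e tau x ^+ 2)) /\
  \int[area]_(x in S) (decay e tau x ^+ 2) <= (2 * c * tau ^+ 2)^-1.
Proof.
move=> tau0; have t2 : 0 < 2 * tau by rewrite mulr_gt0.
have E : (fun x => decay e tau x ^+ 2) = decay e (2 * tau).
  by apply/funext => x; rewrite /decay expr2 -expRD; congr expR; ring.
have I := continuous_integrable_cone l M e1 c0 (@continuous_decay R e (2 * tau)).
rewrite E; split; first exact: I.
rewrite -lee_fin -EFin_Rintegral//; apply: le_trans (integral_decay e1 c0 l0 M0 t2) _.
by rewrite lee_fin le_eqVlt; apply/orP; left; apply/eqP; field; rewrite !gt_eqF.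
Qed.

(** The exponential has L^2 norm O(1 / tau), so an error of L^2 size t costs tau t at the scale
    tau^2. *)
Lemma L2r_decay_le (d : plane R -> R) (t tau : R) : L2r area S d -> 0 < t -> 0 < tau ->
  (\int[area]_(x in S) (d x ^+ 2)%:E <= (t ^+ 2)%:E)%E ->
  area.-integrable S (EFin \o (fun x => `|d x| * decay e tau x)) /\
  tau ^+ 2 * \int[area]_(x in S) (`|d x| * decay e tau x) <= (1 / 2 + 1 / (4 * c)) * (tau * t).
Proof.
move=> Ld t0 tau0 dt.
have [IW W2] := integral_decay_sq tau0.
have mW : measurable_fun S (decay e tau).
  by apply: continuous_measurable_plane => //; exact: continuous_decay.
have LW : L2r area S (decay e tau) by exact: L2r_of_sq.
have Id := L2r_sq_integrable mS Ld.
have IdW := L2r_mul mS (L2r_abs Ld) LW.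
split; first exact: IdW.
have Id2 : \int[area]_(x in S) (d x ^+ 2) <= t ^+ 2 by rewrite -lee_fin -EFin_Rintegral.
(* These Young weights balance the terms: t^2 for d^2 and O(tau^(-2)) for the squared exponential
   both become multiples of t / tau. *)
pose p := (2 * tau * t)^-1; pose q := tau * t / 2.
have p0 : 0 < p by rewrite invr_gt0 !mulr_gt0.
have q0 : 0 < q by rewrite divr_gt0// mulr_gt0.
have Ip := integrableZl mS p Id; have Iq := integrableZl mS q IW.
have H : \int[area]_(x in S) (`|d x| * decay e tau x) <=
    \int[area]_(x in S) (p * d x ^+ 2 + q * decay e tau x ^+ 2).
  apply: le_Rintegral => //; first exact: (integrableD mS Ip Iq).
  move=> x _; rewrite -subr_ge0.
  have -> : p * d x ^+ 2 + q * decay e tau x ^+ 2 - `|d x| * decay e tau x =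
     p * (`|d x| - tau * t * decay e tau x) ^+ 2.
    by rewrite -[d x ^+ 2]real_normK ?num_real// /p /q; field; rewrite !gt_eqF.
  by rewrite mulr_ge0 ?sqr_ge0// ltW.
have E := RintegralD mS Ip Iq; rewrite (RintegralZl p mS Id) (RintegralZl q mS IW) in E.
have H2 : \int[area]_(x in S) (`|d x| * decay e tau x) <= p * t ^+ 2 + q * (2 * c * tau ^+ 2)^-1.
  apply: le_trans H _; rewrite [leLHS]E; apply: lerD; by rewrite ler_wpM2l// ltW.
apply: (@le_trans _ _ (tau ^+ 2 * (p * t ^+ 2 + q * (2 * c * tau ^+ 2)^-1))).
  by rewrite ler_wpM2l ?sqr_ge0.
by rewrite le_eqVlt /p /q; apply/orP; left; apply/eqP; field; rewrite !gt_eqF.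
Qed.

End L2Decay.

Section HerglotzApproximation.
Context {R : realType}.
Variables (D : set (plane R)) (v : plane R -> R[i]) (k beta gamma : R) (g : nat -> plane R -> R[i]).
Hypothesis mD : measurable (D : set (mplane R)).
Hypothesis Lv : forall im, L2r area (D : set (mplane R)) (fun x => cpart im (v x)).
Hypothesis bD : bounded_set D.
Hypothesis k0 : 0 < k.
Hypothesis Hg : forall j, (1 <= j)%N ->
  [/\ L2_circle (g j),
    (H1norm D (fun x => (v x - herglotz k (g j) x)%R) <= (j%:R `^ (- beta))%:E)%E &
    (L2_circle_norm (g j) <= (j%:R `^ gamma)%:E)%E].

Let a (n : nat) : R := n.+1%:R.
(** The shift matches sequences indexed from 0 with approximants indexed from j = 1. *)
Definition hwave (n : nat) : plane R -> R[i] := herglotz k (g n.+1).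
Definition herror im (n : nat) x := cpart im (v x) - cpart im (hwave n x).

Let a0 n : 0 < a n. Proof. by rewrite ltr0Sn. Qed.

(** The factor 2 adds up the real and imaginary parts of the wave. *)
Definition lip : R := 2 * (k * (1 + 2 * pi)).

Lemma lip_ge0 : 0 <= lip.
Proof. by rewrite !mulr_ge0 ?(ltW k0)// addr_ge0// mulr_ge0// pi_ge0. Qed.

Lemma hwave_lipschitz im n x y :
  `|cpart im (hwave n x) - cpart im (hwave n y)| <=
   k * (1 + 2 * pi) * (a n `^ gamma) * (`|x.1 - y.1| + `|x.2 - y.2|).
Proof.
have [Lg _ Ng] := Hg (ltn0Sn n).
by apply: herglotz_lipschitz => //; rewrite powR_gt0.
Qed.

Lemma hwave_normc n x : Normc.normc (hwave n x - hwave n 0) <= lip * (a n `^ gamma) * (`|x.1| + `|x.2|).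
Proof.
apply: le_trans (normc_le_parts _) _; rewrite !cpartB.
have B im := hwave_lipschitz im n x 0.
have := lerD (B false) (B true); rewrite !subr0 => /le_trans; apply.
by rewrite /lip le_eqVlt; apply/orP; left; apply/eqP; ring.
Qed.

Lemma continuous_hwave im n : continuous (fun x => cpart im (hwave n x)).
Proof.
set C := k * (1 + 2 * pi) * (a n `^ gamma) + 1.
have C0 : 0 < C.
  by rewrite ltr_wpDl// mulr_ge0 ?powR_ge0// mulr_ge0 ?(ltW k0)// addr_ge0// mulr_ge0// pi_ge0.
move=> x; apply/cvgrPdist_le => eps eps0.
suff : nbhs (x : plane R) [set y | `|cpart im (hwave n x) - cpart im (hwave n y)| <= eps] by [].
apply/nbhs_ballP; exists (eps / (2 * C)) => /=; first by rewrite divr_gt0// mulr_gt0.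
move=> y [y1 y2]; apply: le_trans (hwave_lipschitz im n x y) _.
apply: (@le_trans _ _ (C * (eps / (2 * C) + eps / (2 * C)))).
  apply: ler_pM.
  - by rewrite mulr_ge0 ?powR_ge0// mulr_ge0 ?(ltW k0)// addr_ge0// mulr_ge0// pi_ge0.
  - by rewrite addr_ge0.
  - by rewrite /C lerDl.
  - by apply: lerD; exact: ltW.
by rewrite le_eqVlt; apply/orP; left; apply/eqP; field; rewrite gt_eqF.
Qed.

Lemma L2r_herror im n : L2r area (D : set (mplane R)) (herror im n) /\
  (\int[area]_(x in (D : set (mplane R))) (herror im n x ^+ 2)%:E <= ((a n `^ (- beta)) ^+ 2)%:E)%E.
Proof.
have mw : measurable_fun (D : set (mplane R)) (fun x => cpart im (hwave n x)).
  by apply: continuous_measurable_plane => //; exact: continuous_hwave.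
have [M M1 DM] := bounded_sub_cbox bD.
have [C C0 HC] := continuous_bounded_cbox M (@continuous_hwave im n).
have Lw : L2r area (D : set (mplane R)) (fun x => cpart im (hwave n x)).
  by apply: (@L2r_bounded _ _ _ _ _ _ C) => //; [exact: bounded_area | move=> x /DM; exact: HC].
split; first exact: L2r_B.
have [_ Ng _] := Hg (ltn0Sn n).
have q0 (f : plane R -> R[i]) : (0 <= sqint area D f)%E.
  by apply: integral_ge0 => x _; rewrite lee_fin sqr_ge0.
apply: le_trans (poweR_half_le (adde_ge0 (adde_ge0 (q0 _) (q0 _)) (q0 _)) (powR_ge0 _ _) Ng).
rewrite -addeA; apply: (@le_trans _ _ (sqint area D (fun x => (v x - herglotz k (g n.+1) x)%R))); last first.
  by rewrite leeDl//; apply: adde_ge0; exact: q0.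
apply: ge0_le_integralW => x _; first by rewrite lee_fin sqr_ge0.
by rewrite lee_fin /herror -cpartB; apply: sqr_le_bound; exact: cpart_le_normc.
Qed.

End HerglotzApproximation.

Section HerglotzValue.
Context {R : realType}.
Variables (e : plane R) (c m : R).
Hypothesis e1 : e.1 ^+ 2 + e.2 ^+ 2 = 1.
Hypothesis c0 : 0 < c.
Hypothesis m0 : 0 < m.
Let l : R := 3 * m / c.
Let M : R := 3 * m.
Notation S := (cone_rect e c l M : set (mplane R)).

Let mS : measurable S := measurable_cone_rect e c l M.
Let l0 : 0 < l. Proof. by rewrite divr_gt0// mulr_gt0. Qed.
Let M0 : 0 < M. Proof. by rewrite mulr_gt0. Qed.

Variables (D : set (plane R)) (V v Q : plane R -> R[i]) (K : R).
Hypothesis SD : S `<=` D.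
Hypothesis D0 : closure D 0.
Hypothesis rQ : continuous_rep D (fun x => 1 + V x) Q.
Hypothesis K0 : 0 <= K.
Hypothesis VK : {ae area, forall x, S x -> Normc.normc (V x) <= K}.
Hypothesis LP : forall im, L2r area S (fun x => cpart im (V x * v x)).
Hypothesis corner : forall im (tau : nat -> R), (forall n, 0 < tau n) ->
  tau n @[n --> \oo] --> +oo ->
  tau n ^+ 2 * \int[area]_(x in S) (cpart im (V x * v x) * probe e c m (tau n) x) @[n --> \oo] --> (0 : R).

Variables (k beta gamma : R) (g : nat -> plane R -> R[i]).
Hypothesis mD : measurable (D : set (mplane R)).
Hypothesis Lv : forall im, L2r area (D : set (mplane R)) (fun x => cpart im (v x)).
Hypothesis bD : bounded_set D.
Hypothesis k0 : 0 < k.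
Hypothesis gamma0 : 0 < gamma.
Hypothesis gb : gamma < beta.
Hypothesis Hg : forall j, (1 <= j)%N ->
  [/\ L2_circle (g j),
    (H1norm D (fun x => (v x - herglotz k (g j) x)%R) <= (j%:R `^ (- beta))%:E)%E &
    (L2_circle_norm (g j) <= (j%:R `^ gamma)%:E)%E].

Let a (n : nat) : R := n.+1%:R.
Let sigma : R := (gamma + beta) / 2.
Let tau n : R := a n `^ sigma.

Let a0 n : 0 < a n. Proof. by rewrite ltr0Sn. Qed.
Let tau0 n : 0 < tau n. Proof. by rewrite powR_gt0. Qed.
Let sigma0 : 0 < sigma. Proof. by rewrite divr_gt0// addr_gt0// (lt_trans gamma0). Qed.
Let ca : a n @[n --> \oo] --> +oo. Proof. exact: natS_pinfty. Qed.
Let ctau : tau n @[n --> \oo] --> +oo.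
Proof. by apply: powR_pinfty => // n; exact: ltW. Qed.

Let N n : R := Normc.normc (hwave k g n 0).
Let C1 : R := 1 / 2 + 1 / (4 * c).
Let L : R := 2 * (lip k * (1 + c^-1)).

Let L0 : 0 <= L.
Proof.
apply: mulr_ge0 => //; apply: mulr_ge0; first exact: lip_ge0.
by rewrite addr_ge0// invr_ge0 ltW.
Qed.

Let q := Normc.normc (Q 0 - 1).

Let sum_bound (KK lg x1 x2 y d b n' : R) : 0 <= KK -> 0 <= lg ->
  `|x1| <= (1 + c^-1) * y -> `|x2| <= (1 + c^-1) * y ->
  KK * (lg * (`|x1| + `|x2|)) + (d + b * y) * n' <=
  d * n' + (b * n' + KK * (2 * (lg * (1 + c^-1)))) * y.
Proof.
move=> KK0 lg0 h1 h2.
have h : KK * (lg * (`|x1| + `|x2|)) <= KK * (lg * ((1 + c^-1) * y + (1 + c^-1) * y)).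
  by rewrite ler_wpM2l// ler_wpM2l// lerD.
by apply: (le_trans (lerD h (lexx _))); rewrite le_eqVlt; apply/orP; left; apply/eqP; ring.
Qed.

Let L_assoc (b n' t KK : R) : b * n' + KK * L * t = b * n' + KK * (2 * (lip k * t * (1 + c^-1))).
Proof. by rewrite /L; ring. Qed.

Let twice_bound (X Y C s : R) : X <= C * s -> Y <= C * s -> X + Y <= 2 * C * s.
Proof. by lra. Qed.

(* V v - V(0) v_j(0) = V (v - v_j) + V (v_j - v_j(0)) + (V - V(0)) v_j(0). *)
Lemma corner_error im d b n : 0 <= d -> 0 <= b ->
  {ae area, forall x, S x -> Normc.normc (V x - (Q 0 - 1)) <= d + b * height e x} ->
  tau n ^+ 2 * \int[area]_(x in S)
    (`|cpart im (V x * v x) - cpart im ((Q 0 - 1) * hwave k g n 0)| * decay e (tau n) x) <=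
  K * (2 * C1 * (tau n * a n `^ (- beta))) +
  (2 * (d * N n) / c + 16 * (b * N n + K * L * a n `^ gamma) / (c * tau n)).
Proof.
move=> d0 b0 ae; pose DW im' x := `|herror v k g im' n x| * decay e (tau n) x.
have an0 : 0 < a n `^ (- beta) by rewrite powR_gt0.
have mW : measurable_fun S (decay e (tau n)).
  by apply: continuous_measurable_plane => //; exact: continuous_decay.
have HD im' : area.-integrable S (EFin \o DW im') /\
    tau n ^+ 2 * \int[area]_(x in S) DW im' x <= C1 * (tau n * a n `^ (- beta)).
  have [L1 L2'] := L2r_herror mD Lv bD k0 Hg im' n.
  apply: (L2r_decay_le e1 c0 l0 M0 (L2r_subset mD mS SD L1) an0 (tau0 n)).
  apply: le_trans L2'; apply: ge0_le_integral_subset => // x _; by rewrite lee_fin sqr_ge0.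
have N0 : 0 <= N n by exact: normc_ge0.
(* The affine majorant of the last two terms of the decomposition: d and b come from V - V(0),
   multiplied by |v_j(0)|, and the term in L from the oscillation of v_j. *)
pose A := d * N n; pose B := b * N n + K * L * a n `^ gamma.
have A0 : 0 <= A by rewrite mulr_ge0.
have B0 : 0 <= B by apply: addr_ge0; apply: mulr_ge0 => //; [apply: mulr_ge0 | exact: powR_ge0].
have maff : measurable_fun S (fun x => A + B * height e x).
  apply: continuous_measurable_plane => // x; apply: cvgD; first exact: cvg_cst.
  by apply: cvgMl_tmp; exact: continuous_dotr.
have affE x : S x -> `|A + B * height e x| = A + B * height e x.
  by move=> /(cone_rect_height c0)[y0 _]; rewrite ger0_norm// addr_ge0// mulr_ge0// ltW.
have aeA : {ae area, forall x, S x -> `|A + B * height e x| <= A + B * height e x}.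
  by apply: aeW => x Sx; rewrite affE.
have [IA leA] := decay_affine e1 c0 l0 M0 maff (tau0 n) A0 B0 aeA.
have [[If lef] [It let_]] := (HD false, HD true).
have mP : measurable_fun S (fun x => cpart im (V x * v x) - cpart im ((Q 0 - 1) * hwave k g n 0)).
  by apply: measurable_funB => //; case: (LP im).
have IK := integrableZl mS K (integrableD mS If It).
have IB := integrableD mS IK IA.
have ptw : {ae area, forall x, S x ->
    `|cpart im (V x * v x) - cpart im ((Q 0 - 1) * hwave k g n 0)| * decay e (tau n) x <=
    K * (DW false x + DW true x) + `|A + B * height e x| * decay e (tau n) x}.
  apply: ae_area_mono (ae_area_and ae VK) => x [xd xK] Sx.
  rewrite /DW -mulrDl mulrA -mulrDl ler_wpM2r ?expR_ge0// affE//.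
  rewrite -cpartB; apply: le_trans (cpart_le_normc _ _) _.
  have -> : V x * v x - (Q 0 - 1) * hwave k g n 0 = V x * (v x - hwave k g n x) +
     (V x * (hwave k g n x - hwave k g n 0) + (V x - (Q 0 - 1)) * hwave k g n 0) by ring.
  have y0 := (cone_rect_height c0 Sx).1.
  have /cboxP[x1 x2] := cone_rect_cbox_height e1 c0 Sx.
  have hl := hwave_normc k0 Hg n x.
  have hp := normc_le_parts (v x - hwave k g n x); rewrite !cpartB in hp.
  apply: le_trans (normcD_le _ _) _; rewrite Normc.normcM.
  have t1 : Normc.normc (V x) * Normc.normc (v x - hwave k g n x) <=
      K * (`|herror v k g false n x| + `|herror v k g true n x|).
    by apply: ler_pM => //; [exact: normc_ge0|exact: normc_ge0|exact: xK].
  have t2 : Normc.normc (V x * (hwave k g n x - hwave k g n 0) + (V x - (Q 0 - 1)) * hwave k g n 0) <=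
     K * (lip k * a n `^ gamma * (`|x.1| + `|x.2|)) + (d + b * height e x) * N n.
    apply: le_trans (normcD_le _ _) _; rewrite !Normc.normcM; apply: lerD.
      by apply: ler_pM => //; [exact: normc_ge0|exact: normc_ge0|exact: xK].
    by rewrite ler_wpM2r// xd.
  apply: le_trans (lerD t1 t2) _; rewrite lerD2l.
  have lg : 0 <= lip k * a n `^ gamma by apply: mulr_ge0; [exact: lip_ge0|exact: powR_ge0].
  have -> : B = b * N n + K * (2 * (lip k * a n `^ gamma * (1 + c^-1))) by exact: L_assoc.
  exact: (sum_bound _ _ _ K0 lg x1 x2).
have [_ le1] := integrable_ae_le mS
  (measurable_funM (measurableT_comp (@normr_measurable R setT) mP) mW) IB
  (fun x _ => mulr_ge0 (normr_ge0 _) (expR_ge0 _))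
  (fun x Sx => addr_ge0 (mulr_ge0 K0 (addr_ge0 (mulr_ge0 (normr_ge0 _) (expR_ge0 _)) (mulr_ge0 (normr_ge0 _) (expR_ge0 _))))
     (mulr_ge0 (normr_ge0 _) (expR_ge0 _))) ptw.
have E := RintegralD mS IK IA.
have E2 := RintegralZl K mS (integrableD mS If It).
have E3 := RintegralD mS If It.
have tot : tau n ^+ 2 * \int[area]_(x in S)
    (`|cpart im (V x * v x) - cpart im ((Q 0 - 1) * hwave k g n 0)| * decay e (tau n) x) <=
   tau n ^+ 2 * (K * (\int[area]_(x in S) DW false x + \int[area]_(x in S) DW true x) +
     \int[area]_(x in S) (`|A + B * height e x| * decay e (tau n) x)).
  rewrite ler_wpM2l ?sqr_ge0//; apply: le_trans le1 _.
  by rewrite [leLHS]E [X in X + _]E2 [X in K * X]E3.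
apply: le_trans tot _; rewrite mulrDr; apply: lerD; last exact: leA.
rewrite mulrCA ler_wpM2l// mulrDr.
exact: twice_bound lef let_.
Qed.

Let near_le (X : nat -> R) (t : R) : 0 <= t -> X n @[n --> \oo] --> (0 : R) ->
  forall eps, 0 < eps -> \forall n \near \oo, t * X n <= eps.
Proof.
move=> t0 cX eps eps0.
have H : t * X n @[n --> \oo] --> (0 : R) by rewrite -(mulr0 t); exact: cvgMl_tmp.
have /cvgrPdist_le/(_ _ eps0) := H; apply: filterS => n.
by rewrite sub0r normrN; apply: le_trans; exact: ler_norm.
Qed.

Let error_sum (K' C' X d N' cc b L' G T eps : R) : 0 < cc -> 0 < T -> 0 <= N' ->
  d = eps * cc / 4 ->
  K' * (2 * C') * X <= eps / 2 -> 16 * b / cc * T^-1 <= eps / 2 -> 16 * (K' * L') / cc * (G * T^-1) <= eps / 2 ->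
  K' * (2 * C' * X) + (2 * (d * N') / cc + 16 * (b * N' + K' * L' * G) / (cc * T)) <= eps * (1 + N').
Proof.
move=> cc0 T0 N0 -> h1 h2 h3.
have h4 : 16 * b / cc * T^-1 * N' <= eps / 2 * N' by rewrite ler_wpM2r.
have -> : K' * (2 * C' * X) + (2 * (eps * cc / 4 * N') / cc + 16 * (b * N' + K' * L' * G) / (cc * T)) =
  K' * (2 * C') * X + eps / 2 * N' + 16 * b / cc * T^-1 * N' + 16 * (K' * L') / cc * (G * T^-1).
  by field; rewrite !gt_eqF.
by lra.
Qed.

Let value_bound (q' n' eta eps : R) : 0 < q' -> 0 < eta -> 0 <= n' -> eps <= q' / 4 -> eps <= q' * eta / 8 ->
  q' * n' <= eps * (1 + n') + eps * (1 + n') -> n' <= eta.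
Proof.
move=> q0 eta0 n0 h1 h2 h.
have h3 : eps * n' <= q' / 4 * n' by rewrite ler_wpM2r.
rewrite -(@ler_pM2l _ (q' / 2)) ?divr_gt0//.
have : 0 <= q' * eta by rewrite mulr_ge0// ltW.
by lra.
Qed.

(** The error bound contains |v_j(0)| itself, but with an arbitrarily small coefficient, while the
    left-hand side contains it with the fixed coefficient |Q(0) - 1|. *)
Lemma hwave_value_cvg : Q 0 <> 1 -> Normc.normc (hwave k g n 0) @[n --> \oo] --> (0 : R).
Proof.
move=> Q1.
have q0 : 0 < q.
  rewrite lt0r normc_ge0 andbT; apply/eqP => /Normc.eq0_normc /eqP.
  by rewrite subr_eq0 => /eqP.
have C10 : 0 <= C1 by rewrite addr_ge0// divr_ge0// mulr_ge0// ltW.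
have an n : a n != 0 by rewrite gt_eqF.
have cX : tau n * a n `^ (- beta) @[n --> \oo] --> (0 : R).
  have bs : 0 < beta - sigma by rewrite /sigma; move: gb; lra.
  have H := powR_cvgV bs a0 ca.
  rewrite (_ : (fun n => _) = (fun n => a n `^ (- (beta - sigma)))); first exact: H.
  apply/funext => n; rewrite /tau -powRD; last by rewrite an implybT.
  by congr (_ `^ _); ring.
have cG : a n `^ gamma * (tau n)^-1 @[n --> \oo] --> (0 : R).
  have bs : 0 < sigma - gamma by rewrite /sigma; move: gb; lra.
  have H := powR_cvgV bs a0 ca.
  rewrite (_ : (fun n => _) = (fun n => a n `^ (- (sigma - gamma)))); first exact: H.
  apply/funext => n; rewrite /tau -powRN -powRD; last by rewrite an implybT.
  by congr (_ `^ _); ring.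
have cT := invtau_cvg tau0 ctau.
have parts eps : 0 < eps -> forall im, \forall n \near \oo,
    `|cpart im ((Q 0 - 1) * hwave k g n 0)| <= eps * (1 + N n).
  move=> eps0 im; apply: (limit_value e1 c0 m0 tau0 ctau (LP im) (corner im tau0 ctau) (N := N)) eps0.
    by move=> n; exact: normc_ge0.
  (* In the target eps (1 + N n), the multiple of N n is shared equally by d and b, and the constant
     eps by the approximation error and the oscillation. *)
  move=> {}eps eps0; pose d := eps * c / 4.
  have d0 : 0 < d by rewrite divr_gt0// mulr_gt0.
  have [b b0 ae] := Q_affine e1 c0 SD D0 rQ K0 VK d0.
  have e2 : 0 < eps / 2 by rewrite divr_gt0.
  have H1 := near_le (mulr_ge0 K0 (mulr_ge0 (ler0n _ 2) C10)) cX e2.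
  have H2 := near_le (divr_ge0 (mulr_ge0 (ler0n _ 16) b0) (ltW c0)) cT e2.
  have H3 := near_le (divr_ge0 (mulr_ge0 (ler0n _ 16) (mulr_ge0 K0 L0)) (ltW c0)) cG e2.
  near=> n; apply: le_trans (corner_error im n (ltW d0) b0 ae) _.
  apply: error_sum => //; first exact: normc_ge0.
  - by near: n.
  - by near: n.
  - by near: n.
apply/cvgrPdist_le => eta eta0.
(* Summing the two parts gives q N <= 2 eps (1 + N): the bound q / 4 absorbs N into the left-hand
   side, and q eta / 8 makes the rest small. *)
pose eps := Num.min (q / 4) (q * eta / 8).
have eps0 : 0 < eps by rewrite lt_min !divr_gt0// mulr_gt0.
have P0 := parts _ eps0 false; have P1 := parts _ eps0 true.
near=> n; rewrite sub0r normrN ger0_norm ?normc_ge0//.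
have h1 : eps <= q / 4 by rewrite ge_min lexx.
have h2 : eps <= q * eta / 8 by rewrite ge_min lexx orbT.
apply: (value_bound q0 eta0 (normc_ge0 _) h1 h2).
rewrite -[q * _]Normc.normcM; apply: le_trans (normc_le_parts _) _.
by apply: lerD; near: n.
Unshelve. all: by end_near.
Qed.

End HerglotzValue.

(** n is the integer part of y = s^(-1/sigma); since y >= 1, n + 1 is at most 2 y, whence the factor
    2^sigma. *)
Lemma exists_scale (R : realType) (sigma s : R) : 0 < sigma -> 0 < s -> s <= 1 ->
  exists n : nat, s^-1 <= n.+1%:R `^ sigma /\ n.+1%:R `^ sigma <= 2 `^ sigma * s^-1.
Proof.
move=> sig0 s0 s1; have is1 : 1 <= s^-1 by rewrite invf_ge1.
have is0 : 0 <= s^-1 by rewrite invr_ge0 ltW.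
pose y := s^-1 `^ sigma^-1.
have y0 : 0 <= y by exact: powR_ge0.
have y1 : 1 <= y.
  rewrite [leLHS](_ : 1 = 1 `^ sigma^-1); last by rewrite powR1.
  by rewrite /y ge0_ler_powR ?nnegrE// invr_ge0 ltW.
have yE : y `^ sigma = s^-1 by rewrite -powRrM mulVf ?gt_eqF// powRr1.
have /andP[ny yn] := truncn_itv y0.
exists (Num.trunc y); split.
  by rewrite -[leLHS]yE ge0_ler_powR ?(ltW sig0) ?nnegrE ?(ltW yn).
rewrite -[in leRHS]yE -powRM// ge0_ler_powR ?(ltW sig0) ?nnegrE ?mulr_ge0//.
by rewrite -natr1; lra.
Qed.

(** * Averages over small discs *)

Section Averages.
Context {R : realType}.
Variables (e : plane R) (c h : R).
Hypothesis e1 : e.1 ^+ 2 + e.2 ^+ 2 = 1.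
Hypothesis c0 : 0 < c.
Variable Omega : set (plane R).
Hypothesis oO : open Omega.
Hypothesis Ocone : forall x, disc 0 h x -> (Omega x <-> 0 < sc e c x).
Notation D := (Omega `&` disc 0 h).
Notation B s := (disc 0 s `&` Omega).

Lemma disc_sub_cbox (s : R) : disc 0 s `<=` cbox s.
Proof. by move=> x; rewrite disc0E => /= xs; apply: cbox_mono (cbox_le_enorm x); exact: ltW. Qed.

Lemma measurable_ball s : measurable (B s : set (mplane R)).
Proof. by apply: measurable_open; apply: openI => //; exact: open_disc0. Qed.

Lemma bounded_ball s : bounded_set (B s).
Proof.
have [N [Nr HN]] := @bounded_cbox R s; exists N; split=> // N' N'N x [xs _].
exact: HN _ N'N _ (disc_sub_cbox xs).
Qed.

Lemma area_ball_le s : 0 < s -> (area (B s : set (mplane R)) <= (4 * s ^+ 2)%:E)%E.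
Proof.
move=> s0; have -> : 4 * s ^+ 2 = (2 * s) ^+ 2 by ring.
rewrite -(area_cbox (ltW s0)); apply: le_measure; rewrite ?inE.
- exact: measurable_ball.
- exact: measurable_cbox.
- by move=> x [/disc_sub_cbox].
Qed.

(** With l = s / (4 (2 + c)), the region [cone_rect e c l l] lies in the box of half-side (2 + c) l
    = s / 4, hence in the disc of radius s, and has area 2 l^2. *)
Definition area_const : R := (8 * (2 + c) ^+ 2)^-1.

Lemma area_const_gt0 : 0 < area_const.
Proof. by rewrite invr_gt0 mulr_gt0// exprn_gt0// addr_gt0. Qed.

Lemma area_ball_ge s : 0 < s -> s <= h -> ((area_const * s ^+ 2)%:E <= area (B s : set (mplane R)))%E.
Proof.
move=> s0 sh; have c2 : 0 < 2 + c by rewrite addr_gt0.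
pose l := s / (4 * (2 + c)); have l0 : 0 < l by rewrite divr_gt0// mulr_gt0.
have -> : area_const * s ^+ 2 = 2 * l * l by rewrite /area_const /l; field; rewrite gt_eqF.
rewrite -(@area_cone_rect R e c l l e1)//; apply: le_measure; rewrite ?inE.
- exact: measurable_cone_rect.
- exact: measurable_ball.
- move=> x Sx; have xs : disc 0 s x.
    rewrite disc0E /=; apply: le_lt_trans (enorm_le_cbox (cone_rect_cbox e1 c0 Sx)) _.
    have -> : 2 * (l + (l + c * l)) = s / 2 by rewrite /l; field; rewrite gt_eqF.
    by rewrite gtr_pMr// invf_lt1// ltr1n.
  split=> //; have Dx : disc 0 h x by move: xs; rewrite !disc0E /= => /lt_le_trans; apply.
  by apply/(Ocone Dx); case: Sx => _ /andP[].
Qed.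

Variables (v : plane R -> R[i]) (k beta gamma : R) (g : nat -> plane R -> R[i]).
Hypothesis Lv : forall im, L2r area (D : set (mplane R)) (fun x => cpart im (v x)).
Hypothesis k0 : 0 < k.
Hypothesis Hg : forall j, (1 <= j)%N ->
  [/\ L2_circle (g j),
    (H1norm D (fun x => (v x - herglotz k (g j) x)%R) <= (j%:R `^ (- beta))%:E)%E &
    (L2_circle_norm (g j) <= (j%:R `^ gamma)%:E)%E].

Let a (n : nat) : R := n.+1%:R.
Let N n : R := Normc.normc (hwave k g n 0).
Let t n : R := a n `^ (- beta).

Let mD : measurable (D : set (mplane R)).
Proof. by apply: measurable_open; apply: openI => //; exact: open_disc0. Qed.

Let bD : bounded_set D.
Proof.
have [M [Mr HM]] := @bounded_ball h; exists M; split=> // M' M'M x [Ox xs].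
exact: HM _ M'M _ (conj xs Ox).
Qed.

Let t0 n : 0 < t n. Proof. by rewrite powR_gt0// ltr0Sn. Qed.

Let young (s tt y : R) : 0 < s -> 0 < tt -> `|y| <= s / (2 * tt) * y ^+ 2 + tt / (2 * s).
Proof.
move=> s0 tt0; rewrite -subr_ge0.
have -> : s / (2 * tt) * y ^+ 2 + tt / (2 * s) - `|y| = (2 * s * tt)^-1 * (s * `|y| - tt) ^+ 2.
  by rewrite -[y ^+ 2]real_normK ?num_real//; field; rewrite !gt_eqF.
by rewrite mulr_ge0 ?sqr_ge0// invr_ge0 !mulr_ge0// ltW.
Qed.

Let BD s : s <= h -> B s `<=` D.
Proof. by move=> sh x [xs Ox]; split=> //; move: xs; rewrite !disc0E /= => /lt_le_trans; apply. Qed.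

Let young_total (s tt I A C : R) : 0 < s -> 0 < tt -> I <= tt ^+ 2 -> A <= 4 * s ^+ 2 ->
  s / (2 * tt) * I + (tt / (2 * s) + C) * A <= 5 / 2 * (s * tt) + C * A.
Proof.
move=> s0 tt0 hI hA.
have h1 : s / (2 * tt) * I <= s / (2 * tt) * tt ^+ 2.
  by rewrite ler_wpM2l// divr_ge0 ?(ltW s0)// mulr_ge0// ltW.
have h2 : tt / (2 * s) * A <= tt / (2 * s) * (4 * s ^+ 2).
  by rewrite ler_wpM2l// divr_ge0 ?(ltW tt0)// mulr_ge0// ltW.
have E1 : s / (2 * tt) * tt ^+ 2 = s * tt / 2 by field; rewrite gt_eqF.
have E2 : tt / (2 * s) * (4 * s ^+ 2) = 2 * (s * tt) by field; rewrite gt_eqF.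
by move: h1 h2; rewrite E1 E2 mulrDl; lra.
Qed.

Let average_bound (ac s tt A I C : R) : 0 < ac -> 0 < s -> 0 <= tt -> 0 < A -> ac * s ^+ 2 <= A ->
  I <= (5 / 2 * (s * tt) + C * A) + (5 / 2 * (s * tt) + C * A) ->
  A^-1 * I <= 5 / ac * (tt * s^-1) + 2 * C.
Proof.
move=> ac0 s0 tt0 A0 hA hI; rewrite ler_pdivrMl//; apply: le_trans hI _.
have -> : 5 / 2 * (s * tt) + C * A + (5 / 2 * (s * tt) + C * A) = 5 * (s * tt) + A * (2 * C) by field.
rewrite mulrDr lerD2r.
have -> : 5 * (s * tt) = 5 / ac * (tt * s^-1) * (ac * s ^+ 2) by field; rewrite !gt_eqF.
rewrite mulrC ler_wpM2r//; apply: mulr_ge0; first by rewrite divr_ge0// ltW.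
by rewrite mulr_ge0// invr_ge0 ltW.
Qed.

(** On the disc, v is split into v - v_j, the oscillation of v_j and v_j(0). For the first, Young's
    inequality with ratio s / t balances the squared error t^2 against the area, at most 4 s^2, and
    gives s t (1/2 + 2). *)
Lemma ball_part_le im s n : 0 < s -> s <= h ->
  area.-integrable (B s : set (mplane R)) (EFin \o (fun x => `|cpart im (v x)|)) /\
  \int[area]_(x in (B s : set (mplane R))) `|cpart im (v x)| <=
  5 / 2 * (s * t n) + (lip k * a n `^ gamma * s + N n) * fine (area (B s : set (mplane R))).
Proof.
move=> s0 sh; have mB := measurable_ball s.
have Bfin := bounded_area (@bounded_ball s) mB.
have LB := L2r_subset mD mB (BD sh) (Lv im).
have Iv := L2r_integrable mB Bfin (L2r_abs LB).
split; first exact: Iv.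
have [Lh hle] := L2r_herror mD Lv bD k0 Hg im n.
have LhB := L2r_subset mD mB (BD sh) Lh.
have Ih2 := L2r_sq_integrable mB LhB.
have h2 : \int[area]_(x in (B s : set (mplane R))) (herror v k g im n x ^+ 2) <= t n ^+ 2.
  rewrite -lee_fin -(EFin_Rintegral mB Ih2); apply: le_trans hle.
  by apply: ge0_le_integral_subset => [|x _|x _|x _] //; [exact: BD | rewrite lee_fin sqr_ge0..].
pose C := lip k * a n `^ gamma * s + N n.
pose p := s / (2 * t n); pose q := t n / (2 * s) + C.
have p0 : 0 <= p by rewrite divr_ge0 ?(ltW s0)// mulr_ge0// ltW.
have Iq : area.-integrable (B s : set (mplane R)) (EFin \o cst q).
  exact: (L2r_integrable mB Bfin (L2r_bounded mB Bfin (measurable_cst _) (fun x _ => lexx `|q|))).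
have Ip := integrableZl mB p Ih2.
have le1 : \int[area]_(x in (B s : set (mplane R))) `|cpart im (v x)| <=
    \int[area]_(x in (B s : set (mplane R))) (p * herror v k g im n x ^+ 2 + cst q x).
  apply: le_Rintegral => //; first exact: (integrableD mB Ip Iq).
  move=> x [xs _]; have /cboxP[x1 x2] := disc_sub_cbox xs.
  have hl := hwave_lipschitz k0 Hg im n x 0; rewrite !subr0 in hl.
  have lg : 0 <= k * (1 + 2 * pi) * a n `^ gamma.
    by rewrite mulr_ge0 ?powR_ge0// mulr_ge0 ?(ltW k0)// addr_ge0// mulr_ge0// pi_ge0.
  have hl2 : k * (1 + 2 * pi) * a n `^ gamma * (`|x.1| + `|x.2|) <= lip k * a n `^ gamma * s.
    have -> : lip k * a n `^ gamma * s = k * (1 + 2 * pi) * a n `^ gamma * (s + s) by rewrite /lip; ring.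
    by rewrite ler_wpM2l// lerD.
  have hN : `|cpart im (hwave k g n 0)| <= N n by exact: cpart_le_normc.
  have hE : cpart im (v x) = herror v k g im n x + ((cpart im (hwave k g n x) - cpart im (hwave k g n 0)) + cpart im (hwave k g n 0)).
    by rewrite /herror; ring.
  rewrite hE /cst /q [leRHS]addrA; apply: le_trans (ler_normD _ _) _; apply: lerD; first by apply: young.
  apply: le_trans (ler_normD _ _) _; apply: lerD => //.
  exact: le_trans hl hl2.
apply: le_trans le1 _; rewrite (RintegralD mB Ip Iq) (RintegralZl p mB Ih2) Rintegral_cst//.
have Af : area (B s : set (mplane R)) \is a fin_num by rewrite ge0_fin_numE.
have A4 : fine (area (B s : set (mplane R))) <= 4 * s ^+ 2 by rewrite -lee_fin fineK// area_ball_le.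
exact: (young_total _ s0 (t0 n) h2 A4).
Qed.

Lemma average_le s n : 0 < s -> s <= h ->
  `|(fine (area (B s : set (mplane R))))^-1 * \int[area]_(x in (B s : set (mplane R))) Normc.normc (v x)| <=
  5 / area_const * (t n * s^-1) + 2 * (lip k * a n `^ gamma * s + N n).
Proof.
move=> s0 sh; have mB := measurable_ball s.
have Bfin := bounded_area (@bounded_ball s) mB.
have Af : area (B s : set (mplane R)) \is a fin_num by rewrite ge0_fin_numE.
have A4 : area_const * s ^+ 2 <= fine (area (B s : set (mplane R))).
  by rewrite -lee_fin fineK// area_ball_ge.
have [If lef] := ball_part_le false n s0 sh; have [It let_] := ball_part_le true n s0 sh.
have I0 : 0 <= \int[area]_(x in (B s : set (mplane R))) Normc.normc (v x).
  by apply: Rintegral_ge0 => x _; exact: normc_ge0.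
have le1 : \int[area]_(x in (B s : set (mplane R))) Normc.normc (v x) <=
    \int[area]_(x in (B s : set (mplane R))) `|cpart false (v x)| +
    \int[area]_(x in (B s : set (mplane R))) `|cpart true (v x)|.
  rewrite -(RintegralD mB If It).
  have H : (\int[area]_(x in (B s : set (mplane R))) (Normc.normc (v x))%:E <=
     \int[area]_(x in (B s : set (mplane R))) (`|cpart false (v x)| + `|cpart true (v x)|)%:E)%E.
    apply: ge0_le_integralW => x _; rewrite lee_fin; [exact: normc_ge0 | exact: normc_le_parts].
  have F := integrable_fin_num mB (integrableD mB If It).
  have F1 : (\int[area]_(x in (B s : set (mplane R))) (Normc.normc (v x))%:E)%E \is a fin_num.
    rewrite ge0_fin_numE; last by apply: integral_ge0 => x _; rewrite lee_fin normc_ge0.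
    by apply: (le_lt_trans H); rewrite -ge0_fin_numE//; apply: integral_ge0 => x _; rewrite lee_fin addr_ge0.
  exact: (fine_le F1 F H).
have Ap : 0 < fine (area (B s : set (mplane R))).
  by apply: lt_le_trans A4; rewrite mulr_gt0 ?area_const_gt0// exprn_gt0.
rewrite ger0_norm; last by rewrite mulr_ge0// invr_ge0 ltW.
exact: (average_bound area_const_gt0 s0 (ltW (t0 n)) Ap A4 (le_trans le1 (lerD lef let_))).
Qed.

(* The index is coupled to the radius by j^sigma ~ 1/s with gamma < sigma < beta. *)
Lemma average_cvg : 0 < h -> 0 < gamma -> gamma < beta ->
  N n @[n --> \oo] --> (0 : R) ->
  (fine (area (B s : set (mplane R))))^-1 * \int[area]_(x in (B s : set (mplane R))) Normc.normc (v x)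
    @[s --> 0^'+] --> (0 : R).
Proof.
move=> h0 g0 gb cN; pose sigma := (gamma + beta) / 2.
have sig0 : 0 < sigma by rewrite divr_gt0// addr_gt0// (lt_trans g0).
have a0 n : 0 < a n by rewrite ltr0Sn.
have ca : a n @[n --> \oo] --> +oo := natS_pinfty.
have bs : 0 < beta - sigma by rewrite /sigma; move: gb; lra.
have sg : 0 < sigma - gamma by rewrite /sigma; move: gb; lra.
have cX := powR_cvgV bs a0 ca; have cY := powR_cvgV sg a0 ca.
pose F n := 5 / area_const * a n `^ (- (beta - sigma)) +
  2 * (lip k * 2 `^ sigma * a n `^ (- (sigma - gamma)) + N n).
have cF : F n @[n --> \oo] --> (0 : R).
  have H := cvgD (cvgMl_tmp (a := 5 / area_const) cX)
     (cvgMl_tmp (a := 2) (cvgD (cvgMl_tmp (a := lip k * 2 `^ sigma) cY) cN)).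
  have E : 5 / area_const * 0 + 2 * (lip k * 2 `^ sigma * 0 + 0) = 0 :> R by ring.
  by rewrite -[X in _ --> X]E; exact: H.
apply/cvgrPdist_le => eps eps0.
(* F bounds the average for every index attached to the radius, so it remains to force that index
   beyond n0. *)
have /cvgrPdist_le/(_ _ eps0) [n0 _ Hn0] := cF.
have an (n : nat) : a n != 0 by rewrite gt_eqF.
have b0 : 0 < (a n0 `^ sigma)^-1 by rewrite invr_gt0 powR_gt0.
near=> s.
have s0 : 0 < s by near: s; exact: nbhs_right_gt.
have sh : s <= h by near: s; apply: filterS (nbhs_right_lt h0) => z /ltW.
have s1 : s <= 1 by near: s; apply: filterS (nbhs_right_lt ltr01) => z /ltW.
have sn : s < (a n0 `^ sigma)^-1 by near: s; exact: nbhs_right_lt.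
have [n [l1 l2]] := exists_scale sig0 s0 s1.
(* The radius is below a(n0)^(-sigma), while a(n)^sigma is at least 1 / s. *)
have nn0 : (n0 <= n)%N.
  rewrite leqNgt; apply/negP => nlt.
  have : a n `^ sigma <= a n0 `^ sigma.
    by rewrite ge0_ler_powR ?(ltW sig0) ?nnegrE ?(ltW (a0 _))// ler_nat ltnS ltnW.
  have : a n0 `^ sigma < s^-1 by rewrite -[ltLHS]invrK ltf_pV2 ?posrE.
  by move=> /lt_le_trans/(_ l1) /lt_le_trans H /H; rewrite ltxx.
rewrite sub0r normrN; apply: le_trans (average_le n s0 sh) _.
have := Hn0 n nn0; rewrite sub0r normrN => /(le_trans (ler_norm _)); apply: le_trans.
apply: lerD.
  rewrite ler_wpM2l ?divr_ge0 ?(ltW area_const_gt0)//.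
  apply: (@le_trans _ _ (t n * a n `^ sigma)); first by rewrite ler_wpM2l// ltW.
  rewrite /t -powRD; last by rewrite an implybT.
  by rewrite le_eqVlt; apply/orP; left; apply/eqP; congr (_ `^ _); ring.
rewrite ler_wpM2l// lerD2r -mulrA -(mulrA (lip k)) ler_wpM2l ?lip_ge0//.
have as0 : 0 < a n `^ sigma by rewrite powR_gt0.
have sle : s <= 2 `^ sigma * (a n `^ sigma)^-1.
  by rewrite ler_pdivlMr// mulrC -ler_pdivlMr.
apply: (@le_trans _ _ (a n `^ gamma * (2 `^ sigma * (a n `^ sigma)^-1))).
  by rewrite ler_wpM2l ?powR_ge0.
rewrite mulrCA -powRN -powRD; last by rewrite an implybT.
by rewrite le_eqVlt; apply/orP; left; apply/eqP; congr (_ * _ `^ _); ring.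
Unshelve. all: by end_near.
Qed.

End Averages.

Unset Implicit Arguments.

Theorem corollary3p3 (R : realType) (Omega Gamma : set (plane R))
    (V v w : plane R -> R[i]) (k h tm tM : R) (Q : plane R -> R[i]) :
  let q := fun x => 1 + V x in
  let S_h := sector tm tM `&` disc 0 h in
  lipschitz_domain Omega ->
  bounded_set Omega ->
  connected (~` Omega) ->
  rel_open (bdry Omega) Gamma ->
  0 < k ->
  Linfty Omega V ->
  transmission_eigenfunctions Omega Gamma k q v w ->
  Gamma 0 ->
  - pi < tm -> tm < tM -> tM < pi -> 0 < tM - tm < pi ->
  0 < h ->
  Omega `&` disc 0 h = S_h ->
  Hk 2 S_h q ->
  continuous_rep S_h q Q ->
  Q 0 <> 1 ->
  (forall (beta gamma : R) (g : nat -> plane R -> R[i]),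
     0 < beta -> 0 < gamma -> gamma < beta ->
     (forall j, (1 <= j)%N ->
        [/\ L2_circle (g j),
            (H1norm S_h (fun x => (v x - herglotz k (g j) x)%R)
               <= (j%:R `^ (- beta))%:E)%E &
            (L2_circle_norm (g j) <= (j%:R `^ gamma)%:E)%E]) ->
     (fine (area (disc 0 l `&` Omega)))^-1 *
       (\int[area]_(x in disc 0 l `&` Omega) Normc.normc (v x))
       @[l --> 0^'+] --> (0 : R)) /\
  (forall (alpha : R) (v0 : plane R -> R[i]),
     0 < alpha < 1 ->
     ae_eq_on S_h v v0 ->
     hoelder_on alpha (closure S_h) v0 ->
     v0 0 = 0).
Proof.
move=> q S_h [oO _ _] bO _ [U oU GammaE] k0 LV TE G0 _ _ _ htheta h0 OmE _ rQ Q1.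
have [e [c [e1 c0 sectorE]]] := sector_cone htheta.
have Ocone x : disc 0 h x -> (Omega x <-> 0 < sc e c x).
  move=> Dx; rewrite -sectorE; split => [Ox|Sx].
    by have [] : S_h x by rewrite -OmE.
  by have [] : (Omega `&` disc 0 h) x by rewrite OmE.
have [bd0 U0] : (bdry Omega `&` U) 0 by rewrite -GammaE.
have [r r0 rU] := small_cbox oU U0 h0.
(* m solves 2 l + 6 m = r with l = 3 m / c. The box of half-side r then contains S, which lies in
   that of half-side l + 6 m, and the support of the probe, which lies in that of half-side 2 l + 2
   m. *)
pose m := r / (6 / c + 6).
have m0 : 0 < m by rewrite divr_gt0// addr_gt0// divr_gt0.
pose l := 3 * m / c; pose M := 3 * m.
have l0 : 0 < l by rewrite divr_gt0// mulr_gt0.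
have mrE : 2 * l + 6 * m = r.
  rewrite /l /m; field; rewrite gt_eqF//= gt_eqF//; have := c0; lra.
have mr : 2 * (3 * m / c) + 6 * m <= r by rewrite -mrE.
have lMr : l + (M + c * l) <= r.
  have cl : c * l = 3 * m by rewrite /l; field; rewrite gt_eqF.
  by rewrite cl -mrE /M; move: l0; lra.
have mS := measurable_cone_rect e c l M.
have mO := measurable_open oO.
have SO := cone_rect_Omega e1 c0 lMr rU Ocone.
have SD : cone_rect e c l M `<=` S_h.
  move=> x Sx; rewrite -OmE; split; first exact: SO.
  by have := cone_rect_cbox e1 c0 Sx => /(cbox_mono lMr)/rU[].
have Sr : cone_rect e c l M `<=` cbox r.
  by move=> x Sx; have := cone_rect_cbox e1 c0 Sx => /(cbox_mono lMr).
have [_ [K1 HK1]] := LV; pose K := `|K1|.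
have VK : {ae area, forall x, cone_rect e c l M x -> Normc.normc (V x) <= K}.
  by apply: ae_area_mono HK1 => x H Sx; apply: le_trans (H (SO _ Sx)) (ler_norm _).
(* 0 lies in Gamma, hence in the closure of Omega, and near 0 Omega coincides with S_h. *)
have D0 : closure S_h 0.
  rewrite -OmE => B nB; have [cl0 _] := bd0.
  have disc00 : disc 0 h (0 : plane R).
    by rewrite disc0E /= /enorm /= expr0n /= addr0 sqrtr0.
  have nBd : nbhs (0 : plane R) (B `&` disc 0 h).
    by apply: filterI => //; apply: open_nbhs_nbhs; split=> //; exact: open_disc0.
  by have [x [Ox [Bx Dx]]] := cl0 _ nBd; exists x.
have LP im : L2r area (cone_rect e c l M : set (mplane R)) (fun x => cpart im (V x * v x)).
  exact: (L2r_subset mO mS SO (L2r_Vv oO LV TE im)).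
have corner := corner_limit e1 c0 m0 h0 k0 mr oO bO oU GammaE rU Ocone LV TE.
have K0 : 0 <= K by exact: normr_ge0.
split; last first.
  move=> alpha v0 /andP[al0 _] vv0 Hv0.
  exact: (hoelder_corner_value e1 c0 m0 SD D0 rQ K0 VK LP corner al0 (ltW r0) Sr Hv0 vv0 Q1).
move=> beta gamma g b0 g0 gb Hg.
have oD : open (Omega `&` disc 0 h) by apply: openI => //; exact: open_disc0.
have mD : measurable (S_h : set (mplane R)) by rewrite -OmE; exact: measurable_open.
have bD : bounded_set S_h.
  have [N [Nr HN]] := bO; exists N; split=> // N' N'N x Dx.
  have [Ox _] : (Omega `&` disc 0 h) x by rewrite OmE.
  exact: HN _ N'N _ Ox.
have [[[Lv _] _] _ _ _ _] := TE.
have LvD im : L2r area (S_h : set (mplane R)) (fun x => cpart im (v x)).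
  apply: (L2r_subset mO mD _ (L2_part im mO Lv)).
  by rewrite -OmE => x [].
have cN := hwave_value_cvg e1 c0 m0 SD D0 rQ K0 VK LP corner mD LvD bD k0 g0 gb Hg Q1.
rewrite -OmE in Hg LvD.
exact: (average_cvg e1 c0 oO Ocone LvD k0 Hg h0 g0 gb cN).
Qed.
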